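(* Let $\mathcal H$ be an infinite-dimensional separable complex Hilbert space, and let $p,q\in[1,\infty]$ be conjugate, i.e. $\frac1p+\frac1q=1$. Let $C\in\mathcal B^p(\mathcal H)$ and $T\in\mathcal B^q(\mathcal H)$. Then the following statements hold. (a) If either $C$ or $T$ is normal with collinear eigenvalues, then $\overline{W_C(T)}$ is convex. (b) If $C$ and $T$ both are normal, then $$P_C(T)\subseteq W_C(T)\subseteq\operatorname{conv}(\overline{P_C(T)}).$$ (c) If $C$ and $T$ both are normal and the eigenvalues of $C$ or the eigenvalues of $T$ are collinear, then $$\overline{W_C(T)}=\operatorname{conv}(\overline{P_C(T)}).$$
   Context: Notation: $\mathcal B(\mathcal H)$ denotes the bounded linear operators on $\mathcal H$, and $U^\dagger$ denotes the Hilbert space adjoint of $U$. For $S\subseteq\mathbb C$, $\overline S$ is its closure and $\operatorname{conv}(S)$ its convex hull. Eigenvalues are collinear if they all lie on a common (real) straight line in $\mathbb C$. Schatten classes: every compact operator $C$ on $\mathcal H$ has a Schmidt decomposition $C=\sum_{n=1}^\infty s_n(C)\langle f_n,\cdot\rangle g_n$ with orthonormal systems $(f_n)_{n\in\mathbb N}$, $(g_n)_{n\in\mathbb N}$ and a decreasing null sequence $(s_n(C))_{n\in\mathbb N}$ in $[0,\infty)$ of singular numbers, which is uniquely determined by $C$. For $p\in[1,\infty)$, $\mathcal B^p(\mathcal H)$ is the set of all compact operators $C$ on $\mathcal H$ with $\sum_{n=1}^\infty s_n(C)^p<\infty$; $\mathcal B^\infty(\mathcal H)$ is the set of all compact operators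 on $\mathcal H$. Conjugacy uses the convention $1/\infty=0$, so $1$ and $\infty$ are conjugate. $C$-numerical range: for $C\in\mathcal B^p(\mathcal H)$ and $T\in\mathcal B^q(\mathcal H)$ with $p,q$ conjugate, $$W_C(T):=\{\operatorname{tr}(CU^\dagger TU)\mid U\in\mathcal B(\mathcal H)\text{ unitary}\}.$$ Modified eigenvalue sequence: the eigenvalue sequence of a compact operator $T$ on $\mathcal H$ is obtained by arranging its non-zero eigenvalues in decreasing order of absolute value, each repeated as many times as its algebraic multiplicity (the dimension of $\ker(T-\lambda I)^{n_0}$, with $n_0$ the smallest $n\in\mathbb N$ such that $\ker(T-\lambda I)^{n}=\ker(T-\lambda I)^{n+1}$); if there are only finitely many non-zero eigenvalues, the sequence is filled up with zeros. The modified eigenvalue sequence of $T$ is obtained from it as follows. If the range of $T$ is infinite-dimensional and the kernel of $T$ is finite-dimensional, put $\dim(\ker T)$ zeros at the beginning of the eigenvalue sequence. If the range and the kernel of $T$ are both infinite-dimensional, mix infinitely many zeros into the eigenvalue sequence (the precise way of mixing is irrelevant below because arbitrary permutations are applied). If the range of $T$ is finite-dimensional, leave the eigenvalue sequence unchanged. $C$-spectrum: for $C\in\mathcal B^p(\mathcal H)$ with modified eigenvalue sequence $(\gamma_n)_{n\in\mathbb N}$ and $T\in\mathcal B^q(\mathcal H)$ with modified eigenvalue sequence $(\tau_n)_{n\in\mathbb N}$, with $p,q$ conjugate, the $C$-spectrum of $T$ is $$P_C(T):=\Big\{\sum_{n=1}^\infty\gamma_n\tau_{\sigma(n)}\ \Big|\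 \sigma:\mathbb N\to\mathbb N\text{ is a permutation}\Big\},$$ where the series converge absolutely. *)

(* Defs.v *)
From HB Require Import structures.
From mathcomp Require Import all_boot all_order all_algebra complex.
From mathcomp Require Import all_classical all_reals all_analysis.

Set Implicit Arguments.
Unset Strict Implicit.
Unset Printing Implicit Defensive.

Import Order.TTheory GRing.Theory Num.Theory.
Import numFieldNormedType.Exports.

Local Open Scope classical_set_scope.
Local Open Scope ring_scope.
Local Open Scope complex_scope.

(* Complex Hilbert spaces.  [{dot V for Num.conj}] is linear in its FIRST
   argument and conjugate-linear in the second one, so the physicists' bracket
   <x, y>, conjugate-linear on the left, is [hdot y x]. *)
HB.mixin Record CompleteNormedModule_isHilbert (R : realType) V
    of CompleteNormedModule R[i] V := {
  hdot : {dot V for (@Num.conj R[i])} ;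
  hdot_norm : forall x : V, `|x| ^+ 2 = hdot x x
}.

#[short(type="hilbertType")]
HB.structure Definition Hilbert (R : realType) :=
  {V of CompleteNormedModule_isHilbert R V & CompleteNormedModule R[i] V}.

(* [R[i]^o] is [R[i]] with its usual metric topology and with its structure of
   module over itself; the scalars [{i01 R[i]}] occurring in [convex_set] are
   the z with 0 <= z <= 1 for the partial order of R[i], i.e. the reals of
   [0, 1]. *)
Definition conv_hull (R : realType) (S : set R[i]^o) : set R[i]^o :=
  smallest (fun A : set R[i]^o => convex_set A) S.

Section Operators.
Context {R : realType} {V : hilbertType R}.
Local Notation C := (R[i]^o).
Local Notation "''[' x , y ]" := (hdot y x).
Implicit Types (A : V -> V) (T U : {linear V -> V}) (e f g : nat -> V).

Definition has_dim (S : set V) (m : nat) : Prop :=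
  exists e : 'I_m -> V,
    (forall a : 'I_m -> R[i],
       \sum_(i < m) a i *: e i = 0 -> forall i, a i = 0) /\
    S = [set x | exists a : 'I_m -> R[i], x = \sum_(i < m) a i *: e i].

Definition finite_dim (S : set V) : Prop := exists m, has_dim S m.

Definition orthonormal_seq e : Prop :=
  forall m n, '[e m, e n] = (m == n)%:R.

Definition orthonormal_basis e : Prop :=
  orthonormal_seq e /\
  forall x, series (fun n => '[e n, x] *: e n) @ \oo --> x.

Definition bounded_op A : Prop :=
  exists M : R[i], forall x, `|A x| <= M * `|x|.

Definition compact_op A : Prop :=
  compact (closure (A @` [set x | `|x| <= 1])).

(* [adjoint A y] is the vector z with <y, A x> = <z, x> for all x; it exists
   (Riesz) and is unique as soon as A is a bounded linear operator. *)
Definition adjoint A : V -> V :=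
  fun y => get [set z | forall x, '[y, A x] = '[z, x]].

Definition normal_op A : Prop := adjoint A \o A =1 A \o adjoint A.

Definition unitary_op A : Prop :=
  [/\ bounded_op A, adjoint A \o A =1 id & A \o adjoint A =1 id].

(* [s] is the sequence of singular numbers of [A]: it occurs in a Schmidt
   decomposition of [A]. *)
Definition singular_numbers A (s : R^nat) : Prop :=
  [/\ (forall n, 0 <= s n), nonincreasing_seq s, s @ \oo --> (0 : R) &
   exists f g, [/\ orthonormal_seq f, orthonormal_seq g &
    forall x, series (fun n => ((s n)%:C * '[f n, x]) *: g n) @ \oo --> A x]].

Definition schatten (p : \bar R) A : Prop :=
  compact_op A /\
  match p with
  | r%:E => exists2 s, singular_numbers A s &
                       (\sum_(0 <= n <oo) (s n `^ r)%:E < +oo)%E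
  | +oo%E => True
  | -oo%E => False
  end.

(* The trace of a trace-class operator; it does not depend on the basis. *)
Definition trace A : C :=
  get [set z : C | forall e, orthonormal_basis e ->
         series (fun n => '[e n, A (e n)] : C) @ \oo --> z].

Definition C_numerical_range A B : set C :=
  [set z | exists2 U : {linear V -> V}, unitary_op U &
             z = trace (A \o adjoint U \o B \o U)].

Definition eigenvalue_op A (z : R[i]) : Prop :=
  exists2 x, x != 0 & A x = z *: x.

Definition collinear_eigenvalues A : Prop :=
  exists a d : R[i], d != 0 /\
    forall z, eigenvalue_op A z -> exists t : R, z = a + t%:C * d.

(* ker (A - z I)^n *)
Definition ker_pow A (z : R[i]) (n : nat) : set V :=
  [set x | iter n (fun y => A y - z *: y) x = 0].

(* [m] is the algebraic multiplicity of [z] (0 if z is not an eigenvalue). *)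
Definition algebraic_multiplicity A (z : R[i]) (m : nat) : Prop :=
  exists n0, [/\ ker_pow A z n0 = ker_pow A z n0.+1,
    (forall n, (n < n0)%N -> ker_pow A z n <> ker_pow A z n.+1) &
    has_dim (ker_pow A z n0) m].

(* Monotonicity of the moduli forces the zeros of [lam], if any, to come after
   all its non-zero terms.  [lam] is unique up to the order of eigenvalues with
   the same modulus. *)
Definition eigenvalue_seq A (lam : nat -> R[i]) : Prop :=
  (forall m n, (m <= n)%N -> `|lam n| <= `|lam m|) /\
  forall z : R[i], z != 0 -> exists2 m, algebraic_multiplicity A z m &
                                 ([set n | lam n = z] #= `I_m)%card.

Definition ker_op A : set V := [set x | A x = 0].

(* [phi] gives the positions of the terms of [lam] among the infinitely many
   zeros that are mixed into it. *)
Definition mixed_with_zeros (lam gam : nat -> R[i]) : Prop :=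
  exists phi : nat -> nat,
    [/\ {homo phi : m n / (m < n)%N}, infinite_set (~` range phi),
        (forall n, gam (phi n) = lam n) &
        forall k, ~ range phi k -> gam k = 0].

Definition modified_eigenvalue_seq A (gam : nat -> R[i]) : Prop :=
  exists2 lam, eigenvalue_seq A lam &
  [/\ (finite_dim (range A) -> gam = lam),
      (~ finite_dim (range A) -> forall d, has_dim (ker_op A) d ->
         gam = fun n => if (n < d)%N then 0 else lam (n - d)%N) &
      (~ finite_dim (range A) -> ~ finite_dim (ker_op A) ->
         mixed_with_zeros lam gam)].

(* Two modified eigenvalue sequences of the same operator only differ by a
   permutation, hence the set below is the same for all choices of [gam] and
   [tau]. *)
Definition C_spectrum A B : set C :=
  [set z : C | exists gam tau (sigma : nat -> nat),
    [/\ modified_eigenvalue_seq A gam, modified_eigenvalue_seq B tau,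
        bijective sigma &
        series (fun n => gam n * tau (sigma n) : C) @ \oo --> z]].

End Operators.

(* Main.v *)
(** A compact normal operator is diagonal in an orthonormal basis, and the
modified eigenvalue sequences are exactly the families of diagonal entries.
If C is diagonal with entries c in the basis h, then W_C(T) is the set of the
sums of c_k <u_k, T u_k> over all orthonormal bases u, and these series converge
uniformly in u by Hoelder's inequality; the roles of C and T are symmetric.
- If the c_k lie on a line, they are multiples of reals, because they accumulate
  at 0. The tails being uniformly small, approximate convexity reduces to finitely
  many vectors, where the range with real weights is convex by the argument of
  Westwick and Poon: the convex combination of two Hermitian matrices with
  spectrum c has spectrum majorized by c, and the Toeplitz-Hausdorff theorem
  realises the two-dimensional transfers that lead from there back to c.
- If T is diagonal too, with entries t in the basis f, a truncated sum is that
  of c_i t_j |<f_j, u_i>|^2, whose weights form a doubly substochastic matrix. By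
  Birkhoff's theorem it is a convex combination of sums over partial injections;
  completing these to permutations of N that send the remaining indices far away
  gives points of P_C(T) nearby. The hull of the closure of the bounded set
  P_C(T) is closed by Caratheodory's theorem in the plane. *)
From HB Require Import structures.
Require Import Defs.
From mathcomp Require Import all_boot all_order all_algebra perm complex.
From mathcomp Require Import all_classical all_reals all_analysis.
From mathcomp Require Import ring lra zify.
Import Order.TTheory GRing.Theory Num.Theory.
Import numFieldNormedType.Exports.
Local Open Scope classical_set_scope.
Local Open Scope ring_scope.
Set Implicit Arguments.
Unset Strict Implicit.
Unset Printing Implicit Defensive.

Local Open Scope complex_scope.

(** * Norms and convergence *)

(** [trace] is chosen as the limit common to all orthonormal bases, so no formula for it is
    available before such a limit is known to exist, and neither operator need be diagonal at that
    stage. If [p] is finite, a Schmidt decomposition of [C] with p-summable singular numbers is at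
    hand; if [p] is infinite, then [q] is 1 and the decomposition of [T] is used. The partial trace
    over n basis vectors amounts to inserting a finite-rank projection, which dominated convergence
    removes in the limit. Projected bases are no longer orthonormal but still satisfy Bessel's
    inequality; this is why the uniform estimates are proved for Bessel sequences. In part (b) the
    truncated problem yields points of the hull of the spectrum only up to a small error. Hence
    closedness of the hull enters already in the inclusion of the range itself, not only in that of
    its closure. *)

Section Modulus.
Context {R : realType}.
Local Notation K := R[i].

(** Norms take values in [R[i]], whose order is partial. Passing to real parts gives real norms,
    accessible to [lra] and [nra]. *)
Definition nm (V : normedModType K) (x : V) : R := complex.Re `|x|.
Definition cm (z : K) : R := complex.Re `|z|.

Lemma nmE (V : normedModType K) (x : V) : `|x| = (nm x)%:C.
Proof.
have := ger0_Im (normr_ge0 x); rewrite /nm; case: `|x| => a b /= ->.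
by rewrite complexr0.
Qed.

Lemma cmE (z : K) : `|z| = (cm z)%:C.
Proof. exact: (@nmE (R[i]^o)). Qed.

Lemma nm_ge0 (V : normedModType K) (x : V) : 0 <= nm x.
Proof. by have := normr_ge0 x; rewrite nmE -[0]/(0%:C) lecR. Qed.

Lemma nm0 (V : normedModType K) : nm (0 : V) = 0.
Proof. by rewrite /nm normr0. Qed.

Lemma nm_eq0 (V : normedModType K) (x : V) : (nm x == 0) = (x == 0).
Proof. by rewrite -[RHS]normr_eq0 nmE -[0%R in RHS]/(0%:C) (inj_eq (@complexI R)). Qed.

Lemma nm_gt0 (V : normedModType K) (x : V) : (0 < nm x) = (x != 0).
Proof. by rewrite lt_def nm_eq0 nm_ge0 andbT. Qed.

Lemma nmD (V : normedModType K) (x y : V) : nm (x + y) <= nm x + nm y.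
Proof. by rewrite -lecR rmorphD /= -!nmE ler_normD. Qed.

Lemma nmN (V : normedModType K) (x : V) : nm (- x) = nm x.
Proof. by rewrite /nm normrN. Qed.

Lemma nmB (V : normedModType K) (x y : V) : nm (x - y) <= nm x + nm y.
Proof. by rewrite -(nmN y) nmD. Qed.

Lemma nm_sub (V : normedModType K) (x y : V) : nm (x - y) = nm (y - x).
Proof. by rewrite -nmN opprB. Qed.

Lemma nm_split (V : normedModType K) (z x y : V) : nm (x - y) <= nm (x - z) + nm (z - y).
Proof. by rewrite -[x - y](subrKA z) nmD. Qed.

Lemma nm_le (V : normedModType K) (x y : V) : nm x <= nm y + nm (x - y).
Proof. by rewrite -{1}(subrK y x) addrC nmD. Qed.

Lemma nmZ (V : normedModType K) (a : K) (x : V) : nm (a *: x) = cm a * nm x.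
Proof. by apply: (@complexI R); rewrite -nmE normrZ rmorphM /= nmE cmE. Qed.

Lemma nm_sum (V : normedModType K) I (r : seq I) (P : pred I) (F : I -> V) :
  nm (\sum_(i <- r | P i) F i) <= \sum_(i <- r | P i) nm (F i).
Proof.
elim/big_ind2: _ => [|x a y b xa yb|//]; first by rewrite nm0.
exact: le_trans (nmD _ _) (lerD _ _).
Qed.

Lemma nm_cm (z : K) : nm (z : R[i]^o) = cm z. Proof. by []. Qed.

Lemma cm_ge0 z : 0 <= cm z. Proof. exact: (@nm_ge0 (R[i]^o)). Qed.
Lemma cm0 : cm 0 = 0. Proof. exact: (@nm0 (R[i]^o)). Qed.
Lemma cm_eq0 z : (cm z == 0) = (z == 0). Proof. exact: (@nm_eq0 (R[i]^o)). Qed.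
Lemma cm_gt0 z : (0 < cm z) = (z != 0). Proof. exact: (@nm_gt0 (R[i]^o)). Qed.
Lemma cmD x y : cm (x + y) <= cm x + cm y. Proof. exact: (@nmD (R[i]^o)). Qed.
Lemma cmN z : cm (- z) = cm z. Proof. exact: (@nmN (R[i]^o)). Qed.
Lemma cm_sub x y : cm (x - y) = cm (y - x). Proof. exact: (@nm_sub (R[i]^o)). Qed.
Lemma cm_split z x y : cm (x - y) <= cm (x - z) + cm (z - y).
Proof. exact: (@nm_split (R[i]^o)). Qed.
Lemma cmM x y : cm (x * y) = cm x * cm y. Proof. exact: (@nmZ (R[i]^o)). Qed.
Lemma cm_sum I (r : seq I) (P : pred I) (F : I -> K) :
  cm (\sum_(i <- r | P i) F i) <= \sum_(i <- r | P i) cm (F i).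
Proof. exact: (@nm_sum (R[i]^o)). Qed.

Lemma cmC (z : K) : cm (z^*)%R = cm z.
Proof. by rewrite /cm norm_conjC. Qed.

Lemma cm_real (r : R) : cm r%:C = `|r|.
Proof. by rewrite /cm normc_def /= expr0n addr0 sqrtr_sqr. Qed.

Lemma cm1 : cm 1 = 1. Proof. by rewrite -[1]/(1%:C) cm_real normr1. Qed.

Lemma cm2 (z : K) : (cm z ^+ 2)%:C = z^* * z.
Proof. by rewrite rmorphXn /= -cmE normCK mulrC. Qed.

Lemma cmV z : cm z^-1 = (cm z)^-1.
Proof.
have [->|z0] := eqVneq z 0; first by rewrite invr0 cm0 invr0.
apply: (mulfI (x := cm z)); first by rewrite cm_eq0.
by rewrite -cmM !mulfV ?cm_eq0// cm1.
Qed.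

Lemma ler_Re_cm (z : K) : `|complex.Re z| <= cm z.
Proof. by rewrite -lecR -cmE normc_ge_Re. Qed.

Lemma realcE (r : R) : (r%:C^* )%R = r%:C.
Proof. exact: conjc_real. Qed.

Lemma Re_sum I (r : seq I) (P : pred I) (F : I -> K) :
  complex.Re (\sum_(i <- r | P i) F i) = \sum_(i <- r | P i) complex.Re (F i).
Proof. by elim/big_rec2: _ => // i y x _ <-; case: (F i); case: x. Qed.

Lemma Re_realM (r : R) (z : K) : complex.Re (r%:C * z) = r * complex.Re z.
Proof. by case: z => a b /=; rewrite mul0r subr0. Qed.

Lemma realc_sum I (r : seq I) (P : pred I) (F : I -> R) :
  (\sum_(i <- r | P i) F i)%:C = \sum_(i <- r | P i) (F i)%:C.
Proof. exact: rmorph_sum. Qed.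

End Modulus.

Section Convergence.
Context {R : realType}.
Local Notation K := R[i].
Implicit Type V : normedModType K.

(** Convergence with real tolerances and explicit indices; [cvsP] links it to the filter form used
    in the definitions. *)
Definition cvs V (u : nat -> V) (l : V) : Prop :=
  forall e : R, 0 < e -> exists N, forall n, (N <= n)%N -> nm (u n - l) < e.

Lemma cvsP V (u : nat -> V) (l : V) : cvs u l <-> u @ \oo --> l.
Proof.
split=> [ul|/cvgrPdist_lt ul e e0].
  apply/cvgrPdist_lt => e e0.
  have [N NP] : exists N, forall n, (N <= n)%N -> nm (u n - l) < complex.Re e.
    by apply: ul; move: e0; rewrite ltcE => /andP[].
  exists N => // n /= /NP; rewrite nm_sub => unl.
  by rewrite nmE ltcE /= unl andbT eq_sym; move/ltW/ger0_Im/eqP: e0; rewrite eq_sym.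
have [|N _ NP] := ul e%:C; first by rewrite -[0]/(0%:C) ltcR.
by exists N => n /NP /=; rewrite nmE ltcR nm_sub.
Qed.

Lemma cvs_unique V (u : nat -> V) (k l : V) : cvs u k -> cvs u l -> k = l.
Proof.
move=> uk ul; apply/eqP; rewrite -subr_eq0 -nm_eq0; apply/eqP.
apply/eqP; rewrite eq_le nm_ge0 andbT; apply/ler_addgt0Pl => e e0; rewrite addr0.
have e2 : 0 < e / 2 by rewrite divr_gt0.
have [N NP] := uk _ e2; have [M MP] := ul _ e2.
apply: le_trans (nm_split (u (maxn N M)) _ _) _.
rewrite (splitr e) lerD //; last exact/ltW/MP/leq_maxr.
by rewrite nm_sub; exact/ltW/NP/leq_maxl.
Qed.

Lemma eq_cvs V (u v : nat -> V) (l : V) : u =1 v -> cvs u l -> cvs v l.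
Proof. by move=> uv ul e /ul[N NP]; exists N => n /NP; rewrite uv. Qed.

Lemma cvs_cst V (l : V) : cvs (fun=> l) l.
Proof. by move=> e e0; exists 0%N => n _; rewrite subrr nm0. Qed.

Lemma cvsD V (u v : nat -> V) (k l : V) :
  cvs u k -> cvs v l -> cvs (fun n => u n + v n) (k + l).
Proof.
move=> uk vl e e0; have e2 : 0 < e / 2 by rewrite divr_gt0.
have [N NP] := uk _ e2; have [M MP] := vl _ e2; exists (maxn N M) => n.
rewrite geq_max => /andP[/NP un /MP vn].
by rewrite opprD addrACA (splitr e); exact: le_lt_trans (nmD _ _) (ltrD un vn).
Qed.

Lemma cvs_lip V (W : normedModType K) (f : V -> W) (M : R) (u : nat -> V) (l : V) :
  (forall x y, nm (f x - f y) <= M * nm (x - y)) -> cvs u l ->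
  cvs (fun n => f (u n)) (f l).
Proof.
move=> fM ul e e0; have M1 : 0 < `|M| + 1 by rewrite ltr_wpDl.
have [N NP] := ul (e / (`|M| + 1)) (divr_gt0 e0 M1).
exists N => n /NP; rewrite ltr_pdivlMr // mulrC; apply: le_lt_trans.
apply: le_trans (fM _ _) _; rewrite ler_wpM2r ?nm_ge0 //.
by rewrite (le_trans (ler_norm _)) // lerDl.
Qed.

Lemma cvsZ V (a : K) (u : nat -> V) (l : V) :
  cvs u l -> cvs (fun n => a *: u n) (a *: l).
Proof.
by apply: (@cvs_lip _ _ ( *:%R a) (cm a)) => x y; rewrite -scalerBr nmZ.
Qed.

Lemma cvsM (a : K) (u : nat -> R[i]^o) (l : R[i]^o) :
  cvs u l -> @cvs (R[i]^o) (fun n => a * u n) (a * l).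
Proof. exact: cvsZ. Qed.

Lemma cvs_sum V I (r : seq I) (F : I -> nat -> V) (l : I -> V) :
  (forall i, cvs (F i) (l i)) ->
  cvs (fun n => \sum_(i <- r) F i n) (\sum_(i <- r) l i).
Proof.
move=> Fl; elim: r => [|i r IH].
  by rewrite big_nil; apply: eq_cvs (cvs_cst 0) => n; rewrite big_nil.
rewrite big_cons; apply: eq_cvs (cvsD (Fl i) IH) => n.
by rewrite big_cons.
Qed.

Lemma cvs_bound V (u : nat -> V) (l : V) (x : V) (M : R) N :
  cvs u l -> (forall n, (N <= n)%N -> nm (u n - x) <= M) -> nm (l - x) <= M.
Proof.
move=> ul uM; apply/ler_addgt0Pl => e e0; have [n nP] := ul _ e0.
apply: le_trans (nm_split (u (maxn n N)) _ _) _; apply: lerD.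
  by rewrite nm_sub; exact/ltW/nP/leq_maxl.
exact/uM/leq_maxr.
Qed.

Lemma sum_split (V : zmodType) (a : nat -> V) m n : (m <= n)%N ->
  \sum_(k < n) a k = \sum_(k < m) a k + \sum_(m <= k < n) a k.
Proof.
by move=> mn; rewrite -!(big_mkord xpredT a) (big_cat_nat (leq0n m) mn).
Qed.

(** The partial sums increase to their supremum; one of them comes within [e] of it, which leaves at
    most [e] for every later block. *)
Lemma sum_tail (a : nat -> R) (M : R) :
  (forall n, 0 <= a n) -> (forall n, \sum_(k < n) a k <= M) ->
  forall e, 0 < e -> exists N, forall n, \sum_(N <= k < n) a k <= e.
Proof.
move=> a0 aM e e0; pose S := [set \sum_(k < n) a k | n in [set: nat]].
have hS : has_sup S.
  by split; [exists (\sum_(k < 0) a k); exists 0%N | exists M => _ [n _ <-]].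
have [_ [N _ <-] Ne] := sup_adherent e0 hS; exists N => n.
have [nN|Nn] := leqP n N; first by rewrite big_geq ?ltW.
have : \sum_(k < n) a k <= sup S by apply: sup_upper_bound => //; exists n.
by rewrite (sum_split a (ltnW Nn)) => h; move: Ne h; lra.
Qed.

End Convergence.

Section Completeness.
Context {R : realType} {V : completeNormedModType R[i]}.

Lemma cvs_complete (u : nat -> V) :
  (forall e : R, 0 < e -> exists N, forall m n, (N <= m)%N -> (N <= n)%N ->
     nm (u m - u n) < e) -> exists l, cvs u l.
Proof.
move=> uc; suff /cauchy_cvg : cauchy (u @ \oo).
  by move/cvg_ex => [l /cvsP ul]; exists l.
apply: cauchy_exP => e e0; have e0' : 0 < complex.Re e.
  by move: e0; rewrite ltcE => /andP[].
have [N NP] := uc _ e0'; exists (u N); exists N => // n /= Nn.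
rewrite -ball_normE /= nmE ltcE /= NP // andbT.
by move/ltW/ger0_Im: e0 => ->.
Qed.

Lemma series_complete (u : nat -> V) :
  (forall e : R, 0 < e -> exists N, forall m n, (N <= m)%N -> (m <= n)%N ->
     nm (\sum_(m <= k < n) u k) <= e) ->
  exists l, cvs (fun n => \sum_(k < n) u k) l.
Proof.
move=> uc; apply: cvs_complete => e e0.
have e2 : 0 < e / 2 by rewrite divr_gt0.
have [N NP] := uc _ e2; exists N.
suff H m n : (N <= m)%N -> (m <= n)%N ->
    nm (\sum_(k < n) u k - \sum_(k < m) u k) < e.
  move=> m n Nm Nn; case: (leqP m n) => [mn|/ltnW nm_]; last exact: H.
  by rewrite nm_sub; exact: H.
move=> Nm mn; rewrite (sum_split u mn) addrAC subrr add0r.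
by apply: le_lt_trans (NP _ _ Nm mn) _; rewrite ltr_pdivrMr // mulr_natr mulr2n ltrDl.
Qed.

End Completeness.

Lemma le_sqr (R : realDomainType) (x y : R) : 0 <= y -> x ^+ 2 <= y ^+ 2 -> x <= y.
Proof.
move=> y0 xy; have [x0|x0] := leP 0 x; last exact: le_trans (ltW x0) y0.
by rewrite -(@ler_pXn2r _ 2).
Qed.

(** * Orthonormal systems *)

Section InnerProduct.
Context {R : realType} {H : hilbertType R}.
Local Notation K := R[i].
Implicit Types x y z : H.

Definition ip x y : K := hdot y x.

Lemma ipDr x y z : ip x (y + z) = ip x y + ip x z.
Proof. by rewrite /ip linearDl. Qed.
Lemma ipDl x y z : ip (x + y) z = ip x z + ip y z.
Proof. by rewrite /ip linearDr. Qed.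
Lemma ipNr x y : ip x (- y) = - ip x y. Proof. by rewrite /ip linearNl. Qed.
Lemma ipNl x y : ip (- x) y = - ip x y. Proof. by rewrite /ip linearNr. Qed.
Lemma ipBr x y z : ip x (y - z) = ip x y - ip x z.
Proof. by rewrite ipDr ipNr. Qed.
Lemma ipBl x y z : ip (x - y) z = ip x z - ip y z.
Proof. by rewrite ipDl ipNl. Qed.
Lemma ip0r x : ip x 0 = 0. Proof. by rewrite /ip linear0l. Qed.
Lemma ipZr a x y : ip x (a *: y) = a * ip x y.
Proof. by rewrite /ip linearZl_LR. Qed.
Lemma ipZl a x y : ip (a *: x) y = (a^* )%R * ip x y.
Proof. by rewrite /ip linearZr_LR. Qed.
Lemma ipC x y : ip y x = ((ip x y)^* )%R.
Proof. by rewrite /ip hermC expr0 mul1r. Qed.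
Lemma ip_sumr I (r : seq I) (P : pred I) (F : I -> H) x :
  ip x (\sum_(i <- r | P i) F i) = \sum_(i <- r | P i) ip x (F i).
Proof. by rewrite /ip linear_sumlz. Qed.
Lemma ip_suml I (r : seq I) (P : pred I) (F : I -> H) x :
  ip (\sum_(i <- r | P i) F i) x = \sum_(i <- r | P i) ip (F i) x.
Proof. by rewrite /ip linear_sumr. Qed.

Lemma ip_nm x : ip x x = (nm x ^+ 2)%:C.
Proof. by rewrite /ip -hdot_norm nmE rmorphXn. Qed.

Lemma Re_ip x : complex.Re (ip x x) = nm x ^+ 2.
Proof. by rewrite ip_nm. Qed.

Lemma cm_ipC x y : cm (ip x y) = cm (ip y x).
Proof. by rewrite ipC cmC. Qed.

Lemma nmD_ip x y : nm (x + y) ^+ 2 = nm x ^+ 2 + nm y ^+ 2 + 2 * complex.Re (ip x y).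
Proof.
rewrite -!Re_ip ipDl !ipDr (ipC x y); case: (ip x y) => a b.
by case: (ip x x) => c d; case: (ip y y) => k l /=; ring.
Qed.

Lemma nmB_ip x y : nm (x - y) ^+ 2 = nm x ^+ 2 + nm y ^+ 2 - 2 * complex.Re (ip x y).
Proof.
by rewrite nmD_ip nmN ipNr; case: (ip x y) => a b /=; rewrite mulrN.
Qed.

Lemma pythagoras x y : ip x y = 0 -> nm (x + y) ^+ 2 = nm x ^+ 2 + nm y ^+ 2.
Proof. by rewrite nmD_ip => ->; rewrite mulr0 addr0. Qed.

Lemma ip_eq0 x : (ip x x == 0) = (x == 0).
Proof. by rewrite /ip dnorm_eq0. Qed.

Lemma ip_inj x y : (forall z, ip z x = ip z y) -> x = y.
Proof.
by move=> xy; apply/eqP; rewrite -subr_eq0 -ip_eq0 ipBr xy subrr.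
Qed.

Lemma nm_unit x : ip x x = 1 -> nm x = 1.
Proof.
rewrite ip_nm -[1 in RHS]/(1%:C) => -[] /eqP.
by rewrite sqrf_eq1 => /orP[/eqP //|/eqP h]; have := nm_ge0 x; rewrite h ler0N1.
Qed.

Lemma cauchy_schwarz x y : cm (ip x y) <= nm x * nm y.
Proof.
have [->|y0] := eqVneq y 0; first by rewrite ip0r cm0 nm0 mulr0.
have ny0 : 0 < nm y by rewrite nm_gt0.
rewrite -(@ler_pXn2r _ 2) ?nnegrE ?cm_ge0 ?mulr_ge0 ?nm_ge0 // exprMn.
(* [a *: y] is the orthogonal projection of [x] on the line of [y]; the claim says that the square
   of its distance to [x] is nonnegative. *)
pose a := ip y x / ip y y.
have : 0 <= nm (x - a *: y) ^+ 2 by rewrite exprn_ge0 ?nm_ge0.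
rewrite nmB_ip nmZ exprMn ipZr /a ip_nm.
have -> : ip y x / (nm y ^+ 2)%:C = ((nm y ^+ 2)^-1)%:C * ip y x.
  by rewrite mulrC fmorphV.
rewrite -[_ * ip x y]mulrA cmM cm_real.
have -> u v w : (`|u| * v) ^+ 2 * w = u ^+ 2 * v ^+ 2 * w :> R.
  by rewrite exprMn real_normK ?num_real.
rewrite Re_realM {2}(ipC x y) -cm2 cm_ipC /=.
set c := cm (ip x y); set n := nm y ^+ 2; set m := nm x ^+ 2.
have n0 : 0 < n by rewrite exprn_gt0.
have -> : m + n^-1 ^+ 2 * c ^+ 2 * n - 2 * (n^-1 * c ^+ 2) = m - c ^+ 2 / n.
  by field; rewrite gt_eqF.
by rewrite subr_ge0 ler_pdivrMr.
Qed.

Lemma cvs_ipr x (u : nat -> H) l : cvs u l -> @cvs _ (R[i]^o) (fun n => ip x (u n)) (ip x l).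
Proof.
apply: (@cvs_lip _ _ (R[i]^o) (ip x) (nm x)) => y z.
by rewrite -ipBr; exact: cauchy_schwarz.
Qed.

Lemma cvs_ipl x (u : nat -> H) l : cvs u l -> @cvs _ (R[i]^o) (fun n => ip (u n) x) (ip l x).
Proof.
apply: (@cvs_lip _ _ (R[i]^o) (ip^~ x) (nm x)) => y z.
by rewrite -ipBl mulrC; exact: cauchy_schwarz.
Qed.

End InnerProduct.

(** * Bessel's inequality, Riesz-Fischer and orthonormal bases *)

Section Orthonormal.
Context {R : realType} {H : hilbertType R}.
Local Notation K := R[i].
Implicit Types (e u v : nat -> H) (x y z : H).

(** What orthonormality leaves behind under projections and unitaries, and all that the uniform
    estimates require. *)
Definition bessel u := forall x n, \sum_(k < n) cm (ip (u k) x) ^+ 2 <= nm x ^+ 2.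

Lemma on_ip e m n : orthonormal_seq e -> ip (e m) (e n) = (m == n)%:R.
Proof. by move=> h; exact: h. Qed.

Lemma on_nm e n : orthonormal_seq e -> nm (e n) = 1.
Proof. by move=> eon; apply: nm_unit; rewrite (on_ip _ _ eon) eqxx. Qed.

Lemma on_sum_nm e (c : nat -> K) n : orthonormal_seq e ->
  nm (\sum_(k < n) c k *: e k) ^+ 2 = \sum_(k < n) cm (c k) ^+ 2.
Proof.
move=> eon; elim: n => [|n IH]; first by rewrite !big_ord0 nm0 expr0n.
rewrite !big_ord_recr /= pythagoras ?IH.
  by rewrite nmZ on_nm ?mulr1.
rewrite ip_suml big1 // => i _; rewrite ipZl ipZr (on_ip _ _ eon).
by rewrite ltn_eqF // !mulr0.
Qed.

Lemma on_sum_ip e (c : nat -> K) n m : orthonormal_seq e ->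
  ip (e m) (\sum_(k < n) c k *: e k) = if (m < n)%N then c m else 0.
Proof.
move=> eon; rewrite ip_sumr; case: ltnP => mn.
  rewrite (bigD1 (Ordinal mn)) //= ipZr (on_ip _ _ eon) eqxx mulr1 big1 ?addr0 //.
  move=> i /eqP im; rewrite ipZr (on_ip _ _ eon) (_ : (m == i) = false) ?mulr0 //.
  by apply/negbTE/eqP => h; apply: im; apply: val_inj.
rewrite big1 // => i _; rewrite ipZr (on_ip _ _ eon) gtn_eqF ?mulr0 //.
exact: leq_trans (ltn_ord i) mn.
Qed.

Lemma on_proj_ip e x n m : orthonormal_seq e -> (m < n)%N ->
  ip (e m) (x - \sum_(k < n) ip (e k) x *: e k) = 0.
Proof. by move=> eon mn; rewrite ipBr (on_sum_ip (fun k => ip (e k) x)) // mn subrr. Qed.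

Lemma on_bessel_eq e x n : orthonormal_seq e ->
  nm x ^+ 2 = \sum_(k < n) cm (ip (e k) x) ^+ 2 +
    nm (x - \sum_(k < n) ip (e k) x *: e k) ^+ 2.
Proof.
move=> eon; set s := \sum_(k < n) _ *: _.
rewrite -{1}(subrK s x) [_ + s]addrC [LHS]pythagoras.
  by have /= <- := on_sum_nm (fun k => ip (e k) x) n eon.
rewrite /s ip_suml big1 // => i _.
by rewrite ipZl on_proj_ip // mulr0.
Qed.

Lemma on_bessel e : orthonormal_seq e -> bessel e.
Proof.
by move=> eon x n; rewrite (on_bessel_eq x n eon) lerDl exprn_ge0 ?nm_ge0.
Qed.

(** The inequality tested on [u k] itself bounds the fourth power of its norm by the square. *)
Lemma bessel_nm u k : bessel u -> nm (u k) <= 1.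
Proof.
move=> ub; have := ub (u k) k.+1; rewrite big_ord_recr /= ip_nm cm_real.
have [->|uk0] := eqVneq (nm (u k)) 0; first by rewrite ler01.
move=> /(le_trans _) h; have {}h : `|nm (u k) ^+ 2| ^+ 2 <= nm (u k) ^+ 2.
  by apply: h; rewrite lerDr; apply: sumr_ge0 => i _; rewrite exprn_ge0 ?cm_ge0.
move: h; rewrite ger0_norm ?exprn_ge0 ?nm_ge0 // -[X in _ <= X]mulr1 expr2.
have n0 : 0 < nm (u k) by rewrite lt_def uk0 nm_ge0.
rewrite ler_pM2l ?exprn_gt0 // => h.
by rewrite -(@ler_pXn2r _ 2) ?nnegrE ?nm_ge0 ?ler01 // expr1n.
Qed.

Lemma riesz_fischer e (c : nat -> K) (M : R) : orthonormal_seq e ->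
  (forall n, \sum_(k < n) cm (c k) ^+ 2 <= M) ->
  exists x, cvs (fun n => \sum_(k < n) c k *: e k) x.
Proof.
move=> eon cM; apply: (series_complete (u := fun k => c k *: e k)) => d d0.
have [|N NP] := sum_tail (a := fun k => cm (c k) ^+ 2) _ cM (exprn_gt0 2 d0).
  by move=> n; rewrite exprn_ge0 ?cm_ge0.
exists N => m n Nm mn.
apply: le_sqr (ltW d0) _; apply: le_trans _ (NP n).
(* Coefficients cut off below [m] turn the block into an initial sum, to which [on_sum_nm]
   applies. *)
pose c' k := if (m <= k)%N then c k else 0.
have -> : \sum_(m <= k < n) c k *: e k = \sum_(k < n) c' k *: e k.
  rewrite (sum_split (fun k => c' k *: e k) mn) [X in _ = X + _]big1 ?add0r; last first.
    by move=> i _; rewrite /c' leqNgt ltn_ord scale0r.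
  by apply: eq_big_nat => i /andP[mi _]; rewrite /c' mi.
rewrite on_sum_nm // (sum_split (fun k => cm (c' k) ^+ 2) mn) big1 ?add0r; last first.
  by move=> i _; rewrite /c' leqNgt ltn_ord cm0 expr0n.
rewrite (@big_cat_nat _ _ _ m N n) //= (@eq_big_nat _ _ _ m n _ (fun k => cm (c k) ^+ 2)).
  by rewrite lerDr sumr_ge0 // => i _; rewrite exprn_ge0 ?cm_ge0.
by move=> i /andP[mi _]; rewrite /c' mi.
Qed.

Lemma on_series_ip e (c : nat -> K) x m : orthonormal_seq e ->
  cvs (fun n => \sum_(k < n) c k *: e k) x -> ip (e m) x = c m.
Proof.
move=> eon cx; apply: (cvs_unique (V := R[i]^o)) (cvs_ipr (e m) cx) _ => d d0.
by exists m.+1 => n mn; rewrite on_sum_ip // mn subrr nm0.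
Qed.

Definition onb e := orthonormal_seq e /\
  forall x, cvs (fun n => \sum_(k < n) ip (e k) x *: e k) x.

Lemma seriesE (V : zmodType) (u : nat -> V) : series u = (fun n => \sum_(k < n) u k).
Proof. by apply/funext => n; rewrite /series /= big_mkord. Qed.

Lemma onbP e : orthonormal_basis e <-> onb e.
Proof.
split=> -[eon ex]; split=> // x.
  by apply/cvsP; have := ex x; rewrite seriesE.
by rewrite seriesE; apply/cvsP; exact: ex.
Qed.

(** The Fourier series of [x] converges by Riesz-Fischer, and its limit has the coefficients of [x],
    so the difference is orthogonal to all [e k]. *)
Lemma onb_complete e : orthonormal_seq e ->
  (forall x, (forall k, ip (e k) x = 0) -> x = 0) -> onb e.
Proof.
move=> eon ec; split=> // x.
have [|y xy] := @riesz_fischer e (fun k => ip (e k) x) (nm x ^+ 2) eon.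
  by move=> n; exact: on_bessel.
suff xy' : x = y by rewrite [X in cvs _ X]xy'.
apply/eqP; rewrite -subr_eq0; apply/eqP/ec => k.
have /= xyk := @on_series_ip e (fun k => ip (e k) x) y k eon xy.
by rewrite ipBr xyk subrr.
Qed.

Lemma onb_eq0 e x : onb e -> (forall k, ip (e k) x = 0) -> x = 0.
Proof.
move=> [eon ex] x0; apply: cvs_unique (ex x) _.
apply: eq_cvs (cvs_cst 0) => n.
by rewrite big1 // => i _; rewrite x0 scale0r.
Qed.

Lemma onb_ext e x y : onb e -> (forall k, ip (e k) x = ip (e k) y) -> x = y.
Proof.
move=> eb xy; apply/eqP; rewrite -subr_eq0; apply/eqP/(onb_eq0 eb) => k.
by rewrite ipBr xy subrr.
Qed.

Lemma onb_parseval e x y : onb e ->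
  @cvs _ (R[i]^o) (fun n => \sum_(k < n) ip y (e k) * ip (e k) x) (ip y x).
Proof.
move=> [eon ex]; apply: eq_cvs (cvs_ipr y (ex x)) => n.
by rewrite ip_sumr; apply: eq_bigr => i _; rewrite ipZr mulrC.
Qed.

Lemma on_reindex e (f : nat -> nat) : injective f ->
  orthonormal_seq e -> orthonormal_seq (e \o f).
Proof.
by move=> fi eon m n; have := eon (f m) (f n); rewrite (inj_eq fi).
Qed.

Lemma onb_reindex e (f : nat -> nat) : bijective f -> onb e -> onb (e \o f).
Proof.
move=> fb eb; have [g fK gK] := fb; apply: onb_complete.
  by apply: on_reindex (bij_inj fb) _; case: eb.
move=> x x0; apply: (onb_eq0 eb) => k.
by have := x0 (g k); rewrite /= gK.
Qed.

End Orthonormal.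

(** * Maximal orthonormal sets and separability *)

Section OrthonormalSets.
Context {R : realType} {H : hilbertType R}.
Local Notation K := R[i].
Implicit Types (x y z : H) (E Q : set H).

Definition onset E := forall x y, E x -> E y -> ip x y = (x == y)%:R.

(** [Q] will be the whole space when a finite family is extended to a basis, and the set of
    eigenvectors in the spectral theorem. Zorn's lemma runs over the sets added to [E0], so that the
    empty chain is harmless. *)
Lemma maximal_onset Q E0 : onset E0 -> E0 `<=` Q ->
  exists E, [/\ onset E, E0 `<=` E, E `<=` Q &
    forall x, Q x -> ip x x = 1 -> ~ (forall y, E y -> ip y x = 0)].
Proof.
move=> on0 Q0.
have [|A [[onA QA] maxA]] := @Zorn_bigcup H [set A | onset (E0 `|` A) /\ A `<=` Q].
  move=> F FP Ftot; split; last by move=> x [A /FP[_ AQ] /AQ].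
  move=> x y [x0|[A FA Ax]] [y0|[B FB By]].
  - exact: on0.
  - by have [onB _] := FP _ FB; apply: onB; [left|right].
  - by have [onA _] := FP _ FA; apply: onA; [right|left].
  - have [AB|BA] := Ftot _ _ FA FB.
      by have [onB _] := FP _ FB; apply: onB; right=> //; exact: AB.
    by have [onA _] := FP _ FA; apply: onA; right=> //; exact: BA.
exists (E0 `|` A); split=> //.
  by move=> x [/Q0|/QA].
move=> x Qx x1 xE; apply: (maxA (A `|` [set x])).
  split; last by move=> xA; have := xE x; rewrite x1 => /(_ (or_intror (xA x (or_intror erefl)))) /eqP; rewrite oner_eq0.
  by move=> y Ay; left.
split; last by move=> y [/QA|->].
move=> y z; rewrite setUA => -[yA|->] [zA|->].
- exact: onA.
- have [yx|_] := eqVneq y x; last exact: xE.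
  by rewrite yx x1.
- have [xz|_] := eqVneq x z; first by rewrite -xz x1.
  by rewrite ipC (xE z zA) conjC0.
- by rewrite eqxx x1.
Qed.

Lemma onset_dist x y : ip x x = 1 -> ip y y = 1 -> ip x y = 0 -> nm (x - y) ^+ 2 = 2.
Proof.
move=> x1 y1 xy; rewrite nmB_ip xy mulr0 subr0 (nm_unit x1) (nm_unit y1).
by rewrite expr1n.
Qed.

(** Distinct elements lie at distance the square root of 2, so choosing for each a point of the
    dense set within 1/2 is injective. *)
Lemma onset_countable E (Hsep : exists2 D : set H, countable D & dense D) :
  onset E -> countable E.
Proof.
move=> onE; have [D Dc Dd] := Hsep.
have {Dd} h x : exists d, D d /\ nm (x - d) < 2^-1.
  have b0 : ball x (2^-1 : K) !=set0 by exists x; apply: ballxx; rewrite invr_gt0.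
  have [d [xd Dd']] := Dd _ b0 (ball_open _ _); exists d; split=> //.
  move: xd; rewrite -ball_normE /= nmE => xd.
  by rewrite -ltcR; apply: lt_le_trans xd _; rewrite fmorphV rmorph_nat.
have [f fP] := choice h.
have fi : {in E &, injective f}.
  move=> x y; rewrite !inE => Ex Ey fxy; apply/eqP/negPn/negP => xy.
  have := onset_dist (x := x) (y := y).
  rewrite (onE x x) // (onE y y) // (onE x y) // !eqxx (negbTE xy).
  move=> /(_ erefl erefl erefl) d2.
  have d1 : nm (x - y) < 1.
    apply: le_lt_trans (nm_split (f x) x y) _.
    rewrite [X in _ < X](splitr 1) div1r ltrD ?(proj2 (fP x)) //.
    by rewrite nm_sub fxy (proj2 (fP y)).
  have : nm (x - y) ^+ 2 < 1 by rewrite expr_lt1 ?nm_ge0.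
  by rewrite d2 ltrn1.
have /eq_countable -> : (E #= f @` E)%card.
  by apply/card_set_bijP; exists f; exact: inj_bij.
by apply: sub_countable Dc; apply: subset_card_le => _ [x _ <-]; have [] := fP x.
Qed.

(* Maximality is expressed by the vanishing of the orthogonal complement. *)
Definition total_set E := forall x, (forall y, E y -> ip y x = 0) -> x = 0.

Lemma total_onset_infinite E : ~ finite_dim [set: H] -> onset E -> total_set E ->
  infinite_set E.
Proof.
move=> Hinf onE totE /finite_setP[n /card_esym/card_set_bijP[f [fE fi fs]]]; apply: Hinf.
have fon i j : (i < n)%N -> (j < n)%N -> ip (f i) (f j) = (i == j)%:R.
  move=> ni nj; rewrite onE; try exact: fE.
  by congr (_%:R); congr nat_of_bool; apply/eqP/eqP => [/fi-> //|-> //]; rewrite ?inE.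
have onsum (a : 'I_n -> K) (j : 'I_n) : ip (f j) (\sum_(i < n) a i *: f i) = a j.
  rewrite ip_sumr (bigD1 j) //= ipZr fon // eqxx mulr1 big1 ?addr0 // => i ij.
  by rewrite ipZr fon // (_ : (j == i :> nat) = false) ?mulr0 // eq_sym; apply/negbTE.
exists n, (fun i => f i); split=> [a a0 i|]; first by rewrite -(onsum a) a0 ip0r.
apply/seteqP; split=> // x _; exists (fun i => ip (f i) x).
apply/eqP; rewrite -subr_eq0; apply/eqP/totE => y /fs[j /= nj <-].
by rewrite ipBr (onsum (fun i => ip (f i) x) (Ordinal nj)) subrr.
Qed.

Lemma onb_enum E (Hsep : exists2 D : set H, countable D & dense D) :
  ~ finite_dim [set: H] -> onset E -> total_set E ->
  exists e, [/\ onb e, forall k, E (e k) & forall x, E x -> exists k, e k = x].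
Proof.
move=> Hinf onE totE.
have /card_esym/card_set_bijP[e [eE ei es]] :=
  eq_card_nat (onset_countable Hsep onE) (total_onset_infinite Hinf onE totE).
have Ee k : E (e k) by apply: eE.
exists e; split=> // [|x /es[k _ <-]]; last by exists k.
apply: onb_complete => [m n|x x0].
  rewrite -[LHS]/(ip (e m) (e n)) onE //; congr (_%:R); congr nat_of_bool.
  by apply/eqP/eqP => [/ei-> //|-> //]; rewrite inE.
by apply: totE => y /es[k _ <-].
Qed.

Lemma maximal_total E : onset E ->
  (forall x, [set: H] x -> ip x x = 1 -> ~ (forall y, E y -> ip y x = 0)) -> total_set E.
Proof.
move=> onE maxE x xE; apply/eqP/negPn/negP => x0.
have n0 : nm x != 0 by rewrite nm_eq0.
apply: (maxE ((nm x)^-1%:C *: x)) => // [|y Ey]; last by rewrite ipZr xE ?mulr0.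
rewrite ipZl ipZr realcE ip_nm mulrA -!rmorphM /= -expr2 exprVn mulVf //.
by rewrite expf_eq0.
Qed.

(** Completes the finitely many vectors found by the finite-dimensional argument: the rest of a
    maximal orthonormal set is countably infinite and is enumerated after them. *)
Lemma onb_extend (Hsep : exists2 D : set H, countable D & dense D) n (u : nat -> H) :
  ~ finite_dim [set: H] ->
  (forall i j, (i < n)%N -> (j < n)%N -> ip (u i) (u j) = (i == j)%:R) ->
  exists e, onb e /\ forall i, (i < n)%N -> e i = u i.
Proof.
move=> Hinf uon; pose E0 : set H := u @` `I_n.
have uinj i j : (i < n)%N -> (j < n)%N -> u i = u j -> i = j.
  move=> ni nj uij; apply/eqP; have := uon _ _ ni nj.
  by rewrite uij uon // eqxx; case: eqP => // _ /eqP; rewrite oner_eq0.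
have on0 : onset E0.
  move=> _ _ [i /= ni <-] [j /= nj <-]; rewrite uon //; congr (_%:R); congr nat_of_bool.
  by apply/eqP/eqP => [->//|]; exact: uinj.
have [//|E [onE E0E _ maxE]] := @maximal_onset setT E0 on0.
have totE := maximal_total onE maxE.
have Ec := onset_countable Hsep onE; have Einf := total_onset_infinite Hinf onE totE.
have Dinf : infinite_set (E `\` E0).
  by apply: infinite_setD => //; apply: finite_image; exact: finite_II.
have Dc : countable (E `\` E0) by apply: sub_countable Ec; apply: subset_card_le => x [].
have /card_esym/card_set_bijP[g [gE gi gs]] := eq_card_nat Dc Dinf.
have Eg k : E (g k) /\ ~ E0 (g k) by apply: (gE k).
have ginj i j : g i = g j -> i = j by apply: gi; rewrite inE.
pose e k := if (k < n)%N then u k else g (k - n)%N.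
have Ee k : E (e k).
  by rewrite /e; case: ltnP => kn; [apply: E0E; exists k|case: (Eg (k - n)%N)].
exists e; split=> [|i ni]; last by rewrite /e ni.
apply: onb_complete => [i j|x x0].
  rewrite -[LHS]/(ip (e i) (e j)) onE //; congr (_%:R); congr nat_of_bool.
  apply/eqP/eqP => [|-> //]; rewrite /e; case: ltnP => ni; case: ltnP => nj //.
  - exact: uinj.
  - by move=> h; case: (Eg (j - n)%N) => _ []; rewrite -h; exists i.
  - by move=> h; case: (Eg (i - n)%N) => _ []; rewrite h; exists j.
  - by move/ginj => h; rewrite -(subnK ni) -(subnK nj) h.
apply: totE => y Ey; have [[k /= kn <-]|ny] := pselect (E0 y).
  by have := x0 k; rewrite /e kn.
have [k _ <-] := gs y (conj Ey ny).
by have := x0 (k + n)%N; rewrite /e ltnNge leq_addl addnK.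
Qed.

Lemma onb_exists (Hsep : exists2 D : set H, countable D & dense D) :
  ~ finite_dim [set: H] -> exists e : nat -> H, onb e.
Proof.
move=> Hinf; have [|e [eb _]] := @onb_extend Hsep 0 (fun=> 0) Hinf; first by [].
by exists e.
Qed.

End OrthonormalSets.

(** * Adjoints and compactness *)

Section Operators.
Context {R : realType} {H : hilbertType R}.
Local Notation K := R[i].
Implicit Types (A B : H -> H) (x y z : H) (u v e f : nat -> H).

Definition mklin A (lA : linear A) : {linear H -> H} :=
  HB.pack A (GRing.isLinear.Build K H H *:%R A lA).

Definition bnd A (M : R) := 0 <= M /\ forall x, nm (A x) <= M * nm x.

Lemma bounded_opP A : bounded_op A <-> exists M, bnd A M.
Proof.
split=> [[M AM]|[M [M0 AM]]]; last first.
  by exists M%:C => x; rewrite !nmE -rmorphM lecR.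
exists (Num.max 0 (complex.Re M)); split=> [|x]; first by rewrite le_max lexx.
have := AM x; rewrite !nmE mulrC lecE => /andP[_].
rewrite Re_realM /= mulrC => /le_trans; apply.
by rewrite ler_wpM2r ?nm_ge0 // le_max lexx orbT.
Qed.

Lemma cvs_bnd (A : {linear H -> H}) M u x : bnd A M -> cvs u x ->
  cvs (fun n => A (u n)) (A x).
Proof. by case=> _ AM; apply: cvs_lip => y z; rewrite -linearB; exact: AM. Qed.

(** [adjoint] is a choice operator; this symmetric relation can be used before existence is known,
    and [isadj_adjoint] returns to [adjoint]. *)
Definition isadj A B := forall x y, ip y (A x) = ip (B y) x.

Lemma isadj_sym A B : isadj A B -> isadj B A.
Proof. by move=> AB x y; rewrite ipC -AB -ipC. Qed.

Lemma isadj_adjoint A B : isadj A B -> adjoint A = B.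
Proof.
move=> AB; apply/funext => y; rewrite /adjoint.
case: xgetP => [z _ /= zP|/(_ (B y)) /=].
  by apply: ip_inj => x; rewrite ipC (ipC (B y)) -AB; congr (_ ^*)%R; exact/esym/zP.
by case=> x; exact: AB.
Qed.

Lemma isadj_linear A B : isadj A B -> linear B.
Proof.
move=> AB a x y; apply: ip_inj => z; rewrite ipC -AB ipDl ipZl !AB rmorphD rmorphM /=.
by rewrite conjCK -!ipC ipDr ipZr.
Qed.

Lemma isadj_bnd A B M : isadj A B -> bnd A M -> bnd B M.
Proof.
move=> AB [M0 AM]; split=> // x.
have [->|B0] := eqVneq (B x) 0; first by rewrite nm0 mulr_ge0 ?nm_ge0.
rewrite -(@ler_pM2r _ (nm (B x))) ?nm_gt0 // -expr2.
have -> : nm (B x) ^+ 2 = cm (ip (B x) (B x)).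
  by rewrite ip_nm cm_real ger0_norm // exprn_ge0 ?nm_ge0.
rewrite -AB; apply: le_trans (cauchy_schwarz _ _) _.
by rewrite mulrAC [M * _ * _]mulrC ler_wpM2l ?nm_ge0 // AM.
Qed.

(** The coefficients of the adjoint vector must be [ip (A (e k)) y]. They are square summable
    because a partial sum [s] satisfies [nm s ^+ 2 = ip y (A s)], which is at most
    [nm y * M * nm s]. *)
Lemma riesz_adjoint (A : {linear H -> H}) M e : onb e -> bnd A M ->
  isadj A (adjoint A).
Proof.
move=> eb [M0 AM]; have [eon ex] := eb.
suff h y : exists z, forall x, ip y (A x) = ip z x.
  by have [B AB] := choice h; rewrite (@isadj_adjoint A B) => x y; exact: AB.
pose c k := ip (A (e k)) y.
have cM n : \sum_(k < n) cm (c k) ^+ 2 <= (M * nm y) ^+ 2.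
  set s := \sum_(k < n) c k *: e k.
  have sE : nm s ^+ 2 = \sum_(k < n) cm (c k) ^+ 2 by exact: on_sum_nm.
  have ys : ip y (A s) = (nm s ^+ 2)%:C.
    rewrite sE realc_sum linear_sum ip_sumr; apply: eq_bigr => i _.
    by rewrite linearZ ipZr cm2 (ipC (A _) y) mulrC.
  rewrite -sE ler_pXn2r ?nnegrE ?nm_ge0 ?mulr_ge0 ?nm_ge0 //.
  have := cauchy_schwarz y (A s); rewrite ys cm_real ger0_norm ?exprn_ge0 ?nm_ge0 //.
  have [->|s0] := eqVneq s 0; first by rewrite nm0 mulr_ge0 ?nm_ge0.
  move=> h; rewrite -(@ler_pM2r _ (nm s)) ?nm_gt0 // -expr2.
  apply: le_trans h _; rewrite mulrAC [M * _ * _]mulrC.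
  by rewrite ler_wpM2l ?nm_ge0.
have [z zP] := riesz_fischer eon cM.
exists z => x; apply: cvs_unique (cvs_ipr y (cvs_bnd (conj M0 AM) (ex x))) _.
apply: eq_cvs (cvs_ipr z (ex x)) => n.
rewrite linear_sum !ip_sumr; apply: eq_bigr => i _.
rewrite linearZ !ipZr; congr (_ * _).
by rewrite ipC (on_series_ip i eon zP) /c -ipC.
Qed.

Lemma unitary_ip (U : {linear H -> H}) e x y : onb e -> unitary_op U ->
  ip (U x) (U y) = ip x y.
Proof.
move=> eb [/bounded_opP[M UM] VU UV]; have UV' := riesz_adjoint eb UM.
by rewrite UV'; congr ip; exact: VU.
Qed.

Lemma unitary_onb (U : {linear H -> H}) e : onb e -> unitary_op U -> onb (U \o e).
Proof.
move=> eb Uu; have [eon ex] := eb; apply: onb_complete => [m n|x x0].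
  by rewrite -[LHS]/(ip (U (e m)) (U (e n))) (unitary_ip _ _ eb Uu); exact: eon.
have [/bounded_opP[M UM] VU UV] := Uu; have UV' := riesz_adjoint eb UM.
rewrite -(UV x) /=; suff -> : adjoint U x = 0 by rewrite linear0.
by apply: (onb_eq0 eb) => k; rewrite ipC -UV' -ipC; exact: x0.
Qed.

Lemma unitary_adjoint_onb (U : {linear H -> H}) e : onb e -> unitary_op U ->
  onb (adjoint U \o e).
Proof.
move=> eb Uu; have [eon ex] := eb.
have [/bounded_opP[M UM] VU UV] := Uu; have UV' := riesz_adjoint eb UM.
apply: onb_complete => [m n|x x0].
  rewrite -[LHS]/(ip (adjoint U (e m)) (adjoint U (e n))) -UV'.
  by rewrite (_ : U _ = e n); [exact: eon|exact: UV].
rewrite -(VU x) /=; suff -> : U x = 0 by exact: (linear0 (mklin (isadj_linear UV'))).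
by apply: (onb_eq0 eb) => k; rewrite UV'; exact: x0.
Qed.

Lemma onb_transport e f : onb e -> onb f ->
  exists U : H -> H, [/\ linear U, forall x, nm (U x) = nm x &
    forall x k, ip (f k) (U x) = ip (e k) x].
Proof.
move=> eb [fon fx]; have [eon ex] := eb.
have h x : exists y, cvs (fun n => \sum_(k < n) ip (e k) x *: f k) y.
  by apply: (riesz_fischer (c := fun k => ip (e k) x)) fon _ => n; exact: on_bessel.
have [U UP] := choice h.
have Uip x k : ip (f k) (U x) = ip (e k) x.
  exact: (on_series_ip (c := fun k => ip (e k) x)) fon (UP x).
exists U; split=> // [a x y|x].
  by apply: (onb_ext (conj fon fx)) => k; rewrite ipDr ipZr !Uip ipDr ipZr.
have Ux : ip (U x) (U x) = ip x x.
  apply: (cvs_unique (V := R[i]^o)) (onb_parseval (U x) (U x) (conj fon fx)) _.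
  apply: eq_cvs (onb_parseval x x eb) => n; apply: eq_bigr => i _.
  by rewrite ipC -Uip -ipC Uip.
by apply/eqP; rewrite -(@eqrXn2 _ 2) ?nm_ge0 // -!Re_ip Ux.
Qed.

(** The transport in the opposite direction is the adjoint. This is how the unitaries in the
    numerical range are traded for orthonormal bases. *)
Lemma unitary_of_onb e f : onb e -> onb f ->
  exists U : {linear H -> H}, unitary_op U /\ forall k, U (e k) = f k.
Proof.
move=> eb fb; have [U [Ul Un Uip]] := onb_transport eb fb.
have [V [_ _ Vip]] := onb_transport fb eb.
have UV : isadj U V.
  move=> x y; apply: (cvs_unique (V := R[i]^o)) (onb_parseval (U x) y fb) _.
  apply: eq_cvs (onb_parseval x (V y) eb) => n; apply: eq_bigr => i _.
  by rewrite Uip ipC Vip -ipC.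
exists (mklin Ul); split=> [|k]; last first.
  apply: (onb_ext fb) => j; rewrite [LHS]Uip; case: eb fb => eon _ [fon _].
  by rewrite (on_ip _ _ eon) (on_ip _ _ fon).
have adjE : adjoint (mklin Ul : H -> H) = V by exact: isadj_adjoint.
split; rewrite ?adjE.
- by apply/bounded_opP; exists 1; split=> // x; rewrite mul1r -(Un x).
- by move=> x /=; apply: (onb_ext eb) => k; rewrite Vip Uip.
- by move=> x /=; apply: (onb_ext fb) => k; rewrite Uip Vip.
Qed.

(** Cluster points rather than convergent subsequences: no extraction map has to be carried
    along. *)
Definition clus u x := forall (d : R) N, 0 < d -> exists2 n, (N <= n)%N & nm (u n - x) < d.

Definition seqcpt A := forall u, (forall n, nm (u n) <= 1) -> exists x, clus (A \o u) x.

Lemma compact_seqcpt A : compact_op A -> seqcpt A.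
Proof.
move=> Ac u u1; pose F := (A \o u) @ \oo.
have [|x [_ xF]] := Ac F _.
  by exists 0%N => // n _; apply: subset_closure; exists (u n) => //=; rewrite nmE -[1]/(1%:C) lecR.
exists x => d N d0.
have d0' : 0 < d%:C by rewrite -[0]/(0%:C) ltcR.
have [|_ [[n /= Nn <-] xd]] := xF ((A \o u) @` [set n | (N <= n)%N]) _ _ (nbhsx_ballx x _ d0').
  by exists N => // n /= Nn; exists n.
by exists n => //; move: xd; rewrite -ball_normE /= nmE ltcR nm_sub.
Qed.

(** Otherwise some [u n] in the unit ball have images of norm at least [n], and these images cannot
    cluster. *)
Lemma seqcpt_bnd (A : {linear H -> H}) : seqcpt A -> exists M, bnd A M.
Proof.
move=> Ac; apply: contrapT => nA.
have h (n : nat) : exists x, nm x <= 1 /\ n%:R <= nm (A x).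
  apply: contrapT => nx; apply: nA; exists n%:R; split=> // x.
  rewrite leNgt; apply/negP => nxA.
  have x0 : x != 0.
    by apply/eqP => x0; move: nxA; rewrite x0 linear0 nm0 mulr0 ltxx.
  have n0 : 0 < nm x by rewrite nm_gt0.
  apply: nx; exists ((nm x)^-1%:C *: x).
  rewrite linearZ /= !nmZ cm_real ger0_norm ?invr_ge0 ?nm_ge0 // mulVf ?gt_eqF //.
  by split=> //; rewrite mulrC ler_pdivlMr // ltW.
have [u uP] := choice h; have [|x xc] := Ac u; first by move=> n; have [] := uP n.
have [n Nn nx] := xc 1 (Num.truncn (nm x + 1)).+1 ltr01.
have [_ un] := uP n.
have := truncnS_gt (nm x + 1).
have : nm (A (u n)) <= nm x + 1.
  by apply: le_trans (nm_le _ x) _; rewrite lerD2l ltW.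
move: (Nn); rewrite -(ler_nat R) => Nn' a b; lra.
Qed.

End Operators.

(** * Diagonalization of compact normal operators *)

Section Spectral.
Context {R : realType} {H : hilbertType R}.
Local Notation K := R[i].
Implicit Types (x y z : H) (u v e f : nat -> H) (E : set H).

Definition subsp E := E 0 /\ forall a x y, E x -> E y -> E (a *: x + y).
Definition sclosed E := forall u x, (forall n, E (u n)) -> clus u x -> E x.

Lemma subspZ E a x : subsp E -> E x -> E (a *: x).
Proof. by case=> E0 EL Ex; have := EL a x 0 Ex E0; rewrite addr0. Qed.

Lemma clus_bnd (A : {linear H -> H}) M u x : bnd A M -> clus u x -> clus (A \o u) (A x).
Proof.
move=> [M0 AM] ux d N d0; have M1 : 0 < M + 1 by rewrite ltr_wpDl.
have [n Nn nx] := ux (d / (M + 1)) N (divr_gt0 d0 M1).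
exists n => //=; rewrite -linearB; apply: le_lt_trans (AM _) _.
move: nx; rewrite ltr_pdivlMr // => nx; apply: le_lt_trans nx.
by rewrite mulrC ler_wpM2l ?nm_ge0 // lerDl.
Qed.

Lemma eigen_sclosed (A : {linear H -> H}) M (a : K) : bnd A M ->
  sclosed [set x | A x = a *: x].
Proof.
move=> AM u x uA ux; have [M0 AM'] := AM.
apply/eqP; rewrite -subr_eq0 -nm_eq0 eq_le nm_ge0 andbT.
apply/ler_addgt0Pl => d d0; rewrite addr0.
pose B := M + cm a + 1; have B0 : 0 < B by rewrite ltr_wpDl // addr_ge0 ?cm_ge0.
have [n _ nx] := ux (d / B) 0%N (divr_gt0 d0 B0).
have -> : A x - a *: x = A (x - u n) - a *: (x - u n).
  by apply: ip_inj => z; rewrite linearB (uA n) /= !(ipBr, ipZr); ring.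
apply: le_trans (nmB _ _) _; rewrite nmZ nm_sub.
apply: le_trans (lerD (AM' _) (lexx _)) _.
move: nx; rewrite ltr_pdivlMr // /B (nm_sub x) => nx.
have := nm_ge0 (u n - x); set t := nm _ in nx * => *; lra.
Qed.

Lemma eigen_subsp (A : {linear H -> H}) (a : K) : subsp [set x | A x = a *: x].
Proof.
split=> [|b x y /= xa ya]; first by rewrite /= linear0 scaler0.
by rewrite linearP xa ya scalerDr !scalerA mulrC.
Qed.

Lemma subspI E F : subsp E -> subsp F -> subsp (E `&` F).
Proof.
by move=> [E0 EL] [F0 FL]; split=> // a x y [Ex Fx] [Ey Fy]; split; auto.
Qed.

Lemma sup_seq (S : set R) : has_sup S ->
  exists v : nat -> R, (forall n, S (v n)) /\
    forall d, 0 < d -> exists N, forall n, (N <= n)%N -> sup S - d < v n.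
Proof.
move=> hS; have h (n : nat) : exists r, S r /\ sup S - n.+1%:R^-1 < r.
  have [|r Sr rS] := @sup_adherent _ S n.+1%:R^-1 _ hS; first by rewrite invr_gt0.
  by exists r.
have [v vP] := choice h; exists v; split=> [n|d d0]; first by have [] := vP n.
exists (Num.truncn d^-1) => n Nn; have [_] := vP n; apply: le_lt_trans.
rewrite lerD2l lerN2 -[d]invrK lef_pV2 ?posrE ?invr_gt0 //.
apply: le_trans (ltW (truncnS_gt _)) _; by rewrite ler_nat.
Qed.

(* On the unit sphere of E, which is compact, x |-> |A x| attains its maximum m
   at some p, and then A^2 p = m^2 p. *)
Lemma selfadjoint_eigen (A : {linear H -> H}) M E : bnd A M -> isadj A A -> subsp E ->
  (forall x, E x -> E (A x)) ->
  (forall u, (forall n, E (u n) /\ nm (u n) = 1) -> exists2 x, E x & clus u x) ->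
  (exists2 x, E x & x != 0) ->
  exists x (r : R), [/\ E x, x != 0 & A x = r%:C *: x].
Proof.
move=> AM AA sE EA Ec [x0 Ex0 x00]; have [M0 AM'] := AM.
pose S := [set nm (A x) | x in [set x | E x /\ nm x = 1]].
have hS : has_sup S.
  split.
    exists (nm (A ((nm x0)^-1%:C *: x0))); exists ((nm x0)^-1%:C *: x0) => //.
    split; first exact: subspZ.
    by rewrite nmZ cm_real ger0_norm ?invr_ge0 ?nm_ge0 // mulVf ?nm_eq0.
  by exists M => _ [x [_ x1] <-]; have := AM' x; rewrite x1 mulr1.
have [v [vS vm]] := sup_seq hS; set m := sup S in vm.
have mub x : E x -> nm x = 1 -> nm (A x) <= m.
  by move=> Ex x1; apply: sup_upper_bound => //; exists x.
have hu n : exists x, (E x /\ nm x = 1) /\ nm (A x) = v n.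
  by have [x] := vS n; exists x.
have [u uP] := choice hu.
have [|p Ep pc] := Ec u; first by move=> n; have [] := uP n.
have p1 : nm p = 1.
  apply/eqP; rewrite eq_le; apply/andP; split; apply/ler_addgt0Pl => d d0.
    have [n _ nd] := pc d 0%N d0; have [[_ u1] _] := uP n.
    apply: le_trans (nm_le p (u n)) _; rewrite u1 nm_sub.
    by rewrite addrC lerD2r ltW.
  have [n _ nd] := pc d 0%N d0; have [[_ u1] _] := uP n.
  by rewrite -u1; apply: le_trans (nm_le (u n) p) _; rewrite addrC lerD2r ltW.
have m0 : 0 <= m by apply: le_trans (mub p Ep p1); exact: nm_ge0.
have pm : nm (A p) = m.
  apply/eqP; rewrite eq_le mub //=; apply/ler_addgt0Pl => d d0.
  have d2 : 0 < d / 2 by rewrite divr_gt0.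
  have [N NP] := vm _ d2.
  have [n Nn nd] := clus_bnd AM pc N d2; have [_ un] := uP n.
  have := NP n Nn; rewrite -un => h.
  have := nm_le (A (u n)) (A p); move: nd; rewrite /=.
  set a := nm (A (u n) - A p); move: h; set b := nm (A (u n)) => *; lra.
have mubx x : E x -> nm (A x) <= m * nm x.
  move=> Ex; have [->|xn0] := eqVneq x 0; first by rewrite linear0 nm0 mulr0.
  have nx : 0 < nm x by rewrite nm_gt0.
  rewrite -ler_pdivrMr // mulrC.
  have := mub ((nm x)^-1%:C *: x); rewrite linearZ !nmZ cm_real.
  by rewrite ger0_norm ?invr_ge0 ?nm_ge0 // mulVf ?gt_eqF //; apply=> //; apply: subspZ.
(* The square of the norm of the difference is [nm (A (A p)) ^+ 2 - 2 m^4 + m^4], and the first term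
   is at most [m^4] by maximality. *)
have A2p : A (A p) = (m ^+ 2)%:C *: p.
  apply/eqP; rewrite -subr_eq0 -nm_eq0 -sqrf_eq0 eq_le sqr_ge0 andbT.
  rewrite nmB_ip ipZr Re_realM nmZ cm_real p1 mulr1 (ger0_norm (exprn_ge0 2 m0)).
  rewrite -AA Re_ip pm.
  have h : nm (A (A p)) ^+ 2 <= (m * m) ^+ 2.
    rewrite ler_pXn2r ?nnegrE ?nm_ge0 ?mulr_ge0 //.
    by rewrite -{2}pm; apply: mubx; exact: EA.
  by move: h; rewrite -expr2; set t := nm _ ^+ 2 => h; nra.
(* Factor [A^2 - m^2] as [(A - m)(A + m)]: either [A + m] kills [p], or it maps [p] to an
   eigenvector for [m]. *)
have [Ap|Ap] := eqVneq (A p + m%:C *: p) 0.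
  exists p, (- m); split=> //; first by rewrite -nm_eq0 p1 oner_eq0.
  by apply/eqP; rewrite rmorphN scaleNr -subr_eq0 opprK Ap.
exists (A p + m%:C *: p), m; split=> //.
  by rewrite addrC; apply: (proj2 sE) => //; exact: EA.
by rewrite linearD A2p linearZ scalerDr scalerA -rmorphM -expr2 addrC.
Qed.

Definition diag (T : H -> H) e (t : nat -> K) := onb e /\ forall k, T (e k) = t k *: e k.

Section Normal.
Variables (T S : {linear H -> H}) (M : R).
Hypotheses (TM : bnd T M) (TS : isadj T S) (Tn : forall x, S (T x) = T (S x)).

Lemma normal_nm x : nm (S x) = nm (T x).
Proof.
apply/eqP; rewrite -(@eqrXn2 _ 2) ?nm_ge0 // -!Re_ip; apply/eqP; congr complex.Re.
by rewrite TS Tn -(isadj_sym TS).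
Qed.

(** The squared norm of the difference expands into four inner products; adjunction and normality
    reduce each to plus or minus the squared modulus of [a] times [ip x x], and they cancel. *)
Lemma normal_eigen_adj x (a : K) : T x = a *: x -> S x = (a^* )%R *: x.
Proof.
move=> Tx; apply/eqP; rewrite -subr_eq0 -nm_eq0 -sqrf_eq0 -(inj_eq (@complexI R)) -ip_nm.
have h1 : ip (S x) (S x) = (a^*)%R * a * ip x x.
  by rewrite (isadj_sym TS) -Tn -TS Tx ipZl ipZr mulrA.
have h2 : ip (S x) x = a * ip x x by rewrite -TS Tx ipZr.
have h3 : ip x (S x) = (a^*)%R * ip x x by rewrite (isadj_sym TS) Tx ipZl.
rewrite ipBr !ipBl !ipZr !ipZl conjCK h1 h2 h3.
by apply/eqP; ring.
Qed.

Hypothesis Tc : seqcpt T.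

(* T^* T has an eigenvector for m^2, where m is the norm of T on E: a cluster
   point of T u_n, for a maximising sequence u_n. The eigenspace has a compact
   unit sphere, on which the real and imaginary parts of T have a common
   eigenvector. *)
Lemma normal_eigen E : subsp E -> sclosed E ->
  (forall x, E x -> E (T x)) -> (forall x, E x -> E (S x)) ->
  (exists2 x, E x & T x != 0) -> exists x a, [/\ E x, x != 0 & T x = a *: x].
Proof.
move=> sE cE ET ES [x0 Ex0 Tx0]; have [M0 TM'] := TM.
have SM : bnd S M by exact: isadj_bnd TS TM.
have [_ SM'] := SM.
have x00 : x0 != 0 by apply: contra_neq Tx0 => ->; rewrite linear0.
pose V := [set nm (T x) | x in [set x | E x /\ nm x = 1]].
have Ex1 : E ((nm x0)^-1%:C *: x0) by apply: subspZ.
have nx1 : nm ((nm x0)^-1%:C *: x0) = 1.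
  by rewrite nmZ cm_real ger0_norm ?invr_ge0 ?nm_ge0 // mulVf ?nm_eq0.
have hV : has_sup V.
  split; first by exists (nm (T ((nm x0)^-1%:C *: x0))); exists ((nm x0)^-1%:C *: x0).
  by exists M => _ [x [_ x1] <-]; have := TM' x; rewrite x1 mulr1.
have [v [vV vm]] := sup_seq hV; set m := sup V in vm.
have mub x : E x -> nm x = 1 -> nm (T x) <= m.
  by move=> Ex x1; apply: sup_upper_bound => //; exists x.
have m0 : 0 < m.
  apply: lt_le_trans (mub _ Ex1 nx1); rewrite linearZ nmZ cm_real mulr_gt0 ?nm_gt0 //.
  by rewrite normr_gt0 invr_eq0 nm_eq0.
have mubx x : E x -> nm (T x) <= m * nm x.
  move=> Ex; have [->|xn0] := eqVneq x 0; first by rewrite linear0 nm0 mulr0.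
  have nx : 0 < nm x by rewrite nm_gt0.
  rewrite -ler_pdivrMr // mulrC.
  have := mub ((nm x)^-1%:C *: x); rewrite linearZ !nmZ cm_real.
  by rewrite ger0_norm ?invr_ge0 ?nm_ge0 // mulVf ?gt_eqF //; apply=> //; apply: subspZ.
have hu n : exists x, (E x /\ nm x = 1) /\ nm (T x) = v n.
  by have [x] := vV n; exists x.
have [u uP] := choice hu.
have [|p pc] := Tc (u := u); first by move=> n; have [[_ ->]] := uP n.
have Ep : E p by apply: cE pc => n /=; apply: ET; have [[]] := uP n.
(* Since [nm (S (T u)) = nm (T (T u))] is at most [m * v n], the expanded square is at most
   [m^2 (m^2 - v^2)]; the factor 2 is slack. *)
have key n : nm (S (T (u n)) - (m ^+ 2)%:C *: u n) ^+ 2 <=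
    2 * m ^+ 2 * (m ^+ 2 - v n ^+ 2).
  have [[Eu u1] un] := uP n.
  rewrite nmB_ip ipZr Re_realM nmZ cm_real u1 mulr1 (ger0_norm (exprn_ge0 2 (ltW m0))).
  rewrite -TS Re_ip un normal_nm.
  have h : nm (T (T (u n))) ^+ 2 <= (m * v n) ^+ 2.
    rewrite ler_pXn2r ?nnegrE ?nm_ge0 ?mulr_ge0 // -?un ?nm_ge0 ?(ltW m0) //.
    by apply: mubx; apply: ET.
  have v0 : 0 <= v n by rewrite -un nm_ge0.
  have vm' : v n <= m by rewrite -un; exact: mub.
  move: h; rewrite exprMn; set t := nm _ ^+ 2; set a := m ^+ 2; set b := v n ^+ 2 => h.
  have a0 : 0 <= a by rewrite sqr_ge0.
  have ba : b <= a by rewrite /a /b ler_pXn2r ?nnegrE // ltW.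
  nra.
have np : m <= nm p.
  apply/ler_addgt0Pl => d d0; have d2 : 0 < d / 2 by rewrite divr_gt0.
  have [N NP] := vm _ d2; have [n Nn nd] := pc _ N d2; have [_ un] := uP n.
  have := NP n Nn; rewrite -un; have := nm_le (T (u n)) p.
  move: nd => /=; set a := nm (T (u n) - p); set b := nm (T (u n)) => *; lra.
have TSp : T (S p) = (m ^+ 2)%:C *: p.
  apply/eqP; rewrite -subr_eq0 -nm_eq0 eq_le nm_ge0 andbT.
  apply/ler_addgt0Pl => d d0; rewrite addr0.
  (* The error splits below into three parts, at most [d / B] times [M * M], [M] and [m ^+ 2]; the 1
     keeps [B] positive. *)
  pose B := M * M + m ^+ 2 + M + 1.
  have B0 : 0 < B by have := mulr_ge0 M0 M0; have := sqr_ge0 m; rewrite /B; lra.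
  have dB : 0 < d / B by rewrite divr_gt0.
  (* By [m^2 - v^2 = (m - v)(m + v)], the bound in [key] is at most [4 m^3 (m - v)]; this gap brings
     it below [(d / B)^2]. *)
  have [|N NP] := vm ((d / B) ^+ 2 / (4 * m ^+ 3)).
    by rewrite divr_gt0 ?exprn_gt0 // mulr_gt0 ?exprn_gt0.
  have [n Nn nd] := pc _ N dB; have [[Eu u1] un] := uP n.
  have small : nm (S (T (u n)) - (m ^+ 2)%:C *: u n) <= d / B.
    apply: le_sqr (ltW dB) _; apply: le_trans (key n) _.
    have v0 : 0 <= v n by rewrite -un nm_ge0.
    have vm' : v n <= m by rewrite -un; exact: mub.
    have := NP n Nn; rewrite ltrBlDr -ltrBlDl ltr_pdivlMr ?mulr_gt0 ?exprn_gt0 // => /ltW.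
    apply: le_trans.
    have -> : 2 * m ^+ 2 * (m ^+ 2 - v n ^+ 2) = (m - v n) * (2 * m ^+ 2 * (m + v n)) by ring.
    apply: ler_wpM2l; first by rewrite subr_ge0.
    have -> : 4 * m ^+ 3 = 2 * m ^+ 2 * (m + m) by ring.
    apply: ler_wpM2l; first by apply: mulr_ge0; rewrite ?sqr_ge0 ?ler0n.
    by rewrite lerD2l.
  have -> : T (S p) - (m ^+ 2)%:C *: p = T (S (p - T (u n)))
      + T (S (T (u n)) - (m ^+ 2)%:C *: u n) - (m ^+ 2)%:C *: (p - T (u n)).
    by apply: ip_inj => z; rewrite !linearB /= !linearZ /= Tn !(ipBr, ipDr, ipNr, ipZr); ring.
  apply: le_trans (nmB _ _) _; apply: le_trans (lerD (nmD _ _) (lexx _)) _.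
  rewrite nmZ cm_real (ger0_norm (exprn_ge0 2 (ltW m0))).
  have h1 : nm (T (S (p - T (u n)))) <= M * M * nm (p - T (u n)).
    by apply: le_trans (TM' _) _; rewrite -mulrA ler_wpM2l.
  have h2 : nm (T (S (T (u n)) - (m ^+ 2)%:C *: u n)) <= M * (d / B).
    by apply: le_trans (TM' _) _; rewrite ler_wpM2l.
  have h3 : nm (p - T (u n)) <= d / B by rewrite nm_sub ltW.
  have h4 : M * M * nm (p - T (u n)) <= M * M * (d / B) by rewrite ler_wpM2l ?mulr_ge0.
  have h5 : m ^+ 2 * nm (p - T (u n)) <= m ^+ 2 * (d / B) by rewrite ler_wpM2l ?sqr_ge0.
  apply: le_trans (lerD (lerD (le_trans h1 h4) h2) h5) _.
  rewrite -!mulrDl -[X in _ <= X](@divfK _ B) ?gt_eqF // [X in _ <= X]mulrC.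
  by rewrite ler_wpM2r ?ltW // /B; lra.
pose E1 := E `&` [set x | T (S x) = (m ^+ 2)%:C *: x].
have T2 : linear (T \o S) by move=> a x y; rewrite /= !linearP.
have sE1 : subsp E1 by apply: subspI => //; exact: (eigen_subsp (mklin T2)).
have TSM : bnd (mklin T2) (M * M).
  split=> [|x /=]; first exact: mulr_ge0.
  by apply: le_trans (TM' _) _; rewrite -mulrA ler_wpM2l.
have cE1 : sclosed E1.
  move=> w x wE wx; split; first by apply: cE wx => n; have [] := wE n.
  by apply: (eigen_sclosed (A := mklin T2) TSM) wx => n; have [] := wE n.
(* On [E1] a vector is recovered from its image, as [m^-2 S (T w)], so a cluster point of [T w] is
   carried to one of [w]. *)
have cpt w : (forall n, E1 (w n) /\ nm (w n) = 1) -> exists2 x, E1 x & clus w x.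
  move=> wP; have [|q qc] := Tc (u := w); first by move=> n; have [_ ->] := wP n.
  have wq : clus w ((m ^- 2)%:C *: S q).
    have := clus_bnd SM qc; have m2 : 0 < m ^+ 2 by rewrite exprn_gt0.
    move=> h d N d0; have [n Nn nd] := h (d * m ^+ 2) N (mulr_gt0 d0 m2).
    exists n => //; move: nd; rewrite /= Tn; have [[_ ->] _] := wP n.
    have -> : (m ^+ 2)%:C *: w n - S q = (m ^+ 2)%:C *: (w n - (m ^- 2)%:C *: S q).
      by rewrite scalerBr scalerA -rmorphM /= mulfV ?scale1r // gt_eqF.
    by rewrite nmZ cm_real ger0_norm ?ltW // mulrC ltr_pM2r.
  by exists ((m ^- 2)%:C *: S q) => //; apply: cE1 wq => n; have [] := wP n.
have E1T x : E1 x -> E1 (T x).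
  by move=> [Ex xm]; split; [exact: ET|rewrite /= Tn xm linearZ].
have E1S x : E1 x -> E1 (S x).
  by move=> [Ex xm]; split; [exact: ES|rewrite /= -Tn xm linearZ].
pose A1 : H -> H := fun x => T x + S x.
have lA1 : linear A1 by move=> a x y; rewrite /A1 !linearP scalerDr addrACA.
have A1M : bnd (mklin lA1) (M + M).
  split=> [|x /=]; first exact: addr_ge0.
  by apply: le_trans (nmD _ _) _; rewrite mulrDl lerD.
have A1A : isadj (mklin lA1) (mklin lA1).
  by move=> x y /=; rewrite /A1 ipDr ipDl TS (isadj_sym TS) addrC.
have [||x [r [E1x xn0 xr]]] := selfadjoint_eigen A1M A1A sE1 _ cpt.
- by move=> x E1x /=; rewrite /A1 -[T x]scale1r; apply: (proj2 sE1); [exact: E1T|exact: E1S].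
- by exists p => //; rewrite -nm_gt0; exact: lt_le_trans np.
pose E2 := E1 `&` [set x | mklin lA1 x = r%:C *: x].
(* With this sign [T] is [(A1 - i A2) / 2]. Both parts are self-adjoint, and by normality they
   commute, so [A2] preserves the eigenspace [E2] of [A1]. *)
pose A2 : H -> H := fun x => 'i%C *: (T x - S x).
have lA2 : linear A2.
  move=> a y z; apply: ip_inj => w; rewrite /A2 (linearP T) (linearP S).
  by rewrite !(ipBr, ipDr, ipNr, ipZr); ring.
have A2M : bnd (mklin lA2) (M + M).
  split=> [|y /=]; first exact: addr_ge0.
  rewrite /A2 nmZ (_ : cm 'i%C = 1) ?mul1r; last first.
    by rewrite /cm normc_def /= expr0n expr1n add0r sqrtr1.
  by apply: le_trans (nmB _ _) _; rewrite mulrDl lerD.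
have A2A : isadj (mklin lA2) (mklin lA2).
  move=> y z /=; rewrite /A2 ipZr ipZl ipBr ipBl TS (isadj_sym TS).
  rewrite -[((_ : K)^* )%R]/((_ : K)^*%C) /= (_ : 0 -i* 1 = - 'i%C); last by apply/eqP; rewrite eq_complex /= oppr0 !eqxx.
  by rewrite mulNr -mulrN opprB.
have sE2 : subsp E2 by apply: subspI => //; exact: eigen_subsp.
have cE2 : sclosed E2.
  move=> w y wE wy; split; first by apply: cE1 wy => n; have [] := wE n.
  by apply: (eigen_sclosed A1M) wy => n; have [] := wE n.
have [|||y [s [[E1y yr] yn0 ys]]] := selfadjoint_eigen A2M A2A sE2.
- move=> y [E1y yr]; split.
    rewrite /= /A2; apply: (subspZ _ sE1); rewrite -scaleN1r addrC.
    by apply: (proj2 sE1); [exact: E1S|exact: E1T].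
  move: yr; rewrite /= /A1 /A2 => yr.
  have Tr : T (T y) + T (S y) = r%:C *: T y by rewrite -linearD yr linearZ.
  have Sr : S (T y) + S (S y) = r%:C *: S y by rewrite -linearD yr linearZ.
  have -> : r%:C *: ('i%C *: (T y - S y)) = 'i%C *: (r%:C *: T y - r%:C *: S y).
    by apply: ip_inj => z; rewrite !(ipBr, ipDr, ipNr, ipZr); ring.
  rewrite -Tr -Sr !linearZ /= !linearB /= Tn.
  by apply: ip_inj => z; rewrite !(ipBr, ipDr, ipNr, ipZr); ring.
- move=> w wP; have [|y E1y wy] := cpt w; first by move=> n; have [[]] := wP n.
  by exists y => //; apply: cE2 wy => n; have [] := wP n.
- by exists x.
exists y, (2^-1 * (r%:C - 'i%C * s%:C)); split=> //; first by case: E1y.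
rewrite -scalerA scalerBl -yr -scalerA -ys /= /A1 /A2 scalerA -expr2 sqr_i scaleN1r opprK.
by apply: ip_inj => z; rewrite !(ipZr, ipDr, ipNr); field.
Qed.

(** Take a maximal orthonormal set of eigenvectors. Its complement [F] is invariant under [T] and
    [S], since eigenvectors of [T] are eigenvectors of [S]. If [T] is nonzero on [F], then
    [normal_eigen] finds an eigenvector there; if it vanishes on [F], any nonzero vector of [F] is
    one. Either contradicts maximality. *)
Lemma normal_diag (Hsep : exists2 D : set H, countable D & dense D) :
  ~ finite_dim [set: H] -> exists e t, diag T e t.
Proof.
move=> Hinf; pose Q := [set x | exists a, T x = a *: x].
have [//|//|E [onE _ EQ maxE]] := @maximal_onset R H Q set0.
have totE : total_set E.
  move=> x xE; apply/eqP/negPn/negP => xn0.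
  pose F := [set y | forall z, E z -> ip z y = 0].
  have normalise y a : F y -> y != 0 -> T y = a *: y -> False.
    move=> Fy yn0 Ty; apply: (maxE ((nm y)^-1%:C *: y)).
    - by exists a; rewrite linearZ /= Ty !scalerA mulrC.
    - rewrite ipZl ipZr realcE ip_nm mulrA -!rmorphM /= -expr2 exprVn mulVf //.
      by rewrite expf_eq0 nm_eq0.
    - by move=> z Ez; rewrite ipZr Fy ?mulr0.
  have [[y Fy Ty]|FT] := pselect (exists2 y, F y & T y != 0); last first.
    apply: (normalise x 0) => //; rewrite scale0r; apply/eqP/negPn/negP => Tx.
    by apply: FT; exists x.
  have [|||||y' [a [Fy' yn0 Ty']]] := @normal_eigen F; last exact: normalise Ty'.
  - split=> [z _|a z w Fz Fw k Ek]; first by rewrite ip0r.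
    by rewrite ipDr ipZr Fz // Fw // mulr0 addr0.
  - move=> u z uF uz k Ek; apply/eqP; rewrite -cm_eq0 eq_le cm_ge0 andbT.
    apply/ler_addgt0Pl => d d0; rewrite addr0.
    have k1 : 0 < nm k + 1 by rewrite ltr_wpDl ?nm_ge0.
    have [n _ nd] := uz (d / (nm k + 1)) 0%N (divr_gt0 d0 k1).
    rewrite -[ip k z]subr0 -(uF n k Ek) -ipBr.
    apply: le_trans (cauchy_schwarz _ _) _.
    move: nd; rewrite ltr_pdivlMr // nm_sub; have := nm_ge0 (z - u n); have := nm_ge0 k.
    set a := nm k; set b := nm _ => *; nra.
  - move=> z Fz k Ek; have [a ka] := EQ _ Ek.
    by rewrite TS (normal_eigen_adj ka) ipZl Fz // mulr0.
  - move=> z Fz k Ek; have [a ka] := EQ _ Ek.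
    by rewrite (isadj_sym TS) ka ipZl Fz // mulr0.
  - by exists y.
have [e [eb eE _]] := onb_enum Hsep Hinf onE totE.
have h k : exists a, T (e k) = a *: e k by exact: EQ.
by have [t tP] := choice h; exists e, t; split.
Qed.

End Normal.
End Spectral.

(** * Schatten classes and traces *)

Section ConjugateExponents.
Context {R : realType}.
Implicit Types (p q : \bar R) (a x : nat -> R).

(** For a finite exponent [M] bounds the sum of the powers, not its root. *)
Definition lpball p (M : R) x : Prop :=
  match p with
  | r%:E => forall n, \sum_(k < n) x k `^ r <= M
  | +oo%E => forall k, x k <= M
  | -oo%E => False
  end.

(** At infinity a null sequence is asked for, not a bounded one: eigenvalues of compact operators
    form one, and for merely bounded [a] the uniform tails of [holder_tail] would fail. *)
Definition lptail p a : Prop :=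
  match p with
  | r%:E => exists M, lpball p M a
  | +oo%E => forall e : R, 0 < e -> exists N, forall n, (N <= n)%N -> a n <= e
  | -oo%E => False
  end.

Definition conj_exp p q := [/\ (1 <= p)%E, (1 <= q)%E & (p^-1 + q^-1 = 1)%E].

Lemma conj_exp_sym p q : conj_exp p q -> conj_exp q p.
Proof. by case=> p1 q1; rewrite addeC. Qed.

Variant conj_exp_spec : \bar R -> \bar R -> Prop :=
| ConjExp1y : conj_exp_spec 1%E +oo%E
| ConjExpy1 : conj_exp_spec +oo%E 1%E
| ConjExpFin (a b : R) of 1 < a & 1 < b & a^-1 + b^-1 = 1 : conj_exp_spec a%:E b%:E.

Lemma conj_expP p q : conj_exp p q -> conj_exp_spec p q.
Proof.
case: p => [a| |] [] //; last first.
  by move=> _ _; rewrite invey add0e => /eqP; rewrite inve_eq1 => /eqP ->; exact: ConjExpy1.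
case: q => [b| |] //; last first.
  by move=> _ _; rewrite invey adde0 => /eqP; rewrite inve_eq1 => /eqP ->; exact: ConjExp1y.
rewrite !lee_fin => a1 b1; have a0 : 0 < a by lra.
have b0 : 0 < b by lra.
rewrite !inver !gt_eqF // -EFinD => -[ab].
have ai : 0 < a^-1 by rewrite invr_gt0.
have bi : 0 < b^-1 by rewrite invr_gt0.
by apply: ConjExpFin => //; rewrite -invf_lt1 //; lra.
Qed.

(** Young's inequality for [l^-1 x] and [l y], without the factors [1/a] and [1/b]. The free scale
    [l] distributes the error between the two sequences. *)
Lemma young_scaled (a b x y l : R) : 1 < a -> 1 < b -> a^-1 + b^-1 = 1 -> 0 < l ->
  0 <= x -> 0 <= y -> x * y <= l^-1 `^ a * x `^ a + l `^ b * y `^ b.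
Proof.
move=> a1 b1 ab l0 x0 y0; have a0 : 0 < a by lra.
have b0 : 0 < b by lra.
have -> : x * y = (l^-1 * x) * (l * y) by field; rewrite gt_eqF.
apply: le_trans (conjugate_powR _ _ a0 b0 ab) _; rewrite ?mulr_ge0 ?invr_ge0 ?(ltW l0) //.
rewrite !powRM ?invr_ge0 ?(ltW l0) //; apply: lerD.
  by rewrite ler_pdivrMr // ler_peMr ?mulr_ge0 ?powR_ge0 // ltW.
by rewrite ler_pdivrMr // ler_peMr ?mulr_ge0 ?powR_ge0 // ltW.
Qed.

Lemma lpball1 M x : (forall k, 0 <= x k) -> lpball 1%E M x -> forall n, \sum_(k < n) x k <= M.
Proof.
move=> x0 xM n; apply: le_trans (xM n); apply: ler_sum => i _.
by rewrite powRr1.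
Qed.

Lemma sum_nat_le (a : nat -> R) N n : (forall k, 0 <= a k) ->
  \sum_(N <= k < n) a k <= \sum_(k < n) a k.
Proof.
move=> a0; have [Nn|nN] := leqP N n; last by rewrite big_geq ?sumr_ge0 // ltnW.
by rewrite (sum_split a Nn) lerDr sumr_ge0.
Qed.

(** [N] is chosen before [x]. This uniformity over a whole ball allows all orthonormal bases to be
    truncated at the same index. *)
Lemma holder_tail p q a : conj_exp p q -> (forall k, 0 <= a k) -> lptail p a ->
  forall M e, 0 < e -> exists N, forall x, (forall k, 0 <= x k) -> lpball q M x ->
    forall n, \sum_(N <= k < n) a k * x k <= e.
Proof.
move=> pq a0; case: (conj_expP pq) => [|| {pq} r s r1 s1 rs] aT M e e0.
- have [M' aM] := aT; have M1 : 0 < `|M| + 1 by rewrite ltr_wpDl.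
  have [N NP] := sum_tail a0 (lpball1 a0 aM) (divr_gt0 e0 M1).
  exists N => x x0 xM n; have := NP n; rewrite ler_pdivlMr // => /(le_trans _); apply.
  rewrite mulr_suml; apply: ler_sum => k _; apply: ler_wpM2l => //.
  by apply: le_trans (xM k) _; rewrite (le_trans (ler_norm _)) // lerDl.
- have M1 : 0 < `|M| + 1 by rewrite ltr_wpDl.
  have [N NP] := aT _ (divr_gt0 e0 M1).
  exists N => x x0 xM n; apply: (@le_trans _ _ (\sum_(N <= k < n) (e / (`|M| + 1)) * x k)).
    rewrite big_nat [leRHS]big_nat; apply: ler_sum => k /andP[Nk _].
    by rewrite ler_wpM2r // NP.
  rewrite -mulr_sumr mulrAC ler_pdivrMr // ler_pM2l //.
  apply: le_trans (sum_nat_le N n x0) _; apply: le_trans (lpball1 x0 xM n) _.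
  by rewrite (le_trans (ler_norm _)) // lerDl.
- have [M' aM] := aT; have M1 : 0 < `|M| + 1 by rewrite ltr_wpDl.
  have r0 : 0 < r by lra.
  have s0 : 0 < s by lra.
  have e2 : 0 < e / 2 by rewrite divr_gt0.
  (* This scale makes the contribution of [x] at most [e / 2] on the whole ball; only then is [N]
     chosen to make that of [a] at most [e / 2]. *)
  pose l := (e / 2 / (`|M| + 1)) `^ s^-1.
  have l0 : 0 < l by apply: powR_gt0; exact: divr_gt0.
  have lsE : l `^ s = e / 2 / (`|M| + 1).
    by rewrite -powRrM mulVf ?gt_eqF // powRr1 // ltW // divr_gt0.
  have L0 : 0 < l^-1 `^ r by apply: powR_gt0; rewrite invr_gt0.
  have [N NP] := sum_tail (a := fun k => a k `^ r) (fun k => powR_ge0 _ _) aM (divr_gt0 e2 L0).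
  exists N => x x0 xM n.
  apply: (@le_trans _ _ (\sum_(N <= k < n) (l^-1 `^ r * a k `^ r + l `^ s * x k `^ s))).
    by apply: ler_sum => k _; exact: young_scaled.
  rewrite big_split /= -!mulr_sumr (splitr e); apply: lerD.
    by rewrite mulrC -ler_pdivlMr.
  rewrite lsE mulrAC ler_pdivrMr // ler_pM2l //.
  apply: le_trans (sum_nat_le N n (fun k => powR_ge0 (x k) s)) _; apply: le_trans (xM n) _.
  by rewrite (le_trans (ler_norm _)) // lerDl.
Qed.

(** The graph of the r-th power lies above its tangent at [m]. For [r > 1] this is Young's
    inequality with exponents [r] and [r / (r - 1)]. *)
Lemma tangent_powR (r m a : R) : 1 <= r -> 0 <= m -> 0 <= a ->
  r * (m `^ (r - 1) * a) <= a `^ r + (r - 1) * m `^ r.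
Proof.
move=> r1 m0 a0; have [->|rn1] := eqVneq r 1.
  by rewrite subrr powRr0 powRr1 // !mul1r mul0r addr0.
have r1' : 1 < r by rewrite lt_neqAle eq_sym rn1.
have r0 : 0 < r by lra.
have rB : 0 < r - 1 by lra.
have := @conjugate_powR R a (m `^ (r - 1)) r (r / (r - 1)) a0 (powR_ge0 _ _) r0.
rewrite divr_gt0 // -powRrM mulrCA divff ?gt_eqF // mulr1 => /(_ isT).
have -> : r^-1 + (r / (r - 1))^-1 = 1 by field; rewrite !gt_eqF.
move=> /(_ erefl) h; rewrite [m `^ _ * _]mulrC.
have -> : a `^ r + (r - 1) * m `^ r = r * (a `^ r / r + m `^ r / (r / (r - 1))).
  by field; rewrite !gt_eqF.
by rewrite ler_pM2l.
Qed.

End ConjugateExponents.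

(** * Schmidt decompositions tested on Bessel sequences *)

Section Bessel.
Context {R : realType} {H : hilbertType R}.
Local Notation K := R[i].
Implicit Types (x y z : H) (u v e f g : nat -> H) (s : nat -> R).

Lemma bessel_isom u (A B : H -> H) : isadj A B -> (forall x, nm (B x) <= nm x) ->
  bessel u -> bessel (A \o u).
Proof.
move=> AB B1 ub x n; apply: le_trans (_ : nm (B x) ^+ 2 <= _); last first.
  by rewrite ler_pXn2r ?nnegrE ?nm_ge0.
apply: le_trans (ub (B x) n); apply: ler_sum => i _.
by rewrite (isadj_sym AB).
Qed.

Definition oproj e n x := \sum_(k < n) ip (e k) x *: e k.

Lemma oproj_adj e n : isadj (oproj e n) (oproj e n).
Proof.
move=> x y; rewrite /oproj ip_sumr ip_suml; apply: eq_bigr => i _.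
by rewrite ipZr ipZl -ipC mulrC.
Qed.

Lemma oproj_nm e n x : orthonormal_seq e -> nm (oproj e n x) <= nm x.
Proof.
move=> eon; apply: le_sqr (nm_ge0 _) _; rewrite (on_bessel_eq x n eon).
rewrite (on_sum_nm (fun k => ip (e k) x) n eon) lerDl.
by rewrite exprn_ge0 ?nm_ge0.
Qed.

Lemma bessel_proj e n u : orthonormal_seq e -> bessel u -> bessel (oproj e n \o u).
Proof.
by move=> eon; apply: bessel_isom (@oproj_adj e n) _ => x; exact: oproj_nm.
Qed.

Definition schmidt_dec (A : H -> H) s f g :=
  [/\ orthonormal_seq f, orthonormal_seq g, forall n, 0 <= s n &
    forall x, cvs (fun n => \sum_(k < n) ((s k)%:C * ip (f k) x) *: g k) (A x)].

(** Dominates the product of the two moduli, which occurs in the Schmidt expansion of [ip x (A y)].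
    Bessel's inequality bounds its sums over [k], and also over sequences of vectors [x] and [y], by
    1. *)
Definition besselmean f g x y k := (cm (ip x (g k)) ^+ 2 + cm (ip (f k) y) ^+ 2) / 2.

Lemma besselmean_ge0 f g x y k : 0 <= besselmean f g x y k.
Proof. by rewrite divr_ge0 // addr_ge0 // exprn_ge0 ?cm_ge0. Qed.

Lemma besselmean_suml f g x y n : bessel f -> bessel g -> nm x <= 1 -> nm y <= 1 ->
  \sum_(k < n) besselmean f g x y k <= 1.
Proof.
move=> fb gb x1 y1; rewrite -mulr_suml ler_pdivrMr // mul1r big_split /=.
rewrite -[2]/(1 + 1); apply: lerD.
  under eq_bigr do rewrite cm_ipC.
  by apply: le_trans (gb x n) _; rewrite expr_le1 ?nm_ge0.
by apply: le_trans (fb y n) _; rewrite expr_le1 ?nm_ge0.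
Qed.

Lemma besselmean_sumr f g u v k n : nm (f k) <= 1 -> nm (g k) <= 1 -> bessel u -> bessel v ->
  \sum_(i < n) besselmean f g (u i) (v i) k <= 1.
Proof.
move=> f1 g1 ub vb; rewrite -mulr_suml ler_pdivrMr // mul1r big_split /=.
rewrite -[2]/(1 + 1); apply: lerD.
  by apply: le_trans (ub _ n) _; rewrite expr_le1 ?nm_ge0.
under eq_bigr do rewrite cm_ipC.
by apply: le_trans (vb _ n) _; rewrite expr_le1 ?nm_ge0.
Qed.

(* The weights [besselmean] are doubly substochastic, so this is Jensen's
   inequality, in its tangent line form to avoid a limit under the power. *)
Lemma schmidt_ball (A : H -> H) s f g (r M : R) : 1 <= r ->
  schmidt_dec A s f g -> lpball r%:E M s -> forall u v, bessel u -> bessel v ->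
  lpball r%:E M (fun k => cm (ip (u k) (A (v k)))).
Proof.
move=> r1 [fon gon s0 As] sM u v ub vb n.
have fb := on_bessel fon; have gb := on_bessel gon.
have r0 : 0 < r by lra.
pose a k := cm (ip (u k) (A (v k))); pose w k m := besselmean f g (u k) (v k) m.
have w0 k m : 0 <= w k m by exact: besselmean_ge0.
have step k (e : R) : 0 < e -> exists N, forall m, (N <= m)%N ->
    a k `^ r <= \sum_(i < m) w k i * s i `^ r + e.
  move=> e0; pose c := r * a k `^ (r - 1).
  have c0 : 0 <= c by rewrite mulr_ge0 ?powR_ge0 // ltW.
  have c1 : 0 < c + 1 by rewrite ltr_wpDl.
  have [N NP] := cvs_ipr (u k) (As (v k)) (divr_gt0 e0 c1).
  exists N => m /NP; rewrite ip_sumr ltr_pdivlMr // => h.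
  have ak : a k <= \sum_(i < m) s i * w k i + e / (c + 1).
    have := @nm_le R (R[i]^o) (ip (u k) (A (v k))) (\sum_(i < m) ip (u k) (((s i)%:C * ip (f i) (v k)) *: g i)).
    move=> /le_trans; apply; apply: lerD; last first.
      by rewrite nm_sub ler_pdivlMr // ltW.
    apply: le_trans (nm_sum _ _ _) _; apply: ler_sum => i _.
    rewrite nm_cm ipZr !cmM cm_real ger0_norm // -mulrA ler_wpM2l // /w /besselmean.
    set x := cm _; set y := cm _; have := sqr_ge0 (x - y); nra.
  (* The tangent inequality at [a k] is averaged with the weights [w k i]; a total weight below 1
     does no harm, as [(r - 1) * a k ^ r] is nonnegative. *)
  have sw : r * (a k `^ (r - 1) * \sum_(i < m) s i * w k i) <=
      \sum_(i < m) w k i * s i `^ r + (r - 1) * a k `^ r.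
    rewrite !mulr_sumr.
    apply: (@le_trans _ _ (\sum_(i < m) w k i * (s i `^ r + (r - 1) * a k `^ r))).
      apply: ler_sum => i _.
      have := tangent_powR r1 (cm_ge0 (ip (u k) (A (v k)))) (s0 i); rewrite -/(a k) => t.
      by have := ler_wpM2l (w0 k i) t; congr (_ <= _); ring.
    under eq_bigr do rewrite mulrDr; rewrite big_split /= lerD2l -mulr_suml.
    rewrite ler_piMl ?mulr_ge0 ?powR_ge0 ?subr_ge0 //.
    by apply: besselmean_suml => //; exact: bessel_nm.
  have ar : r * (a k `^ (r - 1) * a k) = r * a k `^ r.
    by rewrite [_ * a k]mulrC mulr_powRB1 ?cm_ge0.
  have := ler_wpM2l c0 ak; rewrite {1}/c -mulrA ar mulrDr.
  have ce : c * (e / (c + 1)) <= e.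
    by rewrite mulrCA ler_piMr ?(ltW e0) // ler_pdivrMr // mul1r lerDl.
  by move: sw ce; rewrite /c; lra.
(* Each of the [n] terms may use up [d / n.+1]; the successor avoids dividing by zero. *)
apply/ler_addgt0Pl => d d0; have n1 : 0 < n.+1%:R :> R by rewrite ltr0n.
have dn : 0 < d / n.+1%:R by rewrite divr_gt0.
have /choice[N NP] : forall k, exists N, forall m, (N <= m)%N ->
    a k `^ r <= \sum_(i < m) w k i * s i `^ r + d / n.+1%:R by move=> k; exact: step.
pose m := (\max_(k < n) N k)%N.
apply: (@le_trans _ _ (\sum_(k < n) (\sum_(i < m) w k i * s i `^ r + d / n.+1%:R))).
  by apply: ler_sum => k _; apply: NP; exact: leq_bigmax.
rewrite big_split /= sumr_const card_ord addrC; apply: lerD.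
  by rewrite -[leLHS]mulr_natr mulrAC ler_pdivrMr // ler_pM2l // ler_nat.
rewrite exchange_big /=; apply: le_trans (sM m); apply: ler_sum => i _.
rewrite -mulr_suml ler_piMl ?powR_ge0 //.
by apply: besselmean_sumr => //; exact: bessel_nm.
Qed.

End Bessel.

(** * Existence of the trace and its independence of the basis *)

Section Trace.
Context {R : realType} {H : hilbertType R}.
Local Notation K := R[i].
Local Notation cvc := (@cvs R (R[i]^o)).
Implicit Types (x y : H) (u v e f g : nat -> H) (s : nat -> R) (p q : \bar R).

(* R[i] inherits completeness from H, along a line. *)
Lemma scalar_complete x (c : nat -> R[i]^o) : nm x = 1 ->
  (forall d : R, 0 < d -> exists N, forall m n, (N <= m)%N -> (m <= n)%N ->
     \sum_(m <= k < n) cm (c k) <= d) -> exists l, cvs (fun n => \sum_(k < n) c k) l.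
Proof.
move=> x1 cc; have [|y yP] := @series_complete R H (fun k => c k *: x).
  move=> d /cc[N NP]; exists N => m n Nm mn; apply: le_trans (NP m n Nm mn).
  by apply: le_trans (nm_sum _ _ _) _; apply: ler_sum => i _; rewrite nmZ x1 mulr1.
exists (ip x y); apply: eq_cvs (cvs_ipr x yP) => n.
by rewrite ip_sumr; apply: eq_bigr => i _; rewrite ipZr ip_nm x1 expr1n mulr1.
Qed.

(** Dominated convergence: beyond some [N] the sums are small uniformly in [k], and the finitely
    many terms before [N] converge one by one. *)
Lemma dominated_limit p q s (M : R) (d : nat -> nat -> K) (d' t : nat -> K) x :
  nm x = 1 -> conj_exp p q -> (forall n, 0 <= s n) -> lptail p s ->
  (forall k, lpball q M (fun n => cm (d k n))) -> lpball q M (fun n => cm (d' n)) ->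
  (forall n, cvc (d^~ n) (d' n)) ->
  (forall k, cvc (fun n => \sum_(m < n) (s m)%:C * d k m) (t k)) ->
  exists2 l, cvc (fun n => \sum_(m < n) (s m)%:C * d' m) l & cvc t l.
Proof.
move=> x1 pq s0 st dM d'M dd' tE; have tail := holder_tail pq s0 st M.
have cs (c : nat -> K) m n : \sum_(m <= k < n) cm ((s k)%:C * c k) =
    \sum_(m <= k < n) s k * cm (c k).
  by apply: eq_bigr => k _; rewrite cmM cm_real ger0_norm.
have [l lP] : exists l, cvc (fun n => \sum_(m < n) (s m)%:C * d' m) l.
  apply: (scalar_complete (c := fun m => (s m)%:C * d' m) x1) => e /tail[N NP]; exists N => m n Nm mn.
  rewrite cs; apply: le_trans (NP _ (fun k => cm_ge0 (d' k)) d'M n).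
  rewrite (big_cat_nat Nm mn) /= lerDr; apply: sumr_ge0 => k _.
  by rewrite mulr_ge0 ?cm_ge0.
exists l => // e e0; have e3 : 0 < e / 4 by rewrite divr_gt0.
have [N NP] := tail _ e3.
have bound (c : nat -> K) b : lpball q M (fun n => cm (c n)) ->
    cvc (fun n => \sum_(m < n) (s m)%:C * c m) b ->
    cm (b - \sum_(m < N) (s m)%:C * c m) <= e / 4.
  move=> cM cb; apply: (cvs_bound (N := N) cb) => n Nn.
  rewrite (sum_split (fun m => (s m)%:C * c m) Nn) addrAC subrr add0r.
  apply: le_trans (nm_sum _ _ _) _; rewrite cs.
  by apply: NP => // k; exact: cm_ge0.
have [|k kP] := @cvs_sum R (R[i]^o) _ (index_enum 'I_N)
    (fun m k => (s m)%:C * d k m) (fun m => (s m)%:C * d' m) _ (e / 4) e3.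
  by move=> m; apply: (cvsM _ (dd' m)).
exists k => n /kP kn.
have h1 := bound _ _ (dM n) (tE n); have h2 := bound _ _ d'M lP.
rewrite nm_cm; apply: le_lt_trans (cm_split (\sum_(m < N) (s m)%:C * d n m) _ _) _.
have := cm_split (\sum_(m < N) (s m)%:C * d' m) (\sum_(m < N) (s m)%:C * d n m) l.
have {}kn : cm (\sum_(m < N) (s m)%:C * d n m - \sum_(m < N) (s m)%:C * d' m) < e / 4 := kn.
rewrite (cm_sub (\sum_(m < N) (s m)%:C * d' m)).
move: kn h1 h2; set t1 := cm _; set t2 := cm _; set t3 := cm _; set t4 := cm _.
by move=> *; lra.
Qed.

Lemma cvs_proj e x : onb e -> cvs (fun n => oproj e n x) x.
Proof. by case=> eon ex; exact: ex. Qed.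

Lemma proj_sum (A : {linear H -> H}) e n x y :
  \sum_(k < n) ip y (A (e k)) * ip (e k) x = ip y (A (oproj e n x)).
Proof.
rewrite /oproj linear_sum ip_sumr; apply: eq_bigr => k _.
by rewrite linearZ ipZr mulrC.
Qed.

(** With [A] expanded, the partial trace over n basis vectors is the sum of
    [s m * ip (f m) (S (P (g m)))] with [P] the projection on these vectors. As n grows, [P]
    disappears, and the limit no longer mentions the basis. *)
Lemma trace_schmidt_left p q (A S : {linear H -> H}) s f g (M MS : R) :
  conj_exp p q -> lptail p s -> schmidt_dec A s f g -> bnd S MS ->
  (forall u v, bessel u -> bessel v -> lpball q M (fun k => cm (ip (u k) (S (v k))))) ->
  exists z, forall e, onb e ->
    cvc (fun n => \sum_(k < n) ip (e k) (A (S (e k)))) z.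
Proof.
move=> pq st [fon gon s0 As] SM SD.
have fb := on_bessel fon; have gb := on_bessel gon.
have f1 := on_nm 0 fon.
have H1 e : onb e -> exists2 l,
    cvc (fun n => \sum_(m < n) (s m)%:C * ip (f m) (S (g m))) l &
    cvc (fun n => \sum_(k < n) ip (e k) (A (S (e k)))) l.
  move=> eb; have [eon _] := eb.
  apply: (@dominated_limit p q s M (fun n m => ip (f m) (S (oproj e n (g m))))
    (fun m => ip (f m) (S (g m))) (fun n => \sum_(k < n) ip (e k) (A (S (e k))))) f1 pq s0 st _ _ _ _.
  - by move=> n; apply: (SD f (oproj e n \o g)) => //; exact: bessel_proj.
  - exact: SD.
  - by move=> m; apply: cvs_ipr; apply: cvs_bnd SM _; exact: cvs_proj.
  - move=> n; have := @cvs_sum R (R[i]^o) _ (index_enum 'I_n)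
      (fun k j => \sum_(m < j) (s m)%:C * ip (f m) (S (e k)) * ip (e k) (g m))
      (fun k => ip (e k) (A (S (e k)))).
    move=> h; apply: eq_cvs (h _) => [j|k].
      rewrite exchange_big /=; apply: eq_bigr => m _.
      by rewrite -proj_sum mulr_sumr; apply: eq_bigr => k _; rewrite mulrA.
    apply: eq_cvs (cvs_ipr (e k) (As (S (e k)))) => j.
    by rewrite ip_sumr; apply: eq_bigr => m _; rewrite ipZr.
have [[e eb]|ne] := pselect (exists e, onb e); last first.
  by exists 0 => e eb; case: ne; exists e.
have [l lP _] := H1 e eb; exists l => e' /H1[l' lP'].
by rewrite (cvs_unique lP lP').
Qed.

(** The case in which [A] is merely bounded: the second factor is expanded, and the projection falls
    on [f m] instead. *)
Lemma trace_schmidt_right (A S : {linear H -> H}) s f g (M : R) :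
  lptail 1%E s -> schmidt_dec S s f g -> bnd A M ->
  exists z, forall e, onb e ->
    cvc (fun n => \sum_(k < n) ip (e k) (A (S (e k)))) z.
Proof.
move=> st [fon gon s0 Ss] AM.
have fb := on_bessel fon; have gb := on_bessel gon.
have f1 := on_nm 0 fon; have [M0 AM'] := AM.
have pq : conj_exp (1 : \bar R)%E +oo%E.
  by split; rewrite ?leey // inve1 invey adde0.
have AD u v : bessel u -> bessel v -> lpball +oo%E M (fun k => cm (ip (u k) (A (v k)))).
  move=> ub vb k; apply: le_trans (cauchy_schwarz _ _) _.
  rewrite -[M]mul1r; apply: ler_pM; rewrite ?nm_ge0 ?bessel_nm //.
  by apply: le_trans (AM' _) _; rewrite ler_piMr // bessel_nm.
have H1 e : onb e -> exists2 l,
    cvc (fun n => \sum_(m < n) (s m)%:C * ip (f m) (A (g m))) l &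
    cvc (fun n => \sum_(k < n) ip (e k) (A (S (e k)))) l.
  move=> eb; have [eon _] := eb.
  apply: (@dominated_limit _ _ s M (fun n m => ip (oproj e n (f m)) (A (g m)))
    (fun m => ip (f m) (A (g m))) (fun n => \sum_(k < n) ip (e k) (A (S (e k))))) f1 pq s0 st _ _ _ _.
  - by move=> n; apply: (AD (oproj e n \o f) g) => //; exact: bessel_proj.
  - exact: AD.
  - by move=> m; apply: cvs_ipl; exact: cvs_proj.
  - move=> n; have := @cvs_sum R (R[i]^o) _ (index_enum 'I_n)
      (fun k j => \sum_(m < j) (s m)%:C * (ip (f m) (e k) * ip (e k) (A (g m))))
      (fun k => ip (e k) (A (S (e k)))).
    move=> h; apply: eq_cvs (h _) => [j|k].
      rewrite exchange_big /=; apply: eq_bigr => m _.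
      rewrite -mulr_sumr; congr (_ * _).
      rewrite /oproj ip_suml; apply: eq_bigr => k _.
      by rewrite ipZl -ipC.
    apply: eq_cvs (cvs_ipr (e k) (cvs_bnd AM (Ss (e k)))) => j.
    rewrite linear_sum ip_sumr; apply: eq_bigr => m _.
    by rewrite linearZ ipZr mulrA.
have [[e eb]|ne] := pselect (exists e, onb e); last first.
  by exists 0 => e eb; case: ne; exists e.
have [l lP _] := H1 e eb; exists l => e' /H1[l' lP'].
by rewrite (cvs_unique lP lP').
Qed.

Lemma trace_onb (A : H -> H) (z : R[i]^o) e : onb e ->
  (forall e, onb e -> cvc (fun n => \sum_(k < n) ip (e k) (A (e k))) z) ->
  trace A = z.
Proof.
move=> eb h; rewrite /trace; case: xgetP => [w _ /= wP|/(_ z)].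
  apply: cvs_unique (h e eb); apply/cvsP.
  by have /onbP/wP := eb; rewrite seriesE.
by case=> e' /onbP/h/cvsP; rewrite seriesE.
Qed.

Lemma compact_bnd (A : {linear H -> H}) : compact_op A -> exists M, bnd A M.
Proof. by move/compact_seqcpt/seqcpt_bnd. Qed.

Lemma schatten_bnd p (A : {linear H -> H}) : schatten p A -> exists M, bnd A M.
Proof. by case=> /compact_bnd. Qed.

Lemma schatten_schmidt (r : R) (A : {linear H -> H}) : schatten r%:E A ->
  exists s f g, schmidt_dec A s f g /\ lptail r%:E s.
Proof.
case=> _ [s [s0 _ _ [f [g [fon gon As]]]] sr]; exists s, f, g; split.
  by split=> // x; apply/cvsP; have := As x; rewrite seriesE.
exists (fine (\sum_(0 <= n <oo) (s n `^ r)%:E)) => n.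
have p0 k : (0%N <= k)%N -> xpredT k -> (0 <= (s k `^ r)%:E)%E.
  by move=> _ _; rewrite lee_fin powR_ge0.
rewrite -lee_fin fineK; last first.
  by rewrite ge0_fin_numE //; apply: nneseries_ge0.
by apply: le_trans (nneseries_lim_ge n p0); rewrite big_mkord -sumEFin.
Qed.

Lemma schatten_ball p (A : {linear H -> H}) : (1 <= p)%E -> schatten p A ->
  exists M, forall u v, bessel u -> bessel v -> lpball p M (fun k => cm (ip (u k) (A (v k)))).
Proof.
case: p => [r| |] // r1 Ap.
  have [s [f [g [sd [M sM]]]]] := schatten_schmidt Ap.
  by exists M => u v; apply: schmidt_ball sd sM _ _ => //; rewrite -lee_fin.
have [M [M0 AM]] := schatten_bnd Ap; exists M => u v ub vb k.
apply: le_trans (cauchy_schwarz _ _) _.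
rewrite -[M]mul1r; apply: ler_pM; rewrite ?nm_ge0 ?bessel_nm //.
by apply: le_trans (AM _) _; rewrite ler_piMr // bessel_nm.
Qed.

Lemma trace_exists p q (C T U : {linear H -> H}) e : onb e -> conj_exp p q ->
  schatten p C -> schatten q T -> unitary_op U ->
  exists z, forall f, onb f ->
    cvc (fun n => \sum_(k < n) ip (f k) (C (adjoint U (T (U (f k)))))) z.
Proof.
move=> eb pq Cp Tq Uu; have [p1 q1 _] := pq.
have [/bounded_opP[MU UM] VU UV] := Uu; have UV' := riesz_adjoint eb UM.
have Un x : nm (U x) = nm x.
  by apply/eqP; rewrite -(@eqrXn2 _ 2) ?nm_ge0 // -!Re_ip (unitary_ip _ _ eb Uu).
have Vn x : nm (adjoint U x) = nm x by rewrite -Un; congr nm; exact: UV.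
have lS : linear (adjoint U \o T \o U).
  by move=> a x y /=; rewrite !linearP (isadj_linear UV').
pose S := mklin lS.
have [MT [MT0 TM]] := schatten_bnd Tq.
have SM : bnd S MT by split=> // x; rewrite /= Vn; apply: le_trans (TM _) _; rewrite Un.
have [MC CM] := schatten_bnd Cp.
have Ub u : bessel u -> bessel (U \o u).
  by apply: bessel_isom UV' _ => x; rewrite Vn.
have Von u : orthonormal_seq u -> orthonormal_seq (adjoint U \o u).
  move=> uon m n; rewrite -[LHS]/(ip (adjoint U (u m)) (adjoint U (u n))) -UV'.
  by rewrite (_ : U _ = u n); [exact: uon|exact: UV].
(* For finite [p] the operator [C] is expanded. The conjugate of [T] satisfies the same bounds as
   [T], because [U] preserves Bessel sequences. *)
case: p pq p1 Cp => [r| |] // pq r1 Cp.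
  have [s [f [g [sd st]]]] := schatten_schmidt Cp.
  have [M TD] := schatten_ball q1 Tq.
  have [|z zP] := @trace_schmidt_left _ q C S s f g M MT pq st sd SM.
    move=> u v ub vb; have := TD _ _ (Ub _ ub) (Ub _ vb).
    congr (lpball _ _ _); apply/funext => k /=.
    by congr cm; rewrite [RHS](isadj_sym UV').
  by exists z => f' /zP.
(* For infinite [p] the expansion is that of [T], with both orthonormal systems carried over by the
   adjoint of [U]. *)
have {}q1 : q = 1%E.
  by case: pq => _ _; rewrite invey add0e => /eqP; rewrite inve_eq1 => /eqP.
rewrite q1 in Tq; have [s [f [g [[fon gon s0 Ts] st]]]] := schatten_schmidt Tq.
have [|z zP] := @trace_schmidt_right C S s (adjoint U \o f) (adjoint U \o g) MC st _ CM.
  split=> //; [exact: Von|exact: Von|] => x.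
  have VM : bnd (mklin (isadj_linear UV')) 1.
    by split=> // y; rewrite /= Vn mul1r.
  apply: eq_cvs (cvs_bnd VM (Ts (U x))) => n.
  rewrite linear_sum; apply: eq_bigr => k _; rewrite linearZ /=; congr (_ * _ *: _).
  exact: UV'.
by exists z => f' /zP.
Qed.

Lemma trace_cvs p q (C T U : {linear H -> H}) e : onb e -> conj_exp p q ->
  schatten p C -> schatten q T -> unitary_op U ->
  cvc (fun n => \sum_(k < n) ip (e k) (C (adjoint U (T (U (e k))))))
    (trace (C \o adjoint U \o T \o U)).
Proof.
move=> eb pq Cp Tq Uu; have [z zP] := trace_exists eb pq Cp Tq Uu.
by rewrite (@trace_onb _ z e) //; exact: zP.
Qed.

End Trace.

(** * Convexity of finite weighted ranges *)

Section Majorization.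
Context {R : realType} {n : nat}.
Implicit Types (a b c t w : 'I_n -> R).

Lemma sort_perm c : exists s : {perm 'I_n}, forall i j : 'I_n, (i <= j)%N -> c (s j) <= c (s i).
Proof.
pose r := fun i j : 'I_n => c j <= c i; pose e := sort r (enum 'I_n).
have se : size e = n by rewrite size_sort size_enum_ord.
have ue : uniq e by rewrite sort_uniq enum_uniq.
have f_inj : injective (fun i : 'I_n => nth i e i).
  move=> i j; rewrite (set_nth_default i j) ?se // => /eqP.
  by rewrite nth_uniq ?se // => /eqP/val_inj.
exists (perm f_inj) => i j ij; rewrite !permE (set_nth_default i j) ?se //.
apply: (sorted_leq_nth (leT := r)) => //.
- by move=> x y z yx xz; exact: le_trans xz yx.
- by move=> x; exact: lexx.
- by apply: sort_sorted => x y; exact: le_total.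
- by rewrite inE se.
- by rewrite inE se.
Qed.

(** Compare every [t i] with [x], the smallest of the [m] largest entries: replacing [w] by the
    indicator of the first [m] indices moves weight from values below [x] to values above it. *)
Lemma weighted_sum_le t w (m : nat) : (m <= n)%N ->
  (forall i j : 'I_n, (i <= j)%N -> t j <= t i) ->
  (forall i, 0 <= w i) -> (forall i, w i <= 1) -> \sum_i w i = m%:R ->
  \sum_i t i * w i <= \sum_(i < n | (i < m)%N) t i.
Proof.
move=> mn tni w0 w1 wm; case: m => [|m] in mn wm *.
  have w00 i : w i = 0.
    by have := psumr_eq0P (P := predT) (fun i _ => w0 i) wm; apply.
  by rewrite [leRHS]big_pred0 // big1 // => i _; rewrite w00 mulr0.
pose x := t (Ordinal mn).
have card_m : \sum_(i : 'I_n | (i < m.+1)%N) (1 : R) = m.+1%:R.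
  by rewrite -(big_ord_widen n (fun=> 1) mn) sumr_const card_ord.
rewrite -subr_ge0 (bigID (fun i : 'I_n => (i < m.+1)%N) predT) /= opprD addrA -sumrB.
have h1 : \sum_(i : 'I_n | (i < m.+1)%N) x * (1 - w i) <=
    \sum_(i : 'I_n | (i < m.+1)%N) (t i - t i * w i).
  apply: ler_sum => i im; rewrite (_ : t i - _ = t i * (1 - w i)); last by ring.
  rewrite ler_wpM2r ?subr_ge0 //.
  by apply: tni; rewrite -ltnS.
have h2 : \sum_(i : 'I_n | ~~ (i < m.+1)%N) t i * w i <=
    \sum_(i : 'I_n | ~~ (i < m.+1)%N) x * w i.
  by apply: ler_sum => i; rewrite -ltnNge => im; rewrite ler_wpM2r // tni //= ltnW.
move: wm; rewrite (bigID (fun i : 'I_n => (i < m.+1)%N) predT) /= => wm.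
rewrite -!mulr_sumr sumrB card_m -wm in h1; rewrite -mulr_sumr in h2.
by move: h1 h2; set s1 := \sum_(i | _) (t i - _); lra.
Qed.

(* Hardy, Littlewood and Polya, as an induction principle: [a] is obtained from
   [b] by reversing transfers from a larger to a smaller entry. *)
Lemma majorization_ind (P : ('I_n -> R) -> Prop) b : P b ->
  (forall a j k (d : R), j != k -> 0 <= d -> d <= a j - a k ->
     P (fun i => a i - d * (i == j)%:R + d * (i == k)%:R) -> P a) ->
  (forall i j : 'I_n, (i <= j)%N -> b j <= b i) ->
  forall a, (forall m, (m <= n)%N ->
      \sum_(i < n | (i < m)%N) b i <= \sum_(i < n | (i < m)%N) a i) ->
    \sum_i b i = \sum_i a i -> P a.
Proof.
(* The induction is on the number of indices at which [a] and [b] differ. *)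
move=> Pb Pstep bni a; have [N] := ubnP #|[pred i | a i != b i]|.
elim: N a => // N IH a /ltnSE aN ab abn.
have sumT (f : 'I_n -> R) : \sum_(i < n | (i < n)%N) f i = \sum_i f i.
  by apply: eq_bigl => i; rewrite ltn_ord.
have [/forallP eqab|/forallPn[i0 i0ab]] := boolP [forall i, a i == b i].
  by rewrite (_ : a = b) //; apply/funext => i; apply/eqP.
have [k0 k0P] : exists k, a k < b k.
  apply: contrapT => nk; have ge i : b i <= a i.
    by rewrite leNgt; apply/negP => ai; apply: nk; exists i.
  have : \sum_i (a i - b i) == 0 by rewrite sumrB abn subrr.
  rewrite psumr_eq0 => [/allP/(_ i0 (mem_index_enum _))|i _]; last by rewrite subr_ge0.
  by rewrite subr_eq0 (negbTE i0ab).
(* [k] is the first deficient index; the partial sums through [k] force a surplus at some earlier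
   [j]. *)
pose k := [arg min_(i < k0 | a i < b i) (i : nat)].
have [kP kmin] : a k < b k /\ forall i : 'I_n, (i < k)%N -> b i <= a i.
  rewrite /k; case: arg_minnP => // k' k'P k'min; split=> // i ik.
  by rewrite leNgt; apply/negP => /k'min; rewrite leqNgt ik.
have [j [jk jP]] : exists j : 'I_n, (j < k)%N /\ b j < a j.
  apply: contrapT => nj; have eqk (i : 'I_n) : (i < k)%N -> a i = b i.
    move=> ik; apply/eqP; rewrite eq_le kmin // andbT leNgt.
    by apply/negP => bi; apply: nj; exists i.
  have := ab k.+1 (ltn_ord k).
  rewrite !(bigD1 k (ltnSn k)) /=.
  have -> : \sum_(i < n | (i < k.+1)%N && (i != k)) a i =
      \sum_(i < n | (i < k.+1)%N && (i != k)) b i.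
    apply: eq_bigr => i /andP[ik nik]; apply: eqk.
    by rewrite ltn_neqAle -ltnS ik andbT; exact: nik.
  by rewrite lerD2r leNgt kP.
have njk : j != k by apply: contraTneq jk => ->; rewrite ltnn.
(* The smaller of the two gaps: one of the entries [j], [k] then agrees with [b], so the number of
   differences drops. That [b] decreases gives [d <= a j - a k]. *)
pose d := Num.min (a j - b j) (b k - a k).
have d0 : 0 < d by rewrite lt_min !subr_gt0 jP.
have dj : d <= a j - b j by rewrite ge_min lexx.
have dk : d <= b k - a k by rewrite ge_min lexx orbT.
have bjk : b k <= b j by apply: bni; exact: ltnW.
apply: (Pstep a j k d njk (ltW d0)); first by lra.
set a' := fun i => _.
have a'E i : i != j -> i != k -> a' i = a i.
  by rewrite /a' => /negbTE-> /negbTE->; rewrite !mulr0 subr0 addr0.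
have a'j : a' j = a j - d by rewrite /a' eqxx (negbTE njk) mulr1 mulr0 addr0.
have a'k : a' k = a k + d by rewrite /a' eqxx eq_sym (negbTE njk) mulr1 mulr0 subr0.
have sum1 (m : nat) (l : 'I_n) : \sum_(i < n | (i < m)%N) (i == l)%:R = (l < m)%N%:R :> R.
  have [lm|lm] := boolP (l < m)%N.
    rewrite (bigD1 l) //= eqxx big1 ?addr0 // => i /andP[_ /negbTE ->] //.
  by rewrite big1 // => i im; case: eqP => // il; rewrite -il im in lm.
have sum' (m : nat) : \sum_(i < n | (i < m)%N) a' i =
    \sum_(i < n | (i < m)%N) a i - d * (j < m)%N%:R + d * (k < m)%N%:R.
  by rewrite big_split sumrB -!mulr_sumr !sum1.
apply: IH.
- apply: leq_trans aN; apply: proper_card; apply/properP; split.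
    apply/fintype.subsetP => i; rewrite !inE.
    have [-> _|ij] := eqVneq i j; first by rewrite gt_eqF.
    have [-> _|ik] := eqVneq i k; first by rewrite lt_eqF.
    by rewrite a'E.
  have [dE|dE] := leP (a j - b j) (b k - a k).
    exists j; rewrite inE; first by rewrite gt_eqF.
    by rewrite negbK a'j /d (min_idPl dE) subKr.
  exists k; rewrite inE; first by rewrite lt_eqF.
  by rewrite negbK a'k /d (min_idPr (ltW dE)) addrC subrK.
(* Partial sums change only for [j < m <= k]; there every entry of [a] before [m] dominates that of
   [b], and [dj] covers the loss at [j]. *)
- move=> m mn; rewrite sum'.
  have [jm|mj] := ltnP j m; last first.
    have mk : (k < m)%N = false by apply/negbTE; rewrite -leqNgt; exact: leq_trans mj (ltnW jk).
    by rewrite mk !mulr0 subr0 addr0 ab.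
  have [km|mk] := ltnP k m; first by rewrite !mulr1 subrK ab.
  rewrite mulr1 mulr0 addr0 (bigD1 j) //= [X in _ <= X - _](bigD1 j) //=.
  have : \sum_(i < n | (i < m)%N && (i != j)) b i <= \sum_(i < n | (i < m)%N && (i != j)) a i.
    by apply: ler_sum => i /andP[im _]; apply: kmin; exact: leq_trans im mk.
  by move: dj; lra.
- by rewrite abn -!sumT sum' !ltn_ord !mulr1 subrK.
Qed.

End Majorization.

(** * The Toeplitz-Hausdorff theorem in two dimensions *)

Section ToeplitzHausdorff.
Context {R : realType} {H : hilbertType R} (C : {linear H -> H}).
Local Notation K := R[i].
Implicit Types (x y z : H).

Definition qf x := ip x (C x).

(** With [s = t * c] the two equations become [a t^2 - k t - (1 - a) = 0], whose discriminant [D] is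
    nonnegative; for [a = 0] the solution is explicit. *)
Lemma unit_circle_quadratic (k a : R) : 0 <= a <= 1 ->
  exists c s : R, c ^+ 2 + s ^+ 2 = 1 /\ c ^+ 2 + c * s * k = a.
Proof.
move=> /andP[a0 a1]; have [->|an0] := eqVneq a 0.
  by exists 0, 1; rewrite !expr2 !mul0r mulr1 !add0r.
pose D := k ^+ 2 + 4 * a * (1 - a).
have D0 : 0 <= D by rewrite addr_ge0 ?sqr_ge0 // mulr_ge0 ?subr_ge0 // mulr_ge0.
pose t := (k + Num.sqrt D) / (2 * a).
have tE : a * t ^+ 2 - k * t - (1 - a) = 0.
  have h := sqr_sqrtr D0; rewrite /t; set r := Num.sqrt D in h *.
  have -> : a * ((k + r) / (2 * a)) ^+ 2 - k * ((k + r) / (2 * a)) - (1 - a) =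
      (r ^+ 2 - D) / (4 * a) by rewrite /D; field.
  by rewrite h subrr mul0r.
have n0 : 0 < 1 + t ^+ 2 by rewrite ltr_pwDl ?sqr_ge0.
pose c := (Num.sqrt (1 + t ^+ 2))^-1.
have c2 : c ^+ 2 = (1 + t ^+ 2)^-1 by rewrite exprVn sqr_sqrtr // ltW.
exists c, (t * c); split.
  by rewrite exprMn c2; field; rewrite gt_eqF.
have -> : c ^+ 2 + c * (t * c) * k = c ^+ 2 * (1 + k * t) by ring.
rewrite c2; have -> : 1 + k * t = a * (1 + t ^+ 2) by move: tE; lra.
by rewrite mulrCA mulVf ?mulr1 // gt_eqF.
Qed.

(** Up to sign, a number and its conjugate have the same imaginary part, so it suffices that [w * m]
    is real for [m = b - d^*]; the conjugate phase of [m] achieves this. *)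
Lemma phase_real (b d : K) : exists w : K, (w^* )%R * w = 1 /\
  exists k : R, w * b + (w^* )%R * d = k%:C.
Proof.
pose m := b - (d^* )%R.
have sym w : ((w * m)^* )%R = w * m -> ((w * b + (w^* )%R * d)^* )%R = w * b + (w^* )%R * d.
  rewrite /m mulrBr rmorphB rmorphD !rmorphM /= !conjCK => h.
  apply/eqP; rewrite -subr_eq0; apply/eqP; move/eqP: h; rewrite -subr_eq0 => /eqP h.
  by rewrite -[RHS]h; ring.
have real (z : K) : (z^* )%R = z -> exists k : R, z = k%:C.
  move=> h; exists (complex.Re z); rewrite -{1}h.
  move/eqP: h; rewrite -[(z^* )%R]/(z^*%C); case: z => p q.
  rewrite eq_complex /= => /andP[_ /eqP h]; apply/eqP; rewrite eq_complex /= eqxx /=.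
  by rewrite h; apply/eqP; move: h; lra.
have [m0|m0] := eqVneq m 0.
  exists 1; split; first by rewrite conjC1 mulr1.
  by apply: real; apply: sym; rewrite m0 mulr0 conjC0.
have c0 : cm m != 0 by rewrite cm_eq0.
exists ((m^* )%R / (cm m)%:C); split.
  rewrite rmorphM fmorphV /= conjCK realcE mulrCA !mulrA -cm2 -mulrA -invfM -rmorphM /=.
  by rewrite -expr2 divff // -[0%R]/(0%:C) (inj_eq (@complexI R)) expf_eq0.
apply: real; apply: sym.
have -> : (m^* )%R / (cm m)%:C * m = (cm m)%:C.
  rewrite mulrAC -cm2 expr2 rmorphM /= mulfK //.
  by rewrite -[0%R]/(0%:C) (inj_eq (@complexI R)).
by rewrite realcE.
Qed.

(** Dividing by [D = qf x - qf y] normalises the two values to differ by 1. After the phase [w] has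
    made the cross terms real, the rotated vector has value [qf y + D (c^2 + c s k)]. The second
    vector completes the rotation, so the sum of the two values is kept. *)
Lemma toeplitz_hausdorff x y (a : R) : ip x x = 1 -> ip y y = 1 -> ip x y = 0 ->
  0 <= a <= 1 -> exists x' y', [/\ ip x' x' = 1, ip y' y' = 1, ip x' y' = 0,
    (forall z, ip z x = 0 -> ip z y = 0 -> ip z x' = 0 /\ ip z y' = 0) &
    qf x' = a%:C * qf x + (1 - a)%:C * qf y /\ qf x' + qf y' = qf x + qf y].
Proof.
move=> xx yy xy a01; have yx : ip y x = 0 by rewrite ipC xy conjC0.
have [eqq|nqq] := eqVneq (qf x) (qf y).
  exists x, y; split=> //; split=> //.
  by rewrite eqq -mulrDl -rmorphD /= addrC subrK mul1r.
pose D := qf x - qf y; have D0 : D != 0 by rewrite subr_eq0.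
have [w [w1 [k wk]]] := phase_real (ip x (C y) / D) (ip y (C x) / D).
have [c [s [cs ck]]] := unit_circle_quadratic k a01.
have wk' : w * ip x (C y) + (w^* )%R * ip y (C x) = k%:C * D.
  by rewrite -wk; field.
have cs' : c%:C * c%:C + s%:C * s%:C = 1 :> K by rewrite -!rmorphM -rmorphD /= -!expr2 cs.
exists (c%:C *: x + (s%:C * w) *: y), (- (s%:C * (w^* )%R) *: x + c%:C *: y).
split.
- rewrite !(ipDr, ipDl, ipZr, ipZl, xx, yy, xy, yx) !rmorphM /= !realcE !mulr0 !mulr1 addr0 add0r -[RHS]cs'; congr (_ + _).
  by rewrite -[RHS]mulr1 -w1; ring.
- rewrite !(ipDr, ipDl, ipZr, ipZl, xx, yy, xy, yx) !(rmorphM, rmorphN) /= !realcE conjCK !mulr0 !mulr1 addr0 add0r -[RHS]cs' addrC; congr (_ + _).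
  by rewrite -[RHS]mulr1 -w1; ring.
- by rewrite !(ipDr, ipDl, ipZr, ipZl, xx, yy, xy, yx) !(rmorphM, rmorphN) /= !realcE !mulr0 !mulr1; ring.
- by move=> z zx zy; rewrite !(ipDr, ipZr) zx zy !mulr0 addr0.
- have qE : qf (c%:C *: x + (s%:C * w) *: y) = c%:C * c%:C * qf x +
     s%:C * s%:C * ((w^* )%R * w) * qf y + c%:C * s%:C * (w * ip x (C y) + (w^* )%R * ip y (C x)).
    by rewrite /qf linearD !linearZ /= !(ipDr, ipDl, ipZr, ipZl, xx, yy, xy, yx) !rmorphM /= !realcE; ring.
  rewrite qE w1 wk' mulr1 /D; split.
    have -> : s%:C * s%:C = 1 - c%:C * c%:C :> K by rewrite -cs' addrC addKr.
    have -> : a%:C = c%:C * c%:C + c%:C * s%:C * k%:C by rewrite -ck rmorphD !rmorphM.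
    by rewrite rmorphB /= -ck rmorphD !rmorphM /=; ring.
  have -> : qf (- (s%:C * (w^* )%R) *: x + c%:C *: y) = c%:C * c%:C * qf y +
     s%:C * s%:C * ((w^* )%R * w) * qf x - c%:C * s%:C * (w * ip x (C y) + (w^* )%R * ip y (C x)).
    have CZ b z : C (b *: z) = b *: C z by rewrite linearZ.
    rewrite /qf linearD !CZ; set b := - (s%:C * _).
    have bE : (b^* )%R = - (s%:C * w) by rewrite /b rmorphN rmorphM /= realcE conjCK.
    by rewrite !(ipDr, ipDl, ipZr, ipZl) bE realcE /b; ring.
  rewrite w1 wk' /D; transitivity ((c%:C * c%:C + s%:C * s%:C) * (qf x + qf y)); last by rewrite cs' mul1r.
  ring.
Qed.

Definition onfam n (x : 'I_n -> H) := forall i j, ip (x i) (x j) = (i == j)%:R.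

Lemma transfer n (x : 'I_n -> H) (a : 'I_n -> R) j k (d : R) : j != k -> 0 <= d ->
  d <= a j - a k -> onfam x -> exists y : 'I_n -> H, onfam y /\
    \sum_i (a i - d * (i == j)%:R + d * (i == k)%:R)%:C * qf (x i) =
    \sum_i (a i)%:C * qf (y i).
Proof.
move=> jk d0 da xon.
have sumE : \sum_i (a i - d * (i == j)%:R + d * (i == k)%:R)%:C * qf (x i) =
    \sum_i (a i)%:C * qf (x i) - d%:C * qf (x j) + d%:C * qf (x k).
  have delta l (F : 'I_n -> K) : \sum_i (i == l)%:R%:C * F i = F l.
    rewrite (bigD1 l) //= eqxx mul1r big1 ?addr0 // => i /negbTE ->.
    by rewrite rmorph0 mul0r.
  rewrite -[qf (x j)](delta j (fun i => qf (x i))) -[qf (x k)](delta k (fun i => qf (x i))).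
  rewrite !mulr_sumr -sumrB -big_split; apply: eq_bigr => i _ /=.
  by rewrite rmorphD rmorphB !rmorphM /=; ring.
have [d00|dn0] := eqVneq d 0.
  by exists x; split=> //; rewrite sumE d00 rmorph0 !mul0r subr0 addr0.
have dp : 0 < d by rewrite lt_neqAle eq_sym dn0.
have D0 : 0 < a j - a k by exact: lt_le_trans da.
have xj : ip (x j) (x j) = 1 by rewrite xon eqxx.
have xk : ip (x k) (x k) = 1 by rewrite xon eqxx.
have xjk : ip (x j) (x k) = 0 by rewrite xon (negbTE jk).
(* With [t = d / (a j - a k)], the value at [y1] is [(1 - t) qf (x j) + t qf (x k)]. Since [y1] and
   [y2] keep the sum, weighting them by [a j] and [a k] yields the transferred weights on [x j] and
   [x k]. *)
have [|y1 [y2 [y11 y22 y12 yz [q1 q2]]]] :=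
    @toeplitz_hausdorff (x j) (x k) (1 - d / (a j - a k)) xj xk xjk.
  by rewrite subr_ge0 ler_pdivrMr // mul1r da gerBl divr_ge0 // ltW.
have kj : k != j by rewrite eq_sym.
pose y i := if i == j then y1 else if i == k then y2 else x i.
have yx i : i != j -> i != k -> ip (x i) y1 = 0 /\ ip (x i) y2 = 0.
  by move=> /negbTE ij /negbTE ik; apply: yz; rewrite xon ?ij ?ik.
have yj : y j = y1 by rewrite /y eqxx.
have yk : y k = y2 by rewrite /y eqxx (negbTE kj).
have yo i : i != j -> i != k -> y i = x i by rewrite /y => /negbTE-> /negbTE->.
exists y; split.
  move=> i l; case: (eqVneq i j) => [ij|ij]; case: (eqVneq l j) => [lj|lj].
  - by rewrite ij lj yj eqxx.
  - rewrite ij yj eq_sym (negbTE lj); case: (eqVneq l k) => [->|lk]; first by rewrite yk.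
    by have [h _] := yx l lj lk; rewrite yo // ipC h conjC0.
  - rewrite lj yj (negbTE ij); case: (eqVneq i k) => [->|ik]; first by rewrite yk ipC y12 conjC0.
    by have [h _] := yx i ij ik; rewrite yo.
  - case: (eqVneq i k) => [ik|ik]; case: (eqVneq l k) => [lk|lk].
    + by rewrite ik lk yk eqxx.
    + by have [_ h] := yx l lj lk; rewrite ik yk (yo l) // ipC h conjC0 eq_sym (negbTE lk).
    + by have [_ h] := yx i ij ik; rewrite lk yk (yo i) // h (negbTE ik).
    + by rewrite !yo.
rewrite sumE (bigD1 j) //= (bigD1 k) //= [RHS](bigD1 j) //= [X in _ = _ + X](bigD1 k) //=.
rewrite [in RHS](eq_bigr (fun i => (a i)%:C * qf (x i))); last first.
  by move=> i /andP[ij ik]; rewrite yo.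
rewrite yj yk.
have -> : qf y2 = qf (x j) + qf (x k) - qf y1 by rewrite -q2 addrC addKr.
rewrite q1; set X := qf (x j); set Y := qf (x k); set Z := \sum_(i | _) _.
have -> : d%:C = (a j - a k)%:C * (d / (a j - a k))%:C.
  by rewrite -rmorphM /= mulrC divfK // gt_eqF.
set t := d / _; rewrite !rmorphB /= !rmorph1; ring.
Qed.

End ToeplitzHausdorff.

(** * Convexity of the range with finitely many real weights *)

Section FiniteConvexity.
Context {R : realType} {H : hilbertType R} (C : {linear H -> H}).
Local Notation K := R[i].
Local Notation q := (qf C).
Implicit Types (x y z : H).

(** For orthonormal [b] this is membership in the span, with no coefficients to be chosen. *)
Definition spanned n (b : 'I_n -> H) x := x = \sum_k ip (b k) x *: b k.

Lemma spanned_mem n (b : 'I_n -> H) i : onfam b -> spanned b (b i).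
Proof.
move=> bon; rewrite /spanned (bigD1 i) //= bon eqxx scale1r big1 ?addr0 // => k ki.
by rewrite bon (negbTE ki) scale0r.
Qed.

Lemma spanned_subsp n (b : 'I_n -> H) : subsp [set x | spanned b x].
Proof.
split=> [|a x y xb yb]; rewrite /spanned /=.
  by rewrite big1 // => k _; rewrite ip0r scale0r.
rewrite {1}xb {1}yb scaler_sumr -big_split; apply: eq_bigr => k _ /=.
by rewrite ipDr ipZr scalerDl scalerA.
Qed.

Lemma subsp_sum (E : set H) I (r : seq I) (P : pred I) (F : I -> H) : subsp E ->
  (forall i, P i -> E (F i)) -> E (\sum_(i <- r | P i) F i).
Proof.
move=> [E0 EL] EF; elim/big_ind: _ => // x y Ex Ey.
by have := EL 1 x y Ex Ey; rewrite scale1r.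
Qed.

Lemma spanned_sum n (b : 'I_n -> H) I (r : seq I) (P : pred I) (a : I -> K) (F : I -> H) :
  (forall i, P i -> spanned b (F i)) -> spanned b (\sum_(i <- r | P i) a i *: F i).
Proof.
have E := spanned_subsp b => bF.
apply: (subsp_sum (E := [set x | spanned b x])) => // i Pi.
by apply: (subspZ _ E); exact: bF.
Qed.

Lemma spanned_nm n (b : 'I_n -> H) x : spanned b x ->
  nm x ^+ 2 = \sum_k cm (ip (b k) x) ^+ 2.
Proof.
move=> xb; apply: (@complexI R); rewrite -ip_nm realc_sum {2}xb ip_sumr.
by apply: eq_bigr => k _; rewrite ipZr cm2 -ipC mulrC.
Qed.

(** The form of [onfam] for initial segments of sequences, in which a family can be lengthened
    without casts. *)
Definition onn n (x : nat -> H) :=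
  forall i j, (i < n)%N -> (j < n)%N -> ip (x i) (x j) = (i == j)%:R.

Definition fam n (x : nat -> H) : 'I_n -> H := fun i => x i.

Lemma onn_fam n (x : nat -> H) : onn n x -> onfam (@fam n x).
Proof. by move=> xon i j; rewrite /fam xon. Qed.

(** The last clause keeps the new vectors inside every subspace containing the data. It is what
    later shows that two extended families span the same space. *)
Lemma gram_schmidt n (b : nat -> H) x : onn n b -> exists n' b',
  [/\ (n <= n')%N, onn n' b', forall i, (i < n)%N -> b' i = b i,
      spanned (@fam n' b') x &
      forall E, subsp E -> (forall i, (i < n)%N -> E (b i)) -> E x ->
        forall i, (i < n')%N -> E (b' i)].
Proof.
move=> bon; pose r := x - \sum_(k < n) ip (b k) x *: b k.
have [r0|r0] := eqVneq r 0.
  exists n, b; split=> //.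
  by apply/eqP; rewrite -subr_eq0; apply/eqP.
have br i : (i < n)%N -> ip (b i) r = 0.
  move=> ni; have := spanned_mem (Ordinal ni) (onn_fam bon).
  rewrite /r ipBr ip_sumr (bigD1 (Ordinal ni)) //= ipZr bon // eqxx mulr1 big1 ?addr0 ?subrr //.
  move=> k /eqP ki; rewrite ipZr bon // (_ : (i == k) = false) ?mulr0 //.
  by apply/eqP => ik; apply: ki; apply: val_inj.
have nr : nm r != 0 by rewrite nm_eq0.
pose b' i := if (i < n)%N then b i else (nm r)^-1%:C *: r.
have b'n i : (i < n)%N -> b' i = b i by rewrite /b' => ->.
have b'r : b' n = (nm r)^-1%:C *: r by rewrite /b' ltnn.
have b'on : onn n.+1 b'.
  have lt i : (i < n.+1)%N -> i = n \/ (i < n)%N.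
    by rewrite ltnS leq_eqVlt => /orP[/eqP|]; [left|right].
  move=> i j /lt[->|ni] /lt[->|nj].
  - rewrite eqxx b'r ipZl ipZr realcE ip_nm mulrA -!rmorphM /= -expr2 exprVn mulVf //.
    by rewrite expf_eq0.
  - by rewrite b'r (b'n j nj) ipZl ipC br // conjC0 mulr0 gtn_eqF.
  - by rewrite b'r (b'n i ni) ipZr br // mulr0 ltn_eqF.
  - by rewrite !b'n // bon.
exists n.+1, b'; split=> //.
- have E := spanned_subsp (@fam n.+1 b').
  have mem i : (i < n.+1)%N -> spanned (@fam n.+1 b') (b' i).
    by move=> ni; exact: spanned_mem (Ordinal ni) (onn_fam b'on).
  have -> : x = (nm r)%:C *: b' n + \sum_(k < n) ip (b k) x *: b k.
    rewrite b'r scalerA -rmorphM /= divff // scale1r.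
    by rewrite /r subrK.
  apply: (proj2 E); first exact: mem.
  apply: spanned_sum => k _.
  by rewrite -b'n //; apply: mem; rewrite ltnS ltnW.
- move=> E sE Eb Ex i; rewrite ltnS leq_eqVlt => /orP[/eqP->|ni]; last by rewrite b'n //; exact: Eb.
  rewrite b'r; apply: (subspZ _ sE); rewrite /r addrC -scaleN1r; apply: (proj2 sE) => //.
  by apply: (@subsp_sum E _ _ _ _ sE) => k _; apply: (subspZ _ sE); exact: Eb.
Qed.

Lemma gram_schmidt_seq N (v : nat -> H) n b : onn n b -> exists n' b',
  [/\ (n <= n')%N, onn n' b', forall i, (i < n)%N -> b' i = b i,
      forall i, (i < N)%N -> spanned (@fam n' b') (v i) &
      forall E, subsp E -> (forall i, (i < n)%N -> E (b i)) ->
        (forall i, (i < N)%N -> E (v i)) -> forall i, (i < n')%N -> E (b' i)].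
Proof.
move=> bon; elim: N => [|N [n1 [b1 [nn1 b1on b1b b1v b1E]]]].
  by exists n, b; split.
have [n2 [b2 [n12 b2on b2b b2v b2E]]] := gram_schmidt (v N) b1on.
exists n2, b2; split=> //.
- exact: leq_trans n12.
- by move=> i ni; rewrite b2b ?b1b //; exact: leq_trans nn1.
- move=> i; rewrite ltnS leq_eqVlt => /orP[/eqP-> //|iN].
  rewrite (b1v i iN); apply: spanned_sum => k _.
  rewrite /fam -b2b //; have kn : (k < n2)%N by exact: leq_trans n12.
  exact: spanned_mem (Ordinal kn) (onn_fam b2on).
- move=> E sE Eb Ev; apply: b2E => //; last exact: Ev.
  by apply: b1E => // i iN; apply: Ev; rewrite ltnS ltnW.
Qed.

(** Both [n] and [m] equal the double sum of the squared moduli of [ip (b' j) (b i)], summed in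
    either order. *)
Lemma spanned_dim n m (b : 'I_n -> H) (b' : 'I_m -> H) : onfam b -> onfam b' ->
  (forall i, spanned b' (b i)) -> (forall j, spanned b (b' j)) -> n = m.
Proof.
move=> bon b'on bb' b'b; apply/eqP; rewrite -(eqr_nat R); apply/eqP.
have one k (c : 'I_k -> H) : onfam c -> \sum_i nm (c i) ^+ 2 = k%:R.
  move=> con; rewrite -[k in RHS]card_ord -sumr_const; apply: eq_bigr => i _.
  by rewrite (nm_unit (x := c i)) ?expr1n // con eqxx.
rewrite -(one _ b bon) -(one _ b' b'on).
under eq_bigr do rewrite (spanned_nm (bb' _)).
under [RHS]eq_bigr do rewrite (spanned_nm (b'b _)).
rewrite exchange_big; apply: eq_bigr => i _; apply: eq_bigr => j _.
by rewrite cm_ipC.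
Qed.

Lemma fd_convex_core n (c : 'I_n -> R) (b b' : 'I_n -> H) (l : R) :
  onfam b -> onfam b' -> (forall i, spanned b' (b i)) -> (forall j, spanned b (b' j)) ->
  0 <= l <= 1 -> exists w : 'I_n -> H, onfam w /\
    \sum_i (c i)%:C * q (w i) =
    l%:C * (\sum_i (c i)%:C * q (b i)) + (1 - l)%:C * (\sum_i (c i)%:C * q (b' i)).
Proof.
move=> bon b'on bb' b'b /andP[l0 l1].
(* The matrix, in the basis [b], of the convex combination of the operators with eigenvalues [c] in
   the bases [b] and [b']. *)
pose A : 'M[K]_n := \matrix_(i, j) (l%:C * (\sum_k (c k)%:C * (ip (b i) (b k) * ip (b k) (b j))) +
   (1 - l)%:C * (\sum_k (c k)%:C * (ip (b i) (b' k) * ip (b' k) (b j)))).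
have Aherm : A \is hermsymmx.
  apply/is_hermitianmxP; rewrite expr0 scale1r; apply/matrixP => i j; rewrite !mxE.
  have conjM (r : R) (z : K) : ((r%:C * z)^* )%R = r%:C * (z^* )%R by rewrite rmorphM /= realcE.
  have hermc (y : 'I_n -> H) : ((\sum_k (c k)%:C * (ip (b j) (y k) * ip (y k) (b i)))^* )%R =
      \sum_k (c k)%:C * (ip (b i) (y k) * ip (y k) (b j)).
    rewrite rmorph_sum; apply: eq_bigr => k _ /=; rewrite conjM rmorphM /= -!ipC.
    by rewrite [X in _ * X]mulrC.
  by rewrite [RHS]rmorphD /= !conjM !hermc.
pose S := spectralmx A; have Su : S \is unitarymx by exact: spectral_unitarymx.
pose mu i := complex.Re (spectral_diag A 0 i).
have muE i : spectral_diag A 0 i = (mu i)%:C.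
  rewrite /mu RRe_real //; have /mxOverP := hermitian_spectral_diag_real Aherm.
  exact.
have SS i j : \sum_k S i k * (S j k)^* = (i == j)%:R.
  have /unitarymxP/matrixP/(_ i j) := Su; rewrite !mxE => <-.
  by apply: eq_bigr => k _; rewrite !mxE.
have SS' i j : \sum_k (S k i)^* * S k j = (i == j)%:R.
  have := mulVmx (unitarymx_unit Su); rewrite invmx_unitary // => /matrixP/(_ i j).
  by rewrite !mxE => <-; apply: eq_bigr => k _; rewrite !mxE.
have AE i j : A i j = \sum_k (S k i)^* * ((mu k)%:C * S k j).
  have /hermitian_normalmx/orthomx_spectralP/matrixP/(_ i j) -> := Aherm.
  rewrite invmx_unitary // -mulmxA mul_diag_mx !mxE; apply: eq_bigr => k _.
  by rewrite !mxE muE.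
pose x i := \sum_k (S i k)^* *: b k.
have bx k i : ip (b k) (x i) = (S i k)^*.
  rewrite ip_sumr (bigD1 k) //= ipZr bon eqxx mulr1 big1 ?addr0 // => j jk.
  by rewrite ipZr bon eq_sym (negbTE jk) mulr0.
have xb k i : ip (x i) (b k) = S i k by rewrite ipC bx conjCK.
have xon : onfam x.
  move=> i j; rewrite {1}/x ip_suml -SS; apply: eq_bigr => k _.
  by rewrite ipZl conjCK bx.
have xspan i : spanned b (x i) by rewrite /spanned; under eq_bigr do rewrite bx.
have bspan k : spanned x (b k).
  rewrite /spanned; under eq_bigr do rewrite xb scaler_sumr.
  rewrite exchange_big /= (bigD1 k) //=.
  under eq_bigr do rewrite scalerA.
  rewrite -scaler_suml [X in X *: _](_ : _ = 1); last first.
    by transitivity (\sum_i (S i k)^* * S i k); [apply: eq_bigr => i _; rewrite mulrC|rewrite SS' eqxx].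
  rewrite scale1r big1 ?addr0 // => j jk.
  under eq_bigr do rewrite scalerA.
  rewrite -scaler_suml [X in X *: _](_ : _ = 0) ?scale0r //.
  by transitivity (\sum_i (S i j)^* * S i k); [apply: eq_bigr => i _; rewrite mulrC|rewrite SS' (negbTE jk)].
have b'span k : spanned x (b' k).
  by rewrite (b'b k); apply: spanned_sum => j _.
have xspan' i : spanned b' (x i).
  by rewrite (xspan i); apply: spanned_sum => j _.
(* Both sides are the trace of [A] times the compression of [C], written once in the eigenbasis [x]
   and once in [b] and [b']. *)
have qx : \sum_i (mu i)%:C * q (x i) =
    l%:C * (\sum_i (c i)%:C * q (b i)) + (1 - l)%:C * (\sum_i (c i)%:C * q (b' i)).
  pose Ck i j := ip (b i) (C (b j)).
  have qE y : spanned b y -> q y = \sum_i \sum_j Ck i j * (ip (b j) y * ip y (b i)).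
    move=> yb; rewrite /qf {1 2}yb ip_suml; apply: eq_bigr => i _.
    rewrite ipZl linear_sum ip_sumr mulr_sumr; apply: eq_bigr => j _.
    by rewrite linearZ ipZr -ipC /Ck; ring.
  have sumq (d : 'I_n -> R) (y : 'I_n -> H) : (forall i, spanned b (y i)) ->
      \sum_i (d i)%:C * q (y i) = \sum_i \sum_j Ck i j *
        \sum_k (d k)%:C * (ip (b j) (y k) * ip (y k) (b i)).
    move=> yb; under eq_bigr do rewrite qE // mulr_sumr.
    rewrite exchange_big; apply: eq_bigr => i _ /=.
    under eq_bigr do rewrite mulr_sumr.
    rewrite exchange_big; apply: eq_bigr => j _ /=.
    by rewrite mulr_sumr; apply: eq_bigr => k _; ring.
  rewrite !sumq //; last by move=> i; exact: spanned_mem.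
  rewrite !mulr_sumr -big_split; apply: eq_bigr => i _ /=.
  rewrite !mulr_sumr -big_split; apply: eq_bigr => j _ /=.
  rewrite [l%:C * _]mulrCA [(1 - l)%:C * _]mulrCA -mulrDr; congr (_ * _).
  transitivity (A j i); last by rewrite mxE.
  rewrite AE; apply: eq_bigr => k _; rewrite bx xb; ring.
(* The weight of [c j] in the eigenvalue [mu i]. Rows and columns sum to 1 because [x], [b] and [b']
   are orthonormal bases of one space. *)
pose D i j := l * cm (ip (x i) (b j)) ^+ 2 + (1 - l) * cm (ip (x i) (b' j)) ^+ 2.
have D0 i j : 0 <= D i j by rewrite addr_ge0 // mulr_ge0 ?subr_ge0 // exprn_ge0 ?cm_ge0.
have Drow i : \sum_j D i j = 1.
  rewrite big_split -!mulr_sumr /=.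
  under eq_bigr do rewrite cm_ipC.
  under [X in _ + _ * X]eq_bigr do rewrite cm_ipC.
  rewrite -(spanned_nm (xspan i)) -(spanned_nm (xspan' i)).
  by rewrite (nm_unit (x := x i)) ?xon ?eqxx // expr1n !mulr1 addrC subrK.
have Dcol j : \sum_i D i j = 1.
  rewrite big_split -!mulr_sumr /= -(spanned_nm (bspan j)) -(spanned_nm (b'span j)).
  rewrite (nm_unit (x := b j)) ?bon ?eqxx // (nm_unit (x := b' j)) ?b'on ?eqxx //.
  by rewrite expr1n !mulr1 addrC subrK.
have muD i : mu i = \sum_j D i j * c j.
  apply: (@complexI R).
  have -> : (mu i)%:C = \sum_k \sum_j S i k * (A k j * (S i j)^* ).
    under eq_bigr => k _ do under eq_bigr => j _ do rewrite AE mulr_suml mulr_sumr.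
    under eq_bigr => k _ do rewrite exchange_big.
    rewrite exchange_big /= (bigD1 i) //= [X in _ + X]big1 ?addr0.
      have -> : \sum_k \sum_j S i k * ((S i k)^* * ((mu i)%:C * S i j) * (S i j)^* ) =
         (mu i)%:C * (\sum_k S i k * (S i k)^* ) * (\sum_j S i j * (S i j)^* ).
        rewrite [(mu _)%:C * _]mulr_sumr mulr_suml; apply: eq_bigr => k _; rewrite mulr_sumr.
        by apply: eq_bigr => j _; ring.
      by rewrite SS eqxx !mulr1.
    move=> m mi.
    have -> : \sum_k \sum_j S i k * ((S m k)^* * ((mu m)%:C * S m j) * (S i j)^* ) =
       (mu m)%:C * (\sum_k S i k * (S m k)^* ) * (\sum_j S m j * (S i j)^* ).
      rewrite [(mu _)%:C * _]mulr_sumr mulr_suml; apply: eq_bigr => k _; rewrite mulr_sumr.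
      by apply: eq_bigr => j _; ring.
    by rewrite [X in _ * X]SS (negbTE mi) mulr0.
  have gram (y : 'I_n -> H) : (forall j, spanned b (y j)) ->
      \sum_k \sum_j S i k * ((\sum_m (c m)%:C * (ip (b k) (y m) * ip (y m) (b j))) * (S i j)^* ) =
      \sum_m (c m * cm (ip (x i) (y m)) ^+ 2)%:C.
    move=> yb; under eq_bigr => k _ do under eq_bigr => j _ do rewrite mulr_suml mulr_sumr.
    under eq_bigr => k _ do rewrite exchange_big.
    rewrite exchange_big; apply: eq_bigr => m _ /=.
    rewrite rmorphM /= cm2 -ipC.
    have -> : ip (y m) (x i) = \sum_j (S i j)^* * ip (y m) (b j).
      by rewrite {1}/x ip_sumr; apply: eq_bigr => j _; rewrite ipZr.
    have -> : ip (x i) (y m) = \sum_k S i k * ip (b k) (y m).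
      by rewrite {1}/x ip_suml; apply: eq_bigr => k _; rewrite ipZl conjCK.
    rewrite [X in _ = _ * X]mulrC mulr_suml mulr_sumr; apply: eq_bigr => k _.
    by rewrite !mulr_sumr; apply: eq_bigr => j _; ring.
  have bspan' j : spanned b (b j) by exact: spanned_mem.
  rewrite realc_sum.
  transitivity (l%:C * (\sum_m (c m * cm (ip (x i) (b m)) ^+ 2)%:C) +
     (1 - l)%:C * (\sum_m (c m * cm (ip (x i) (b' m)) ^+ 2)%:C)).
    rewrite -!gram // !mulr_sumr -big_split; apply: eq_bigr => k _ /=.
    rewrite !mulr_sumr -big_split; apply: eq_bigr => j _ /=.
    by rewrite mxE; ring.
  rewrite !mulr_sumr -big_split; apply: eq_bigr => j _ /=.
  by rewrite /D -!rmorphM -rmorphD /=; congr (_%:C); ring.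
have permsum (t : {perm 'I_n}) (F : 'I_n -> R) : \sum_i F (t i) = \sum_i F i.
  by rewrite [RHS](reindex_inj (@perm_inj _ t)).
have [s sP] := sort_perm mu; have [r rP] := sort_perm c.
(* [mu] in decreasing order is the end of the chain of transfers, where [P] is trivial. Each
   reversed transfer changes the vectors, until the weights are those of [c]. *)
pose P a := forall y : 'I_n -> H, onfam y -> exists w : 'I_n -> H, onfam w /\
  \sum_i (mu (s i))%:C * q (y i) = \sum_i (a i)%:C * q (w i).
have : P (fun i => c (r i)).
  apply: (@majorization_ind R n P (fun i => mu (s i))) => //.
  - by move=> y yon; exists y.
  - move=> a j k d jk d0 da IH y /IH[y' [y'on ->]].
    by have [w [won wE]] := @transfer R H C n y' a j k d jk d0 da y'on; exists w.
  (* [w j] is the mass of column [j] in the rows of the [m] largest [mu]: at most 1 each, [m] in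
     total. *)
  - move=> m mn; pose w j := \sum_(i < n | (i < m)%N) D (s i) j.
    have w1 j : w j <= 1.
      rewrite -(Dcol j) (reindex_inj (@perm_inj _ s)) /= /w.
      rewrite [leRHS](bigID (fun i : 'I_n => (i < m)%N)) /= lerDl.
      exact: sumr_ge0.
    have -> : \sum_(i < n | (i < m)%N) mu (s i) = \sum_i c (r i) * w (r i).
      rewrite (permsum r (fun i => c i * w i)).
      under eq_bigr do rewrite muD.
      rewrite exchange_big; apply: eq_bigr => j _ /=.
      by rewrite /w mulr_sumr; apply: eq_bigr => i _; rewrite mulrC.
    apply: weighted_sum_le => // [i|]; first by apply: sumr_ge0.
    rewrite (permsum r w) exchange_big /=.
    under eq_bigr do rewrite Drow.
    by rewrite -(big_ord_widen n (fun=> 1) mn) sumr_const card_ord.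
  - rewrite (permsum s mu) (permsum r c).
    under eq_bigr do rewrite muD.
    rewrite exchange_big; apply: eq_bigr => j _ /=.
    by rewrite -mulr_suml Dcol mul1r.
have xson : onfam (fun i => x (s i)).
  by move=> i j; rewrite xon (inj_eq (@perm_inj _ s)).
move=> /(_ _ xson)[w [won wE]].
exists (fun i => w (r^-1%g i)); split.
  by move=> i j; rewrite won (inj_eq (@perm_inj _ _)).
rewrite -qx [RHS](reindex_inj (@perm_inj _ s)) /= wE.
by rewrite [LHS](reindex_inj (@perm_inj _ r)) /=; under eq_bigr do rewrite permK.
Qed.

(* Poon's argument: the convex combination of two operators with spectrum c has
   spectrum majorised by c, and the transfers leading back to c are realised by
   Toeplitz-Hausdorff on two-dimensional spaces. *)
Lemma fd_convex N (c : nat -> R) (u v : nat -> H) (l : R) :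
  onn N u -> onn N v -> 0 <= l <= 1 -> exists w, onn N w /\
    \sum_(i < N) (c i)%:C * q (w i) =
    l%:C * (\sum_(i < N) (c i)%:C * q (u i)) + (1 - l)%:C * (\sum_(i < N) (c i)%:C * q (v i)).
Proof.
move=> uon von l01.
(* [b] extends [u] to a basis of the span of [u] and [v]; then [b'] extends [v] to a basis of that
   same span, so the lengths agree. *)
have [n [b [Nn bon bu bv bE]]] := gram_schmidt_seq N v uon.
have [m [b' [Nm b'on b'v b'b b'E]]] := gram_schmidt_seq n b von.
have mem k (e : nat -> H) i : onn k e -> (i < k)%N -> spanned (@fam k e) (e i).
  by move=> eon ik; exact: spanned_mem (Ordinal ik) (onn_fam eon).
have b'span i : (i < m)%N -> spanned (@fam n b) (b' i).
  move: i; apply: (b'E _ (spanned_subsp (@fam n b))) => i ni /=; first exact: bv.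
  exact: mem.
have nm' : n = m.
  by apply: (spanned_dim (onn_fam bon) (onn_fam b'on)) => i; [exact: b'b|exact: b'span].
subst m.
(* The added vectors get weight zero, so the sums over [n] are still those over [N]. *)
pose c' (i : 'I_n) := if (i < N)%N then c i else 0.
have [|||w [won wE]] := @fd_convex_core n c' (@fam n b) (@fam n b') l (onn_fam bon) (onn_fam b'on).
- by move=> i; exact: b'b.
- by move=> i; exact: b'span.
- exact: l01.
have sumN (y : nat -> H) (z : 'I_n -> H) : (forall i : 'I_n, (i < N)%N -> z i = y i) ->
    \sum_(i < n) (c' i)%:C * q (z i) = \sum_(i < N) (c i)%:C * q (y i).
  move=> zy; rewrite (big_ord_widen n (fun i => (c i)%:C * q (y i)) Nn) [RHS]big_mkcond /=.
  apply: eq_bigr => i _; rewrite /c'; case: ifPn => iN; first by rewrite zy.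
  by rewrite rmorph0 mul0r.
pose w' i := if insub i is Some j then w j else 0.
have w'E (i : 'I_n) : w' i = w i by rewrite /w' valK.
exists w'; split.
  move=> i j iN jN; have i' : (i < n)%N by exact: leq_trans Nn.
  have j' : (j < n)%N by exact: leq_trans Nn.
  by rewrite (w'E (Ordinal i')) (w'E (Ordinal j')) won.
rewrite -(sumN w' w) => [|i _]; last by rewrite w'E.
by rewrite wE (sumN u) => [|i /bu //]; rewrite (sumN v) => [|i /b'v].
Qed.

End FiniteConvexity.

(** * The C-numerical range of a diagonal operator *)

Section ComplexSets.
Context {R : realType}.
Local Notation K := R[i].
Implicit Types (S : set R[i]^o).

Lemma convexP S : convex_set S <->
  forall (x y : K) (l : R), 0 <= l <= 1 -> S x -> S y -> S (l%:C * x + (1 - l)%:C * y).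
Proof.
split=> [cS x y l /andP[l0 l1] Sx Sy|cS x y k].
  have l0' : 0 <= l%:C by rewrite ler0c.
  have l1' : l%:C <= 1 by rewrite -[1]/(1%:C) lecR.
  have := cS x y (Itv01 l0' l1') (mem_set Sx) (mem_set Sy) => /set_mem.
  by congr (S _); rewrite rmorphB /= rmorph1.
rewrite !inE => Sx Sy.
have k0 : 0 <= k%:num by [].
have k1 : k%:num <= 1 by [].
have kE : k%:num = (complex.Re k%:num)%:C by rewrite RRe_real // ger0_real.
have := cS x y (complex.Re k%:num).
rewrite -ler0c -kE k0 -lecR -kE k1 => /(_ isT Sx Sy).
by congr (S _); rewrite rmorphB /= -kE.
Qed.

Lemma closureP S z : closure S z <-> forall e : R, 0 < e -> exists2 s, S s & cm (z - s) < e.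
Proof.
split=> [zS e e0|zS B /nbhs_ballP[e /= e0 eB]].
  have e0' : 0 < e%:C by rewrite -[0]/(0%:C) ltcR.
  have [s [Ss]] := zS _ (nbhsx_ballx z _ e0').
  by rewrite -ball_normE /= cmE ltcR; exists s.
have eE : e = (complex.Re e)%:C by rewrite RRe_real // gtr0_real.
have [|s Ss sz] := zS (complex.Re e); first by rewrite -ltcR -eE.
by exists s; split=> //; apply: eB; rewrite -ball_normE /= cmE eE ltcR.
Qed.

Lemma closure_convex S :
  (forall (x y : K) (l e : R), 0 <= l <= 1 -> S x -> S y -> 0 < e ->
     exists2 s, S s & cm (s - (l%:C * x + (1 - l)%:C * y)) <= e) ->
  convex_set (closure S).
Proof.
move=> aS; apply/convexP => x y l l01 /closureP xS /closureP yS; apply/closureP => e e0.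
have e4 : 0 < e / 4 by rewrite divr_gt0.
have [x' Sx' xx'] := xS _ e4; have [y' Sy' yy'] := yS _ e4.
have [s Ss sP] := aS _ _ _ _ l01 Sx' Sy' e4; exists s => //.
apply: le_lt_trans (cm_split (l%:C * x' + (1 - l)%:C * y') _ _) _.
rewrite [X in _ + X]cm_sub.
have -> : l%:C * x + (1 - l)%:C * y - (l%:C * x' + (1 - l)%:C * y') =
  l%:C * (x - x') + (1 - l)%:C * (y - y') by ring.
have := cmD (l%:C * (x - x')) ((1 - l)%:C * (y - y')).
case/andP: l01 => l0 l1; rewrite !cmM !cm_real !ger0_norm ?subr_ge0 //.
move: xx' yy' sP; have := cm_ge0 (x - x'); have := cm_ge0 (y - y').
set a := cm (x - x'); set b := cm (y - y') => *; nra.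
Qed.

End ComplexSets.

Section NumericalRange.
Context {R : realType} {H : hilbertType R}.
Local Notation K := R[i].
Local Notation cvc := (@cvs R (R[i]^o)).
Implicit Types (x y : H) (u v e f h : nat -> H) (p q : \bar R) (t : nat -> K).

Lemma diag_ip (C : {linear H -> H}) M h (c : nat -> K) k x : bnd C M -> diag C h c ->
  ip (h k) (C x) = c k * ip (h k) x.
Proof.
move=> CM [[hon hx] Ch].
apply: (cvs_unique (V := R[i]^o)) (cvs_ipr (h k) (cvs_bnd CM (hx x))) _ => d d0.
exists k.+1 => n kn; rewrite linear_sum ip_sumr (bigD1 (Ordinal kn)) //= big1 ?addr0.
  rewrite linearZ ipZr /= Ch ipZr (on_ip _ _ hon) eqxx mulr1 mulrC subrr.
  by rewrite (@nm0 _ (R[i]^o)).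
move=> i /eqP ik; rewrite linearZ ipZr /= Ch ipZr (on_ip _ _ hon).
rewrite (_ : (k == i) = false) ?mulr0 //; apply/eqP => ki; apply: ik; exact: val_inj.
Qed.

Lemma diag_coef (T : H -> H) f t k : diag T f t -> ip (f k) (T (f k)) = t k.
Proof.
by move=> [[fon _] Tf]; rewrite Tf ipZr (on_ip _ _ fon) eqxx mulr1.
Qed.

(** Otherwise infinitely many orthonormal vectors have orthogonal images of norm above [d]; two of
    these cannot both be within [d / 2] of one point. *)
Lemma diag_cvs0 (T : {linear H -> H}) f t : seqcpt T -> diag T f t ->
  forall d : R, 0 < d -> exists N, forall n, (N <= n)%N -> cm (t n) <= d.
Proof.
move=> Tc [[fon _] Tf] d d0; apply: contrapT => nN.
have big k : exists n, (k <= n)%N /\ d < cm (t n).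
  apply: contrapT => nk; apply: nN; exists k => n kn; rewrite leNgt; apply/negP => dn.
  by apply: nk; exists n.
have [phi phiP] := choice big.
have [|x xc] := Tc (f \o phi); first by move=> n /=; rewrite on_nm.
have d2 : 0 < d / 2 by rewrite divr_gt0.
have [k1 _ h1] := xc _ 0%N d2; have [k2 k12 h2] := xc _ (phi k1).+1 d2.
have [p1 t1] := phiP k1; have [p2 t2] := phiP k2.
have ne : phi k1 != phi k2.
  by apply: contraTneq (leq_trans k12 p2) => ->; rewrite ltnn.
move: h1 h2; rewrite /= !Tf => h1 h2.
have : nm (t (phi k1) *: f (phi k1) - t (phi k2) *: f (phi k2)) < d.
  apply: le_lt_trans (nm_split x _ _) _; rewrite (splitr d) ltrD //.
  by rewrite nm_sub.
have := nmB_ip (t (phi k1) *: f (phi k1)) (t (phi k2) *: f (phi k2)).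
rewrite ipZl ipZr (on_ip _ _ fon) (negbTE ne) !mulr0 subr0 !nmZ !on_nm // !mulr1.
set a := nm _; set b := cm _ in t1 *; set c := cm _ in t2 * => abc ad.
have a0 : 0 <= a by exact: nm_ge0.
nra.
Qed.

Lemma diag_tail q (T : {linear H -> H}) f t : (1 <= q)%E -> schatten q T -> diag T f t ->
  lptail q (fun k => cm (t k)).
Proof.
move=> q1 Tq Td; have [[fon _] _] := Td; have fb := on_bessel fon.
case: q q1 Tq => [r| |] // q1 Tq; last first.
  by apply: diag_cvs0 Td; apply: compact_seqcpt; case: Tq.
have [M TM] := schatten_ball q1 Tq; exists M => n.
have := TM f f fb fb n; congr (_ <= _); apply: eq_bigr => k _.
by rewrite (diag_coef k Td).
Qed.

(** The trace is taken in the basis [adjoint U \o f], where the conjugate of [T] is diagonal; every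
    orthonormal basis arises in this way. *)
Lemma range_diag_right p q (C T : {linear H -> H}) f t z : conj_exp p q ->
  schatten p C -> schatten q T -> diag T f t ->
  C_numerical_range C T z <->
  exists2 u, onb u & cvc (fun n => \sum_(k < n) t k * qf C (u k)) z.
Proof.
move=> pq Cp Tq [fb Tf].
have key (U : {linear H -> H}) : unitary_op U ->
    cvc (fun n => \sum_(k < n) t k * qf C (adjoint U (f k))) (trace (C \o adjoint U \o T \o U)).
  move=> Uu; have ub := unitary_adjoint_onb fb Uu.
  apply: eq_cvs (trace_cvs ub pq Cp Tq Uu) => n; apply: eq_bigr => k _ /=.
  have [/bounded_opP[MU UM] VU UV] := Uu; have UV' := riesz_adjoint fb UM.
  rewrite (UV (f k) : U (adjoint U (f k)) = f k) Tf.
  have VZ : adjoint U (t k *: f k) = t k *: adjoint U (f k).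
    by apply: ip_inj => y; rewrite ipZr !(isadj_sym UV') ipZr.
  by rewrite VZ linearZ ipZr.
split=> [[U Uu ->]|[u ub uz]].
  by exists (adjoint U \o f); [exact: unitary_adjoint_onb|exact: key].
have [U [Uu Ue]] := unitary_of_onb ub fb; exists U => //.
apply: cvs_unique uz _; apply: eq_cvs (key U Uu) => n; apply: eq_bigr => k _.
have [_ VU _] := Uu.
by rewrite -Ue (VU (u k) : adjoint U (U (u k)) = u k).
Qed.

Lemma range_diag_left p q (C T : {linear H -> H}) h c z : conj_exp p q ->
  schatten p C -> schatten q T -> diag C h c ->
  C_numerical_range C T z <->
  exists2 u, onb u & cvc (fun n => \sum_(k < n) c k * qf T (u k)) z.
Proof.
move=> pq Cp Tq Cd; have [hb Ch] := Cd; have [MC CM] := schatten_bnd Cp.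
have key (U : {linear H -> H}) : unitary_op U ->
    cvc (fun n => \sum_(k < n) c k * qf T (U (h k))) (trace (C \o adjoint U \o T \o U)).
  move=> Uu; apply: eq_cvs (trace_cvs hb pq Cp Tq Uu) => n; apply: eq_bigr => k _ /=.
  have [/bounded_opP[MU UM] VU UV] := Uu; have UV' := riesz_adjoint hb UM.
  by rewrite (diag_ip _ _ CM Cd) (isadj_sym UV').
split=> [[U Uu ->]|[u ub uz]].
  by exists (U \o h); [exact: unitary_onb|exact: key].
have [U [Uu Ue]] := unitary_of_onb hb ub; exists U => //.
apply: cvs_unique uz _; apply: eq_cvs (key U Uu) => n; apply: eq_bigr => k _.
by rewrite Ue.
Qed.

Lemma diag_collinear (T : {linear H -> H}) f t : seqcpt T -> diag T f t ->
  collinear_eigenvalues T -> exists (d : K) (r : nat -> R), forall k, t k = d * (r k)%:C.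
Proof.
move=> Tc Td [a [d [d0 ad]]]; have [[fon _] Tf] := Td.
have h k : exists s : R, t k = a + s%:C * d.
  apply: ad; exists (f k); last exact: Tf.
  by rewrite -nm_gt0 on_nm.
have [s sP] := choice h.
have cd : 0 < cm d by rewrite cm_gt0.
(* [t k / d] differs from [a / d] by the real number [s k], so its modulus bounds this imaginary
   part for every [k], and it tends to 0. *)
have ImE : complex.Im (a / d) = 0.
  apply/eqP; rewrite -normr_le0; apply/ler_addgt0Pl => e e0; rewrite addr0.
  have [N NP] := diag_cvs0 Tc Td (mulr_gt0 e0 cd).
  have := NP N (leqnn N); rewrite -ler_pdivrMr // -cmV -cmM.
  apply: le_trans; rewrite sP mulrDl mulfK //.
  case: (a / d) => x y; rewrite /cm normc_def /= addr0.
  by rewrite -[leLHS]sqrtr_sqr ler_sqrt ?addr_ge0 ?sqr_ge0 // lerDr sqr_ge0.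
exists d, (fun k => complex.Re (a / d) + s k) => k.
rewrite sP rmorphD /= (_ : (complex.Re (a / d))%:C = a / d).
  by rewrite mulrDr [d * (a / d)]mulrC divfK // [d * _]mulrC.
by apply/eqP; rewrite eq_complex /= ImE !eqxx.
Qed.

Lemma range_convex (Hsep : exists2 D : set H, countable D & dense D) p q
    (A : {linear H -> H}) t (d : K) (r : nat -> R) : ~ finite_dim [set: H] ->
  conj_exp p q -> schatten q A -> lptail p (fun k => cm (t k)) ->
  (forall k, t k = d * (r k)%:C) ->
  convex_set (closure
    ([set z | exists2 u, onb u & cvc (fun n => \sum_(k < n) t k * qf A (u k)) z] : set R[i]^o)).
Proof.
move=> Hinf pq Aq tt tE; have [_ q1 _] := pq.
have [M AM] := schatten_ball q1 Aq.
have tail := holder_tail pq (fun k => cm_ge0 (t k)) tt M.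
have ball u : onb u -> lpball q M (fun k => cm (qf A (u k))).
  by move=> [uon _]; apply: AM; exact: on_bessel.
have sumle u m n : \sum_(m <= k < n) cm (t k * qf A (u k)) <=
    \sum_(m <= k < n) cm (t k) * cm (qf A (u k)).
  by apply: ler_sum => k _; rewrite cmM.
apply: closure_convex => x y l e l01 [u ub ux] [v vb vy] e0.
have e4 : 0 < e / 4 by rewrite divr_gt0.
have [N NP] := tail _ e4.
have tailN w z : onb w -> cvc (fun n => \sum_(k < n) t k * qf A (w k)) z ->
    cm (z - \sum_(k < N) t k * qf A (w k)) <= e / 4.
  move=> wb wz; apply: (cvs_bound (N := N) wz) => n Nn.
  rewrite (sum_split (fun k => t k * qf A (w k)) Nn) addrAC subrr add0r.
  apply: le_trans (nm_sum _ _ _) _; apply: le_trans (sumle _ _ _) _.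
  by apply: NP (ball _ wb) _ => k; exact: cm_ge0.
have uon i j : (i < N)%N -> (j < N)%N -> ip (u i) (u j) = (i == j)%:R.
  by move=> _ _; case: ub => uon _; exact: uon.
have von i j : (i < N)%N -> (j < N)%N -> ip (v i) (v j) = (i == j)%:R.
  by move=> _ _; case: vb => von _; exact: von.
(* Only the first [N] vectors are combined, with the real weights [r]; the common factor [d] is
   restored in [wN]. Completing [w] to a basis and truncating all three series costs a tail of
   [e / 4] for each. *)
have [w [won wE]] := fd_convex A r uon von l01.
have [w' [w'b w'w]] := onb_extend Hsep Hinf won.
have [z zP] : exists z, cvc (fun n => \sum_(k < n) t k * qf A (w' k)) z.
  apply: (@scalar_complete _ _ (w' 0%N) (fun k => t k * qf A (w' k))).
    by case: w'b => w'on _; exact: on_nm.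
  move=> e' /tail[N' NP']; exists N' => m n Nm mn.
  apply: le_trans (sumle _ _ _) _; apply: le_trans (NP' _ _ (ball _ w'b) n); last first.
    by move=> k; exact: cm_ge0.
  rewrite (big_cat_nat Nm mn) /= lerDr; apply: sumr_ge0 => k _.
  by rewrite mulr_ge0 ?cm_ge0.
exists z; first by exists w'.
have rE (y' : nat -> H) : \sum_(k < N) t k * qf A (y' k) = d * \sum_(k < N) (r k)%:C * qf A (y' k).
  by rewrite mulr_sumr; apply: eq_bigr => k _; rewrite tE mulrA.
have wN : \sum_(k < N) t k * qf A (w' k) =
    l%:C * (\sum_(k < N) t k * qf A (u k)) + (1 - l)%:C * (\sum_(k < N) t k * qf A (v k)).
  rewrite !rE [l%:C * _]mulrCA [(1 - l)%:C * _]mulrCA -mulrDr -wE; congr (_ * _).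
  by apply: eq_bigr => k _; rewrite w'w.
have h1 := tailN _ _ w'b zP; have h2 := tailN _ _ ub ux; have h3 := tailN _ _ vb vy.
apply: le_trans (cm_split (\sum_(k < N) t k * qf A (w' k)) _ _) _.
rewrite [X in _ + cm (X - _)]wN.
set X := \sum_(k < N) t k * qf A (u k) in h2 *.
set Y := \sum_(k < N) t k * qf A (v k) in h3 *.
have -> : l%:C * X + (1 - l)%:C * Y - (l%:C * x + (1 - l)%:C * y) =
   - (l%:C * (x - X) + (1 - l)%:C * (y - Y)) by ring.
rewrite cmN; have := cmD (l%:C * (x - X)) ((1 - l)%:C * (y - Y)).
case/andP: l01 => l0 l1; rewrite !cmM !cm_real !ger0_norm ?subr_ge0 //.
have := cm_ge0 (x - X); have := cm_ge0 (y - Y); move: h1 h2 h3.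
set a := cm (x - X); set b := cm (y - Y); set c := cm (z - _) => *; nra.
Qed.

End NumericalRange.

Lemma kernel_row (F : fieldType) m n (A : 'M[F]_(m, n)) : (n < m)%N ->
  exists2 v : 'rV[F]_m, v != 0 & v *m A = 0.
Proof.
move=> nm; have : kermx A != 0.
  by rewrite -mxrank_eq0 mxrank_ker subn_eq0 -ltnNge (leq_ltn_trans (rank_leq_col A)).
by case/rowV0Pn => v /sub_kermxP vA v0; exists v.
Qed.

(** * Modified eigenvalue sequences *)

Section Rearrangement.
Context {K : Type}.
Implicit Types (a b : nat -> K).

Definition fiber a z := [set n | a n = z].

(** Bijections chosen fibre by fibre glue together, as the fibre of [n] is read off from [a n]. The
    set [Z] allows the fibre over 0 to be left out. *)
Lemma fiber_glue a b (Z : set K) :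
  (forall z, Z z -> (fiber a z #= fiber b z)%card) ->
  exists s : nat -> nat, set_bij [set n | Z (a n)] [set n | Z (b n)] s /\
    forall n, Z (a n) -> b (s n) = a n.
Proof.
move=> ab; have h z : exists g : nat -> nat, Z z -> set_bij (fiber a z) (fiber b z) g.
  have [Zz|nZ] := pselect (Z z); last by exists id.
  by have /card_set_bijP[g gP] := ab z Zz; exists g.
have [g gP] := choice h; pose s n := g (a n) n.
have sb n : Z (a n) -> b (s n) = a n.
  by move=> Zn; have [gf _ _] := gP _ Zn; exact: (gf n).
exists s; split=> //; split.
- by move=> n /= Zn; rewrite sb.
- move=> n m; rewrite !inE /= => Zn Zm snm.
  have anm : a n = a m by rewrite -sb // snm sb.
  by have [_ gi _] := gP _ Zn; apply: gi; rewrite ?inE //; move: snm; rewrite /s -anm.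
- move=> k /= Zk; have [_ _ gs] := gP _ Zk.
  have [n /= an gn] := gs k erefl; exists n; first by rewrite /= an.
  by rewrite /s an.
Qed.

Lemma fiber_perm a b : (forall z, (fiber a z #= fiber b z)%card) ->
  exists s : nat -> nat, bijective s /\ forall n, b (s n) = a n.
Proof.
move=> ab; have [s [sb sE]] := @fiber_glue a b setT (fun z _ => ab z).
by exists s; split=> [|n]; [rewrite -setTT_bijective|exact: sE].
Qed.

Lemma fiber_card a b (Z : set K) : (forall z, Z z -> (fiber a z #= fiber b z)%card) ->
  ([set n | Z (a n)] #= [set n | Z (b n)])%card.
Proof.
by move=> /fiber_glue[s [sb _]]; apply/card_set_bijP; exists s.
Qed.

Lemma infinite_nat_card (A B : set nat) : infinite_set A -> infinite_set B -> (A #= B)%card.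
Proof.
move=> Ai Bi; have h (D : set nat) : infinite_set D -> (D #= [set: nat])%card.
  by apply: eq_card_nat; exact: countableP.
exact: card_eq_trans (h A Ai) (card_esym (h B Bi)).
Qed.

Lemma infinite_setC (A : set nat) : finite_set A -> infinite_set (~` A).
Proof. by move=> Af; rewrite -setTD; apply: infinite_setD Af; exact: infinite_nat. Qed.

Lemma card_fiber_comp a b (f : nat -> nat) z : injective f ->
  (forall n, b (f n) = a n) -> (forall k, b k = z -> exists n, f n = k) ->
  (fiber b z #= fiber a z)%card.
Proof.
move=> fi ba fs; have -> : fiber b z = f @` fiber a z.
  apply/seteqP; split=> [k bk|_ [n an <-]]; last by rewrite /fiber /= ba.
  by have [n nk] := fs k bk; exists n; rewrite // /fiber /= -ba nk.
by apply: inj_card_eq => x y _ _; exact: fi.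
Qed.

End Rearrangement.

(** * Dimensions of coordinate subspaces *)

Section Dimension.
Context {R : realType} {H : hilbertType R}.
Local Notation K := R[i].
Implicit Types (x y : H) (S : set H).

Definition lin_indep m (e : 'I_m -> H) :=
  forall a : 'I_m -> K, \sum_(i < m) a i *: e i = 0 -> forall i, a i = 0.

Lemma indep_le m n (e : 'I_m -> H) (g : 'I_n -> H) : lin_indep e ->
  (forall i, exists a : 'I_n -> K, e i = \sum_j a j *: g j) -> (m <= n)%N.
Proof.
move=> ei eg; rewrite leqNgt; apply/negP => nm.
have [a aP] := choice eg.
have [v v0 vA] := kernel_row (\matrix_(i, j) a i j) nm.
suff : v = 0 by move/eqP: v0.
apply/rowP => i; rewrite [RHS]mxE; apply: (ei (v 0)).
under eq_bigr do rewrite aP scaler_sumr.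
rewrite exchange_big big1 //= => j _.
under eq_bigr do rewrite scalerA.
rewrite -scaler_suml; move/rowP/(_ j): vA; rewrite !mxE.
by under eq_bigr do rewrite mxE; move=> ->; rewrite scale0r.
Qed.

Lemma has_dim_uniq S m n : has_dim S m -> has_dim S n -> m = n.
Proof.
have h k l : has_dim S k -> has_dim S l -> (k <= l)%N.
  move=> [e [ei Se]] [g [_ Sg]]; apply: (@indep_le k l e g ei) => i.
  suff : S (e i) by rewrite Sg.
  rewrite Se; exists (fun j => (j == i)%:R).
  rewrite (bigD1 i) //= eqxx scale1r big1 ?addr0 // => j /negbTE ->.
  by rewrite scale0r.
by move=> Sm Sn; apply/eqP; rewrite eqn_leq !h.
Qed.

Lemma onfam_indep m (e : 'I_m -> H) : onfam e -> lin_indep e.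
Proof.
move=> eon a a0 i; have := ip0r (e i); rewrite -a0 ip_sumr (bigD1 i) //= big1 ?addr0.
  by rewrite ipZr eon eqxx mulr1.
by move=> j ji; rewrite ipZr eon eq_sym (negbTE ji) mulr0.
Qed.

Lemma has_dim_finite S m f (Q : set nat) : orthonormal_seq f -> has_dim S m ->
  (forall k, Q k -> S (f k)) -> finite_set Q.
Proof.
move=> fon [e [ei Se]] Qf; apply: contrapT => Qi.
have /card_esym/card_set_bijP[g [gQ gi _]] := eq_card_nat (countableP Q) Qi.
have : (m.+1 <= m)%N; last by rewrite ltnn.
apply: (@indep_le m.+1 m (fun i : 'I_m.+1 => f (g i)) e).
  apply: onfam_indep => i j; rewrite (on_ip _ _ fon); congr (_%:R); congr nat_of_bool.
  have gi' k l : g k = g l -> k = l by apply: gi; rewrite inE.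
  by apply/eqP/eqP => [/gi'/val_inj|->].
move=> i; have : S (f (g i)) by apply: Qf; exact: gQ.
by rewrite Se.
Qed.

(** The closed span of the [f k] with [k] in [Q]. Kernels of diagonal operators have this form,
    which turns dimensions into cardinalities of index sets. *)
Definition coord_space f (Q : set nat) : set H :=
  [set x | forall k, ~ Q k -> ip (f k) x = 0].

Lemma coord_space_dim f Q m : onb f -> (Q #= `I_m)%card -> has_dim (coord_space f Q) m.
Proof.
move=> fb; have [fon fx] := fb => /card_esym/card_set_bijP[g [gQ gi gs]].
have gon : onfam (fun i : 'I_m => f (g i)).
  move=> i j; rewrite (on_ip _ _ fon); congr (_%:R); congr nat_of_bool.
  apply/eqP/eqP => [h|-> //]; apply: val_inj; apply: gi => //; by rewrite inE /=.
exists (fun i : 'I_m => f (g i)); split; first exact: onfam_indep.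
apply/seteqP; split=> [x xQ|x [a ->] k nQ]; last first.
  rewrite ip_sumr big1 // => i _; rewrite ipZr (on_ip _ _ fon).
  rewrite (_ : (k == g i) = false) ?mulr0 //; apply/eqP => kg; apply: nQ.
  by rewrite kg; apply: gQ => /=.
exists (fun i => ip (f (g i)) x); apply: (onb_ext fb) => k.
rewrite ip_sumr; have [Qk|nQ] := pselect (Q k); last first.
  rewrite xQ // big1 // => i _; rewrite ipZr (on_ip _ _ fon).
  rewrite (_ : (k == g i) = false) ?mulr0 //; apply/eqP => kg; apply: nQ.
  by rewrite kg; apply: gQ => /=.
have [i /= im <-] := gs k Qk.
rewrite (bigD1 (Ordinal im)) //= ipZr (on_ip _ _ fon) eqxx mulr1 big1 ?addr0 // => j ji.
have := gon (Ordinal im) j; rewrite eq_sym (negbTE ji) /= ipZr => ->.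
by rewrite mulr0.
Qed.

Lemma coord_space_dimP f Q m : onb f -> has_dim (coord_space f Q) m <-> (Q #= `I_m)%card.
Proof.
move=> fb; split=> [Sm|]; last exact: coord_space_dim.
have [fon _] := fb.
have /finite_setP[n Qn] : finite_set Q.
  apply: (has_dim_finite fon Sm) => k Qk l nl; rewrite (on_ip _ _ fon).
  by case: eqP => // lk; case: nl; rewrite lk.
by rewrite (has_dim_uniq Sm (coord_space_dim fb Qn)).
Qed.

Lemma finite_dimP f Q : onb f -> finite_dim (coord_space f Q) <-> finite_set Q.
Proof.
move=> fb; split=> [[m /(coord_space_dimP _ _ fb) Qm]|/finite_setP[m Qm]].
  by apply/finite_setP; exists m.
by exists m; apply/coord_space_dimP.
Qed.

End Dimension.

(** * Eigenvalue sequences of diagonal operators *)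

Section EigenvalueSequences.
Context {R : realType} {H : hilbertType R} (T : {linear H -> H}) (M : R).
Local Notation K := R[i].
Implicit Types (x y : H) (f : nat -> H) (t lam gam : nat -> K).
Context (TM : bnd T M) (f : nat -> H) (t : nat -> K) (Td : diag T f t).

Let fb : onb f. Proof. by case: Td. Qed.

(** The power multiplies the k-th coefficient by [(t k - z) ^+ n], so all positive powers have the
    same kernel. *)
Lemma ker_pow_diag (z : K) n : (0 < n)%N -> ker_pow T z n = coord_space f (fiber t z).
Proof.
move=> n0; have it x k : ip (f k) (iter n (fun y => T y - z *: y) x) = (t k - z) ^+ n * ip (f k) x.
  elim: n {n0} => [|n IH]; first by rewrite expr0 mul1r.
  by rewrite iterS ipBr ipZr (diag_ip _ _ TM Td) IH exprS; ring.
apply/seteqP; split=> [x xn k kz|x xz] /=.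
  have := it x k; rewrite xn ip0r => /esym/eqP; rewrite mulf_eq0 expf_eq0 n0 subr_eq0 /=.
  by case/orP => /eqP.
apply: (onb_eq0 fb) => k; rewrite it; have [kz|kz] := eqVneq (t k) z.
  by rewrite kz subrr expr0n gtn_eqF // mul0r.
by rewrite xz ?mulr0 // => /eqP; rewrite (negbTE kz).
Qed.

Lemma ker_op_diag : ker_op T = coord_space f (fiber t 0).
Proof.
rewrite -(@ker_pow_diag 0 1) //; apply/seteqP; split=> x; rewrite /ker_op /ker_pow /=.
  by rewrite scale0r subr0.
by rewrite scale0r subr0.
Qed.

Lemma algebraic_multiplicity_diag (z : K) m :
  algebraic_multiplicity T z m <-> (fiber t z #= `I_m)%card.
Proof.
split=> [[n0 [n01 _ nm]]|zm].
  apply/(coord_space_dimP _ _ fb); have [n00|n00] := posnP n0; last by rewrite -(@ker_pow_diag z n0).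
  by rewrite -(@ker_pow_diag z n0.+1) // -n01.
(* The index [n0] is 0 if [z] is no eigenvalue, and 1 otherwise. *)
have [e|ne] := pselect (ker_pow T z 0 = ker_pow T z 1).
  exists 0%N; split=> //; rewrite e ker_pow_diag //; exact/coord_space_dimP.
exists 1%N; split; first by rewrite !ker_pow_diag.
  by case.
by rewrite ker_pow_diag //; exact/coord_space_dimP.
Qed.

Lemma finite_dim_range_diag : finite_dim (range T) <-> finite_set [set k | t k <> 0].
Proof.
have [fon fx] := fb; split=> [[m Tm]|tf].
  apply: (has_dim_finite fon Tm) => k /= /eqP tk; exists ((t k)^-1 *: f k) => //.
  by rewrite linearZ /= (proj2 Td) scalerA mulVf // scale1r.
suff -> : range T = coord_space f [set k | t k <> 0] by apply/finite_dimP.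
apply/seteqP; split=> [_ [x _ <-] k /= /contrapT tk|x xt].
  by rewrite (diag_ip _ _ TM Td) tk mul0r.
have /finite_setP[m /card_esym/card_set_bijP[g [gQ gi gs]]] := tf.
exists (\sum_(i < m) ((t (g i))^-1 * ip (f (g i)) x) *: f (g i)) => //.
apply: (onb_ext fb) => k; rewrite (diag_ip _ _ TM Td) ip_sumr.
have [tk|tk] := pselect (t k <> 0); last first.
  by rewrite xt // (contrapT tk) mul0r.
have [i /= im gk] := gs k tk; rewrite -gk in tk *.
rewrite (bigD1 (Ordinal im)) //= big1 ?addr0 => [|j ji].
  rewrite ipZr (on_ip _ _ fon) eqxx mulr1 mulrA divff ?mul1r //; exact/eqP.
rewrite ipZr (on_ip _ _ fon) (_ : (g i == g j) = false) ?mulr0 //.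
apply/eqP => /gi; rewrite !inE /= => /(_ im (ltn_ord j)) ij.
by move/eqP: ji; apply; apply: val_inj.
Qed.

Lemma eigenvalue_seq_fiber lam z : eigenvalue_seq T lam -> z <> 0 ->
  (fiber lam z #= fiber t z)%card.
Proof.
move=> [_ lamz] /eqP/lamz[m /algebraic_multiplicity_diag tm lm].
exact: card_eq_trans lm (card_esym tm).
Qed.

(** The rule for zeros makes the fibres over 0 agree: both are infinite if the range is
    finite-dimensional; otherwise [lam] has no zeros, and [gam] has just the inserted ones, as many
    as the dimension of the kernel. *)
Lemma modified_fiber gam z : modified_eigenvalue_seq T gam -> (fiber gam z #= fiber t z)%card.
Proof.
move=> [lam ls [gfin gd gmix]]; have lam_fiber := eigenvalue_seq_fiber ls.
have nz : ([set n | lam n <> 0] #= [set k | t k <> 0])%card.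
  by apply: (fiber_card (Z := [set z | z <> 0])) => w; exact: lam_fiber.
have [fin|ninf] := pselect (finite_dim (range T)).
  rewrite gfin //; have [->|/eqP z0] := eqVneq z 0; last exact: lam_fiber.
  have tf := proj1 finite_dim_range_diag fin.
  have lf : finite_set [set n | lam n <> 0] by rewrite (eq_finite_set nz).
  have C (a : nat -> K) : fiber a 0 = ~` [set n | a n <> 0].
    by apply/seteqP; split=> [n an /= /(_ an)//|n /= /contrapT].
  by rewrite !C; apply: infinite_nat_card; exact: infinite_setC.
have li : infinite_set [set n | lam n <> 0].
  by rewrite (eq_finite_set nz) => /(proj2 finite_dim_range_diag).
(* A zero would force all later terms to vanish, since the moduli decrease. *)
have lam0 n : lam n <> 0.
  move=> ln; apply: li; apply: (sub_finite_set (B := `I_n)); last exact: finite_II.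
  move=> k /= lk; rewrite ltnNge; apply/negP => nk; apply: lk.
  have [mono _] := ls; have := mono n k nk; rewrite ln normr0 normr_le0.
  by move/eqP.
have [[d kd]|kinf] := pselect (finite_dim (ker_op T)).
  have td : (fiber t 0 #= `I_d)%card by apply/(coord_space_dimP _ _ fb); rewrite -ker_op_diag.
  rewrite (gd ninf d kd); set g := fun n => _.
  have [->|/eqP z0] := eqVneq z 0.
    rewrite (_ : fiber g 0 = `I_d); first exact: card_esym.
    apply/seteqP; split=> n; rewrite /fiber /g /=; last by move=> ->.
    by case: ltnP => // _ /lam0.
  apply: card_eq_trans (lam_fiber z z0).
  apply: (card_fiber_comp (f := fun n => (n + d)%N)).
  - by move=> n m /addIn.
  - by move=> n; rewrite /g ltnNge leq_addl addnK.
  - move=> k; rewrite /g; case: ltnP => [_ /esym //|dk _].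
    by exists (k - d)%N; rewrite subnK.
have [phi [phi_mono phi_inf gphi g0]] := gmix ninf kinf.
have [->|/eqP z0] := eqVneq z 0.
  apply: infinite_nat_card; last first.
    by move=> tf; apply: kinf; rewrite ker_op_diag; apply/finite_dimP.
  apply: (sub_infinite_set _ phi_inf) => k /= nk; exact: g0.
apply: card_eq_trans (lam_fiber z z0).
apply: (card_fiber_comp (f := phi)) => //.
- move=> m n mn; apply/eqP; rewrite eqn_leq; apply/andP; split; rewrite leqNgt.
    by apply/negP => /phi_mono; rewrite mn ltnn.
  by apply/negP => /phi_mono; rewrite mn ltnn.
- move=> k gk; apply: contrapT => nk; apply: z0; rewrite -gk; apply: g0 => -[n _ nE].
  by apply: nk; exists n.
Qed.

Lemma modified_diag gam : modified_eigenvalue_seq T gam -> exists e, diag T e gam.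
Proof.
move=> gm; have [s [sb sE]] := fiber_perm (fun z => modified_fiber z gm).
exists (f \o s); split; first exact: onb_reindex.
by move=> k /=; rewrite (proj2 Td) sE.
Qed.

Context (t0 : forall d : R, 0 < d -> exists N, forall n, (N <= n)%N -> cm (t n) <= d).

Lemma max_outside (s : seq nat) :
  exists k, k \notin s /\ forall j, j \notin s -> cm (t j) <= cm (t k).
Proof.
have [[j0 [j0s tj0]]|h] := pselect (exists j, j \notin s /\ 0 < cm (t j)); last first.
  (* All remaining terms are zero, so any index outside [s] is maximal. *)
  exists (\max_(i <- s) i).+1%N; split=> [|j js].
    by apply/negP => ks; have := @leq_bigmax_seq _ s xpredT id _ ks isT; rewrite ltnn.
  apply: le_trans (cm_ge0 _); rewrite leNgt; apply/negP => tj; apply: h.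
  by exists j.
have [N NP] := t0 tj0; pose B := maxn N j0.+1.
have j0B : (j0 < B)%N by rewrite leq_maxr.
pose k := [arg max_(i > Ordinal j0B | (i : nat) \notin s) cm (t i)]%O.
have [ks kmax] : (k : nat) \notin s /\ forall i : 'I_B, (i : nat) \notin s -> cm (t i) <= cm (t k).
  by rewrite /k; case: arg_maxP.
exists (nat_of_ord k); split=> // j js; case: (ltnP j B) => [jB|Bj]; first exact: (kmax (Ordinal jB)).
apply: le_trans (kmax (Ordinal j0B) j0s); apply: NP.
exact: leq_trans (leq_maxl _ _) Bj.
Qed.

(** Greedy choice, [L n] listing the first [n] indices taken. A nonzero term never taken would be
    dominated by all [t (r n)], but [r] is injective, so these include arbitrarily small ones. *)
Lemma decreasing_arrangement : exists r : nat -> nat, [/\ injective r,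
  forall m n, (m <= n)%N -> cm (t (r n)) <= cm (t (r m)) &
  forall k, t k <> 0 -> exists n, r n = k].
Proof.
have [nx nxP] := choice max_outside.
pose L := fix L n := if n is m.+1 then nx (L m) :: L m else [::].
pose r n := nx (L n).
have rL n : r n \notin L n by have [] := nxP (L n).
have inL m n : (m < n)%N -> r m \in L n.
  elim: n => // n IH; rewrite ltnS leq_eqVlt /= inE => /orP[/eqP->|/IH->]; first by rewrite eqxx.
  by rewrite orbT.
have LP n k : k \in L n -> exists2 m, (m < n)%N & r m = k.
  elim: n => // n IH; rewrite /= inE => /orP[/eqP->|/IH[m mn mk]]; first by exists n.
  by exists m => //; exact: ltnW.
have ri : injective r.
  have h m n : (m < n)%N -> r m <> r n.
    by move=> /inL mn e; have := rL n; rewrite -e mn.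
  by move=> m n e; case: (ltngtP m n) => // /h; rewrite e.
exists r; split=> // [m n mn|k tk].
  have [_] := nxP (L m); apply; apply/negP => /LP[l lm /ri le].
  by move: lm; rewrite le ltnNge mn.
apply: contrapT => nk.
have ck : 0 < cm (t k) by rewrite cm_gt0; exact/eqP.
have [N NP] := t0 (divr_gt0 ck (ltr0n R 2)).
have [n Nn] : exists n, (N <= r n)%N.
  apply: contrapT => h; have rN n : (r n < N)%N by rewrite ltnNge; apply/negP => ?; apply: h; exists n.
  pose g (i : 'I_N.+1) := Ordinal (rN i).
  have gi : injective g by move=> i j [] /ri/val_inj.
  by have := leq_card g gi; rewrite !card_ord ltnn.
have : cm (t k) <= cm (t (r n)).
  by have [_] := nxP (L n); apply; apply/negP => /LP[m _ mk]; apply: nk; exists m.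
by have := NP _ Nn; lra.
Qed.

Lemma modified_exists : exists gam, modified_eigenvalue_seq T gam.
Proof.
have [r [ri rmono rs]] := decreasing_arrangement; pose lam := t \o r.
have ls : eigenvalue_seq T lam.
  split=> [m n mn|z z0]; first by rewrite !cmE lecR; exact: rmono.
  have cz : 0 < cm z by rewrite cm_gt0.
  have [m tm] : exists m, (fiber t z #= `I_m)%card.
    apply/finite_setP; have [N NP] := t0 (divr_gt0 cz (ltr0n R 2)).
    apply: (sub_finite_set (B := `I_N)); last exact: finite_II.
    move=> k tk /=; rewrite ltnNge; apply/negP => /NP; rewrite tk; lra.
  exists m; first exact/algebraic_multiplicity_diag.
  apply: card_eq_trans tm; apply: card_esym; apply: (card_fiber_comp (f := r)) => // k tk.
  by apply: rs; rewrite tk; exact/eqP.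
have [fin|ninf] := pselect (finite_dim (range T)).
  by exists lam; exists lam => //; split.
have [[d kd]|kinf] := pselect (finite_dim (ker_op T)).
  exists (fun n => if (n < d)%N then 0 else lam (n - d)%N); exists lam => //; split=> //.
    by move=> _ d' /(has_dim_uniq kd) ->.
  by move=> _ []; exists d.
exists (fun n => if odd n then 0 else lam n./2); exists lam => //; split=> // [_ d kd|_ _].
  by case: kinf; exists d.
exists double; split=> [m n|||k nk].
- by rewrite ltn_double.
- apply: (@sub_infinite_set _ (range (fun n => n.*2.+1))).
    by move=> _ [n _ <-] [m _] /(congr1 odd); rewrite /= !odd_double.
  have /eq_finite_set -> : (range (fun n => n.*2.+1) #= [set: nat])%card.
    by apply: inj_card_eq => m n _ _ [] /double_inj.
  exact: infinite_nat.
- by move=> n; rewrite odd_double doubleK.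
- case: ifPn => // ok; case: nk; exists k./2 => //.
  by rewrite -[RHS]odd_double_half (negbTE ok).
Qed.

End EigenvalueSequences.

(** * Convex hulls in the plane *)

Section Caratheodory.
Context {R : realType}.
Local Notation K := R[i].
Implicit Types (S : set R[i]^o).

Lemma Im_sum I (r : seq I) (P : pred I) (F : I -> K) :
  complex.Im (\sum_(i <- r | P i) F i) = \sum_(i <- r | P i) complex.Im (F i).
Proof. by elim/big_rec2: _ => // i y x _ <-; case: (F i); case: x. Qed.

Lemma Im_realM (r : R) (z : K) : complex.Im (r%:C * z) = r * complex.Im z.
Proof. by case: z => a b /=; rewrite mul0r addr0. Qed.

Lemma ler_Im_cm (z : K) : `|complex.Im z| <= cm z.
Proof.
have := ler_Re_cm (- 'i%C * z); rewrite cmM cmN; have -> : cm 'i%C = 1 :> R.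
  by rewrite /cm normc_def /= expr0n expr1n add0r sqrtr1.
rewrite mul1r; congr (`|_| <= _).
by case: z => a b /=; ring.
Qed.

Lemma cm_ReIm (z : K) : cm z <= `|complex.Re z| + `|complex.Im z|.
Proof.
case: z => a b /=; have -> : (a +i* b)%C = a%:C + 'i%C * b%:C.
  by apply/eqP; rewrite eq_complex /=; apply/andP; split; apply/eqP; ring.
rewrite (le_trans (cmD _ _)) // cmM !cm_real; have -> : cm 'i%C = 1 :> R.
  by rewrite /cm normc_def /= expr0n expr1n add0r sqrtr1.
by rewrite mul1r.
Qed.

Definition combo m S (z : K) := exists (w : 'I_m -> R) (x : 'I_m -> K),
  [/\ forall i, 0 <= w i, \sum_i w i = 1, forall i, S (x i) & z = \sum_i (w i)%:C * x i].

(** More than three points of the plane are affinely dependent, the three columns of [A] being 1 and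
    the two coordinates. Subtracting the dependence, scaled by the smallest ratio, makes one weight
    vanish and keeps the others nonnegative. *)
Lemma combo_drop m S z : (2 < m)%N -> combo m.+1 S z -> combo m S z.
Proof.
move=> m2 [w [x [w0 w1 Sx ->]]].
pose A : 'M[R]_(m.+1, 3) := \matrix_(i, j)
  if j == 0%N :> nat then 1 else if j == 1%N :> nat then complex.Re (x i) else complex.Im (x i).
have [v v0 vA] := kernel_row A m2.
have v1 : \sum_i v 0 i = 0.
  have := congr1 (fun B : 'rV[R]_3 => B 0 0) vA; rewrite !mxE => e0.
  by rewrite -[RHS]e0; apply: eq_bigr => i _; rewrite mxE mulr1.
have vx : \sum_i (v 0 i)%:C * x i = 0.
  have e1 := congr1 (fun B : 'rV[R]_3 => B 0 1) vA.
  have e2 := congr1 (fun B : 'rV[R]_3 => B 0 (inord 2)) vA.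
  move: e1 e2; rewrite !mxE => e1 e2.
  apply/eqP; rewrite eq_complex Re_sum Im_sum; apply/andP; split; apply/eqP.
    by rewrite -[RHS]e1; apply: eq_bigr => i _; rewrite mxE Re_realM.
  by rewrite -[RHS]e2; apply: eq_bigr => i _; rewrite mxE Im_realM inordK.
have [i1 vi1] : exists i, 0 < v 0 i.
  apply: contrapT => nv; have vn i : v 0 i <= 0.
    by rewrite leNgt; apply/negP => h; apply: nv; exists i.
  move/eqP: v0; apply; apply/rowP => i; rewrite mxE; apply/eqP.
  have : \sum_i - v 0 i == 0 by rewrite sumrN v1 oppr0.
  rewrite psumr_eq0 => [|j _]; last by rewrite oppr_ge0.
  by move/allP/(_ i (mem_index_enum _)); rewrite oppr_eq0.
pose i0 := [arg min_(i < i1 | 0 < v 0 i) (w i / v 0 i)]%O.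
have [vi0 mi0] : 0 < v 0 i0 /\ forall i, 0 < v 0 i -> w i0 / v 0 i0 <= w i / v 0 i.
  by rewrite /i0; case: arg_minP.
pose t := w i0 / v 0 i0; have t0 : 0 <= t by rewrite divr_ge0 // ltW.
pose w' i := w i - t * v 0 i.
have w'0 i : 0 <= w' i.
  rewrite /w' subr_ge0; have [vi|vi] := ltP 0 (v 0 i).
    by rewrite -ler_pdivlMr // mi0.
  by apply: le_trans (w0 i); rewrite mulr_ge0_le0.
have wi0 : w' i0 = 0 by rewrite /w' /t divfK ?subrr // gt_eqF.
exists (fun j => w' (lift i0 j)), (fun j => x (lift i0 j)); split=> //.
  transitivity (\sum_i w' i); first by rewrite [RHS](bigD1_ord i0) //= wi0 add0r.
  by rewrite sumrB w1 -mulr_sumr v1 mulr0 subr0.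
transitivity (\sum_i (w' i)%:C * x i); last first.
  by rewrite [LHS](bigD1_ord i0) //= wi0 mul0r add0r.
transitivity (\sum_i (w i)%:C * x i - t%:C * \sum_i (v 0 i)%:C * x i).
  by rewrite vx mulr0 subr0.
rewrite mulr_sumr -sumrB; apply: eq_bigr => i _.
have -> : (w' i)%:C = (w i)%:C - t%:C * (v 0 i)%:C by rewrite -rmorphM -rmorphB.
by rewrite mulrBl mulrA.
Qed.

Lemma combo_convex S : convex_set (combo 3 S : set R[i]^o).
Proof.
apply/convexP => x y l /andP[l0 l1] [w [a [w0 w1 Sa ->]]] [w' [a' [w0' w1' Sa' ->]]].
(* Two triples are six points; three reductions lead back to three. *)
do 3! [apply: combo_drop => //].
pose g T (b b' : 'I_3 -> T) (i : 'I_(3 + 3)) :=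
  match fintype.split i with inl j => b j | inr j => b' j end.
have gl T (b b' : 'I_3 -> T) j : g T b b' (lshift 3 j) = b j.
  by rewrite /g (unsplitK (inl j)).
have gr T (b b' : 'I_3 -> T) j : g T b b' (rshift 3 j) = b' j.
  by rewrite /g (unsplitK (inr j)).
exists (g _ (fun j => l * w j) (fun j => (1 - l) * w' j)), (g _ a a'); split.
- by move=> i; rewrite /g; case: fintype.split => j; rewrite mulr_ge0 ?subr_ge0.
- rewrite (@big_split_ord _ _ _ 3 3) /=.
  under eq_bigr do rewrite gl; under [X in _ + X]eq_bigr do rewrite gr.
  by rewrite -!mulr_sumr w1 w1'; ring.
- by move=> i; rewrite /g; case: fintype.split => j.
rewrite (@big_split_ord _ _ _ 3 3) /=.
under [X in _ = X + _]eq_bigr do rewrite !gl; under [X in _ = _ + X]eq_bigr do rewrite !gr.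
by rewrite !mulr_sumr; congr (_ + _); apply: eq_bigr => i _; rewrite mulrA !rmorphM.
Qed.

Lemma hull_convex S : convex_set (conv_hull S : set R[i]^o).
Proof.
apply/convexP => x y l l01 hx hy A [cA SA].
by apply: (iffLR (convexP A) cA) => //; [exact: hx|exact: hy].
Qed.

Lemma combo_hull m S z : combo m S z -> conv_hull S z.
Proof.
move=> [w [x [w0 w1 Sx ->]]] A [cA SA]; move/convexP: cA => cA.
elim: m w x w0 w1 Sx => [w x _|m IH w x w0 w1 Sx].
  by rewrite big_ord0 => /eqP; rewrite eq_sym oner_eq0.
rewrite big_ord_recl; have := w1; rewrite big_ord_recl /=; set s := \sum_(i < m) _ => ws.
have s0 : 0 <= s by apply: sumr_ge0.
have [s00|sN0] := eqVneq s 0.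
  have z0 (i : 'I_m) : w (lift ord0 i) = 0.
    move/eqP: s00; rewrite psumr_eq0 // => /allP/(_ i (mem_index_enum _)).
    by move/eqP.
  rewrite big1 => [|i _]; last by rewrite z0 mul0r.
  have -> : w ord0 = 1 by rewrite -ws s00 addr0.
  by rewrite mul1r addr0; apply: SA.
have -> : \sum_(i < m) (w (lift ord0 i))%:C * x (lift ord0 i) =
   s%:C * \sum_(i < m) (w (lift ord0 i) / s)%:C * x (lift ord0 i).
  rewrite mulr_sumr; apply: eq_bigr => i _; rewrite mulrA -rmorphM /=; congr (_%:C * _).
  by rewrite mulrCA divff // mulr1.
have -> : s = 1 - w ord0 by rewrite -ws addrC addKr.
apply: cA.
- by rewrite w0 -subr_ge0 -ws addrC addKr.
- exact: SA.
apply: IH => [i||i] //; first by rewrite divr_ge0 // -ws addrC addKr.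
by rewrite -mulr_suml -/s -ws addrC addKr divff.
Qed.

Lemma hull_combo S z : conv_hull S z -> combo 3 S z.
Proof.
apply; split; first exact: combo_convex.
move=> x Sx; exists (fun i : 'I_3 => (i == 0)%:R), (fun=> x); split=> //.
  by rewrite !big_ord_recl big_ord0 /=; ring.
by rewrite !big_ord_recl big_ord0 /= !mulr0n; rewrite rmorph1 rmorph0; ring.
Qed.

Lemma vector_cluster (I : finType) (u : nat -> I -> R) M : (forall n i, `|u n i| <= M) ->
  exists x : I -> R, forall d N, 0 < d -> exists2 n, (N <= n)%N & forall i, `|u n i - x i| < d.
Proof.
move=> uM; pose v n : 'rV[R]_#|I| := \row_i u n (enum_val i).
have cpt : compact [set y : 'rV[R]_#|I| | forall i, `[- M, M]%classic (y 0 i)].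
  by apply: (@rV_compact _ _ (fun=> `[- M, M]%classic)) => i; exact: segment_compact.
have [|y [yM yc]] := cpt (v @ \oo) _.
  by exists 0%N => // n _ i; rewrite /= mxE in_itv /= -ler_norml.
exists (fun i => y 0 (enum_rank i)) => d N d0.
have [|_ [[n Nn <-] /= yn]] := yc [set v n | n in [set n | (N <= n)%N]] (ball y d) _ (nbhsx_ballx _ _ d0).
  by exists N => // n Nn; exists n.
exists n => // i; have [_ /(_ 0 (enum_rank i))] := yn.
by rewrite mxE enum_rankK /ball /= distrC.
Qed.

(** The approximating combinations have nine bounded real parameters: three weights and three
    points. A cluster point of these represents the limit. *)
Lemma hull_closed S M : closed S -> (forall z, S z -> cm z <= M) ->
  closed (conv_hull S : set R[i]^o).
Proof.
move=> cS SM z /closureP zS; apply: (@combo_hull 3).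
have hS n : exists wx : ('I_3 -> R) * ('I_3 -> K), [/\ forall i, 0 <= wx.1 i,
    \sum_i wx.1 i = 1, forall i, S (wx.2 i) &
    cm (z - \sum_i (wx.1 i)%:C * wx.2 i) < n.+1%:R^-1].
  have [|s /hull_combo[w [x [w0 w1 Sx ->]]] zs] := zS n.+1%:R^-1; first by rewrite invr_gt0.
  by exists (w, x).
have [g gP] := choice hS; pose w n := (g n).1; pose x n := (g n).2.
have w0 n i : 0 <= w n i by have [h _ _ _] := gP n; exact: h.
have w1 n : \sum_i w n i = 1 by have [_ h _ _] := gP n; exact: h.
have Sx n i : S (x n i) by have [_ _ h _] := gP n; exact: h.
have zE n : cm (z - \sum_i (w n i)%:C * x n i) < n.+1%:R^-1 by have [_ _ _ h] := gP n; exact: h.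
have wle n i : w n i <= 1 by rewrite -(w1 n) (bigD1 i) //= lerDl sumr_ge0.
have M0 : 0 <= M by apply: le_trans (cm_ge0 _) (SM _ (Sx 0%N ord0)).
pose u n (i : 'I_3 + ('I_3 + 'I_3)) := match i with
  inl i => w n i | inr (inl i) => complex.Re (x n i) | inr (inr i) => complex.Im (x n i) end.
have uM n i : `|u n i| <= 1 + M.
  have xM j := SM _ (Sx n j).
  case: i => [i|[i|i]] /=; first by rewrite ger0_norm // (le_trans (wle n i)) // lerDl.
    by rewrite (le_trans (ler_Re_cm _)) // (le_trans (xM i)) // lerDr.
  by rewrite (le_trans (ler_Im_cm _)) // (le_trans (xM i)) // lerDr.
have [y yP] := vector_cluster uM.
pose w' i := y (inl i); pose x' i := (y (inr (inl i)) +i* y (inr (inr i)))%C.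
have near d N : 0 < d -> exists2 n, (N <= n)%N &
    (forall i, `|w n i - w' i| < d) /\ (forall i, cm (x n i - x' i) < 2 * d).
  move=> d0; have [n Nn nP] := yP d N d0; exists n => //; split=> i.
    exact: (nP (inl i)).
  have h1 := nP (inr (inl i)); have h2 := nP (inr (inr i)).
  rewrite (le_lt_trans (cm_ReIm _)) // mulr2n mulrDl mul1r.
  by move: h1 h2; rewrite /= /x'; case: (x n i) => a b /=; exact: ltrD.
have w'0 i : 0 <= w' i.
  rewrite leNgt; apply/negP => wn; have [|n _ [/(_ i) wi _]] := near (- w' i) 0%N.
    by rewrite oppr_gt0.
  by have := w0 n i; move: wi; rewrite ltr_norml => /andP[]; lra.
have w'1 : \sum_i w' i = 1.
  apply/eqP; rewrite -subr_eq0 -normr_eq0 -(w1 0%N); apply/eqP/le_anti.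
  rewrite normr_ge0 andbT; apply/ler_addgt0Pl => e e0; rewrite addr0.
  have [|n _ [wn _]] := near (e / 3) 0%N; first by rewrite divr_gt0.
  rewrite w1 -(w1 n) -sumrB (le_trans (ler_norm_sum _ _ _)) //.
  have -> : e = \sum_(i < 3) e / 3 by rewrite sumr_const card_ord -mulr_natr; field.
  by apply: ler_sum => i _; rewrite distrC ltW.
have Sx' i : S (x' i).
  apply: cS; apply/closureP => e e0; have [|n _ [_ /(_ i) xn]] := near (e / 2) 0%N.
    by rewrite divr_gt0.
  by exists (x n i) => //; rewrite cm_sub; move: xn; rewrite mulrC divfK.
exists w', x'; split=> //; apply/eqP; rewrite -subr_eq0 -cm_eq0; apply/eqP/le_anti.
rewrite cm_ge0 andbT; apply/ler_addgt0Pl => e e0; rewrite addr0.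
(* Each of the three summands moves by at most [2 * d + M * d], which makes [e / 2] in total; the
   other half is the distance from [z]. *)
pose d := e / (2 * 3 * (2 + M)); have d0 : 0 < d by rewrite divr_gt0 // mulr_gt0 // ltr_wpDr.
have [N _ NP] := near_infty_natSinv_lt (PosNum (divr_gt0 e0 (ltr0Sn _ 1))).
have [n Nn [wn xn]] := near d N d0.
apply: le_trans (cm_split (\sum_i (w n i)%:C * x n i) _ _) _.
have -> : e = e / 2 + \sum_(i < 3) (2 + M) * d.
  rewrite sumr_const card_ord -mulr_natr /d; field.
  by rewrite gt_eqF // ltr_wpDr.
apply: lerD; first by rewrite (le_trans (ltW (zE n))) // ltW // (NP n).
rewrite -sumrB (le_trans (cm_sum _ _ _)) //; apply: ler_sum => i _.
have -> : (w n i)%:C * x n i - (w' i)%:C * x' i =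
  (w n i)%:C * (x n i - x' i) + (w n i - w' i)%:C * x' i.
  by rewrite rmorphB /=; ring.
rewrite (le_trans (cmD _ _)) // !cmM !cm_real mulrDl; apply: lerD.
  by rewrite ger0_norm // (le_trans _ (ltW (xn i))) // ler_piMl // cm_ge0.
by rewrite mulrC; apply: ler_pM; [exact: cm_ge0|by []|exact: SM|exact: ltW].
Qed.

End Caratheodory.

(** * Doubly stochastic matrices *)

Section Birkhoff.

Definition hall (I J : finType) (e : I -> {set J}) :=
  forall A : {set I}, (#|A| <= #|(\bigcup_(i in A) e i)%SET|)%N.

(* Rado: if some [e x] has two points, deleting one of the two preserves Hall's
   condition, because the union of neighbourhoods is submodular. *)
Lemma hall_marriage (I J : finType) (e : I -> {set J}) : hall e ->
  exists2 f : I -> J, injective f & forall i, f i \in e i.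
Proof.
have [n] := ubnP (\sum_i #|e i|)%N; elim: n e => // n IH e; rewrite ltnS => en he.
have [/existsP[x x1]|/existsPn e1] := boolP [exists x, (1 < #|e x|)%N]; last first.
  have e0 i : exists y, e i = [set y]%SET.
    apply/cards1P; have := he [set i]%SET; rewrite cards1 big_set1 => i1.
    by rewrite eqn_leq i1 leqNgt e1.
  have [f fP] := choice e0; exists f => [i j fij|i]; last by rewrite fP set11.
  apply/eqP/contraT => ij; have := he [set i; j]%SET.
  by rewrite cards2 ij finset.bigcup_setU !big_set1 !fP fij finset.setUid cards1.
have [y1 [y2 [ey1 ey2 y12]]] : exists y1 y2, [/\ y1 \in e x, y2 \in e x & y1 != y2].
  by have /card_gt1P[y1 [y2 [? ? ?]]] := x1; exists y1, y2.
pose d y i := if i == x then e i :\ y else e i.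
have dn y : y \in e x -> (\sum_i #|d y i| < n)%N.
  move=> ey; apply: leq_trans en; rewrite (bigD1 x) //= [ltnRHS](bigD1 x) //= /d eqxx.
  rewrite (cardsD1 y (e x)) ey add1n addSn ltnS leq_add2l; apply: leq_sum => i /negbTE ->.
  exact: leqnn.
have de y i : d y i \subset e i by rewrite /d; case: ifP => _ //; exact: subD1set.
have sub y : hall (d y) -> y \in e x -> exists2 f : I -> J, injective f & forall i, f i \in e i.
  by move=> hd ey; have [f fi fP] := IH _ (dn y ey) hd; exists f => // i; apply: fintype.subsetP (fP i).
apply: contrapT => nf.
have bad y : y \in e x -> exists A : {set I}, (#|(\bigcup_(i in A) d y i)%SET| < #|A|)%N.
  move=> ey; apply: contrapT => nA; apply/nf/sub/ey => A.
  by rewrite leqNgt; apply/negP => h; apply: nA; exists A.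
have [A1 h1] := bad y1 ey1; have [A2 h2] := bad y2 ey2.
have xA y (A : {set I}) : (#|(\bigcup_(i in A) d y i)%SET| < #|A|)%N -> x \in A.
  apply: contraLR => xA; rewrite -leqNgt (leq_trans (he A)) // subset_leq_card //.
  apply/bigcupsP => i iA; apply: (bigcup_max i) => //.
  by rewrite /d; case: eqP => // ix; rewrite -ix iA in xA.
set X := (\bigcup_(i in A1) d y1 i)%SET in h1; set Y := (\bigcup_(i in A2) d y2 i)%SET in h2.
have XY : (\bigcup_(i in A1 :|: A2) e i)%SET \subset X :|: Y.
  apply/bigcupsP => i; have [-> _|ix] := eqVneq i x.
    apply/fintype.subsetP => y ey; rewrite inE.
    have [yy1|yy1] := eqVneq y y1.
      apply/orP; right; apply/bigcupP; exists x; first exact: (xA y2).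
      by rewrite /d eqxx !inE ey yy1 y12.
    apply/orP; left; apply/bigcupP; exists x; first exact: (xA y1).
    by rewrite /d eqxx !inE ey yy1.
  rewrite inE => /orP[iA|iA]; [apply: fintype.subset_trans (finset.subsetUl _ _)|apply: fintype.subset_trans (finset.subsetUr _ _)].
    by apply: (bigcup_max i) => //; rewrite /d (negbTE ix).
  by apply: (bigcup_max i) => //; rewrite /d (negbTE ix).
have XYI : (\bigcup_(i in (A1 :&: A2) :\ x) e i)%SET \subset X :&: Y.
  apply/bigcupsP => i; rewrite !inE => /and3P[/negbTE ix iA1 iA2]; rewrite finset.subsetI.
  by apply/andP; split; apply: (bigcup_max i) => //; rewrite /d ix.
have xI : x \in A1 :&: A2 by rewrite inE (xA y1) ?(xA y2).
(* The cardinalities of [X] and [Y] sum to at most those of [A1] and [A2] minus 2, whereas Hall's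
   condition on the union and on the intersection without [x] loses only 1. *)
have := leq_trans (he _) (subset_leq_card XY).
have := leq_trans (he _) (subset_leq_card XYI).
have := cardsUI X Y; have := cardsUI A1 A2; have := cardsD1 x (A1 :&: A2).
rewrite xI; lia.
Qed.

Context {R : realType} {I : finType}.
Local Notation K := R[i].

Lemma positive_diagonal (M : I -> I -> R) (w : R) : 0 < w -> (forall i j, 0 <= M i j) ->
  (forall i, \sum_j M i j = w) -> (forall j, \sum_i M i j = w) ->
  exists s : {perm I}, forall i, 0 < M i (s i).
Proof.
move=> w0 M0 Mr Mc; pose e i := [set j | 0 < M i j]%SET.
have he : hall e.
  move=> A; rewrite -(ler_nat R) -(ler_pM2r w0).
  have -> : #|A|%:R * w = \sum_(i in A) \sum_j M i j.
    by under eq_bigr do rewrite Mr; rewrite sumr_const mulr_natl.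
  have -> : \sum_(i in A) \sum_j M i j = \sum_(i in A) \sum_(j in (\bigcup_(i in A) e i)%SET) M i j.
    apply: eq_bigr => i iA; rewrite [LHS](bigID (mem ((\bigcup_(i in A) e i)%SET))) /=.
    rewrite [X in _ + X]big1 ?addr0 // => j /negP nj; apply/le_anti; rewrite M0 andbT leNgt.
    by apply/negP => Mij; apply: nj; apply/bigcupP; exists i; rewrite ?inE.
  rewrite exchange_big /= (le_trans (y := \sum_(j in (\bigcup_(i in A) e i)%SET) w)) //.
    apply: ler_sum => j _; rewrite -(Mc j) [leRHS](bigID (mem A)) /= lerDl.
    exact: sumr_ge0.
  by rewrite sumr_const mulr_natl.
have [f fi fP] := hall_marriage he; exists (perm fi) => i; rewrite permE.
by have := fP i; rewrite inE.
Qed.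

(** The common sum [w] varies so that multiples of permutation matrices can be split off, each
    killing an entry. The convex set [S] absorbs the resulting combination, which is never written
    out. *)
Lemma birkhoff (S : set R[i]^o) (F : I -> I -> K) (M : I -> I -> R) (w : R) :
  convex_set S -> (forall s : {perm I}, S (\sum_i F i (s i))) -> 0 <= w ->
  (forall i j, 0 <= M i j) ->
  (forall i, \sum_j M i j = w) -> (forall j, \sum_i M i j = w) ->
  exists2 z, S z & \sum_i \sum_j (M i j)%:C * F i j = w%:C * z.
Proof.
move=> /convexP cS SF; have [n] := ubnP #|[pred x : I * I | M x.1 x.2 != 0]|.
elim: n M w => // n IH M w Mn w0 M0 Mr Mc.
have [w00|wN0] := eqVneq w 0.
  exists (\sum_i F i ((1%g : {perm I}) i)); first exact: SF.
  rewrite w00 mul0r big1 // => i _; rewrite big1 // => j _.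
  suff -> : M i j = 0 by rewrite mul0r.
  have := Mr i; rewrite w00 => /eqP; rewrite psumr_eq0 // => /allP/(_ j (mem_index_enum _)).
  by move/eqP.
have wp : 0 < w by rewrite lt_neqAle eq_sym wN0.
have [s sP] := positive_diagonal wp M0 Mr Mc.
have [i1|I0] := pickP (@predT I); last first.
  exists (\sum_i F i (s i)); first exact: SF.
  by rewrite !big1 ?mulr0 // => i; have := I0 i.
move=> _; pose i0 := [arg min_(i < i1) M i (s i)]%O; pose l := M i0 (s i0).
have lM i : l <= M i (s i) by rewrite /l /i0; case: arg_minP => // k _; apply.
pose M' i j := M i j - (if j == s i then l else 0).
have M'0 i j : 0 <= M' i j.
  by rewrite /M'; case: eqP => [->|_]; rewrite ?subr0 // subr_ge0.
have M'r i : \sum_j M' i j = w - l by rewrite sumrB Mr -big_mkcond big_pred1_eq.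
have M'c j : \sum_i M' i j = w - l.
  rewrite sumrB Mc -big_mkcond (big_pred1 (s^-1%g j)) // => i /=.
  by rewrite eq_sym (canF_eq (permK s)) eq_sym.
have lw : 0 <= w - l by rewrite -(M'r i0) sumr_ge0.
have [||//|//|//|z Sz zE] := IH M' (w - l); rewrite //.
  rewrite -ltnS; apply: leq_trans Mn; apply: proper_card; apply/properP; split.
    apply/fintype.subsetP => -[i j]; rewrite !inE /=; apply: contraNneq => Mij.
    have := M'0 i j; rewrite /M' Mij sub0r oppr_ge0; case: eqP => [ji|_ _]; last by rewrite oppr0.
    by move=> l0; have := sP i0; rewrite -/l ltNge l0.
  exists (i0, s i0); rewrite !inE /=; first by rewrite gt_eqF.
  by rewrite /M' eqxx subrr eqxx.
have -> : \sum_i \sum_j (M i j)%:C * F i j = (w - l)%:C * z + l%:C * \sum_i F i (s i).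
  rewrite -zE mulr_sumr -big_split; apply: eq_bigr => i _ /=.
  rewrite [LHS](bigD1 (s i)) // [X in _ = X + _](bigD1 (s i)) //=.
  rewrite /M' eqxx rmorphB mulrBl /= -!addrA; congr (_ + _).
  rewrite [RHS]addrC -addrA subrr addr0.
  by apply: eq_bigr => j /negbTE ->; rewrite subr0.
exists ((l / w)%:C * \sum_i F i (s i) + (1 - l / w)%:C * z).
  apply: cS => //; rewrite divr_ge0 ?(ltW (sP i0)) //= ler_pdivrMr // mul1r.
  by rewrite -subr_ge0.
rewrite mulrDr !mulrA -!rmorphM /= mulrBr mulr1 mulrCA divff // mulr1 addrC //.
Qed.

End Birkhoff.

Lemma extend_bij (g : nat -> nat) N :
  (forall i j, (i < N)%N -> (j < N)%N -> g i = g j -> i = j) ->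
  exists2 s : nat -> nat, bijective s & forall i, (i < N)%N -> s i = g i.
Proof.
move=> gi; have AC := infinite_setC (finite_II N).
have BC := infinite_setC (finite_image g (finite_II N)).
have /card_set_bijP[k [kf ki ks]] := infinite_nat_card AC BC.
pose s i := if (i < N)%N then g i else k i.
have kN i : (N <= i)%N -> forall j, (j < N)%N -> g j <> k i.
  by move=> Ni j jN gk; apply: (kf i); [rewrite /= ltnNge Ni|exists j].
exists s => [|i iN]; last by rewrite /s iN.
rewrite -setTT_bijective; split=> // [i j _ _|y _].
  rewrite /s; case: ltnP => iN; case: ltnP => jN; first exact: gi.
  - by move=> /(kN _ jN _ iN).
  - by move=> /esym /(kN _ iN _ jN).
  - by apply: ki; rewrite inE /=; apply/negP; rewrite -leqNgt.
have [[i iN <-]|yB] := pselect ((g @` `I_N) y).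
  by exists i => //; rewrite /s (iN : (i < N)%N).
have [i iN <-] := ks y yB; exists i => //.
by rewrite /s ifN //; apply/negP.
Qed.

(** * The C-spectrum *)

Section Spectrum.
Context {R : realType} {H : hilbertType R}.
Local Notation K := R[i].
Local Notation cvc := (@cvs R (R[i]^o)).
Implicit Types (u f h : nat -> H) (p q : \bar R) (c t : nat -> K).

(** The C-spectrum for one choice of the two sequences, which may be in any order. *)
Definition pairings c t : set R[i]^o := [set z |
  exists2 s : nat -> nat, bijective s & cvc (fun n => \sum_(k < n) c k * t (s k)) z].

Section Pairings.
Variables (p q : \bar R) (C T : {linear H -> H}) (h f : nat -> H) (c t : nat -> K).
Hypothesis pq : conj_exp p q.
Hypothesis Cp : schatten p C.
Hypothesis Tq : schatten q T.
Hypothesis Cd : diag C h c.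
Hypothesis Td : diag T f t.

Lemma range_tail (e : R) : 0 < e -> exists N, forall u, onb u -> forall n,
  \sum_(N <= k < n) cm (c k * qf T (u k)) <= e.
Proof.
move=> e0; have [p1 q1 _] := pq; have [M TM] := schatten_ball q1 Tq.
have [N NP] := holder_tail pq (fun k => cm_ge0 (c k)) (diag_tail p1 Cp Cd) M e0.
exists N => u [uon _] n; under eq_bigr do rewrite cmM.
apply: NP => [k|]; first exact: cm_ge0.
by apply: TM; exact: on_bessel.
Qed.

Lemma range_tail_lim (e : R) : 0 < e -> exists N, forall u z, onb u ->
  cvc (fun n => \sum_(k < n) c k * qf T (u k)) z ->
  cm (z - \sum_(k < N) c k * qf T (u k)) <= e.
Proof.
move=> e0; have [N NP] := range_tail e0; exists N => u z ub uz.
apply: (cvs_bound (N := N) uz) => n Nn.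
rewrite (sum_split (fun k => c k * qf T (u k)) Nn) addrAC subrr add0r.
by apply: le_trans (nm_sum _ _ _) _; exact: NP.
Qed.

Lemma pairings_range : pairings c t `<=` C_numerical_range C T.
Proof.
move=> z [s sb sz]; apply/(range_diag_left _ pq Cp Tq Cd); have [fb _] := Td.
exists (f \o s); first exact: onb_reindex.
by apply: eq_cvs sz => n; apply: eq_bigr => k _; rewrite /qf (diag_coef _ Td).
Qed.

Lemma pairing_cvg (s : nat -> nat) : bijective s ->
  exists z, cvc (fun n => \sum_(k < n) c k * t (s k)) z.
Proof.
move=> sb; have [fb _] := Td; have fsb := onb_reindex sb fb.
apply: (@scalar_complete _ _ (f 0%N) (fun k => c k * t (s k))).
  by case: fb => fon _; exact: on_nm.
move=> e /range_tail[N NP]; exists N => m n Nm mn.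
apply: le_trans (NP _ fsb n); under [leRHS]eq_bigr do rewrite /qf (diag_coef _ Td).
rewrite (big_cat_nat Nm mn) /= lerDr; apply: sumr_ge0 => k _; exact: cm_ge0.
Qed.

Lemma qf_diag x : cvc (fun n => \sum_(j < n) t j * (cm (ip (f j) x) ^+ 2)%:C) (qf T x).
Proof.
have [M TM] := schatten_bnd Tq; have [[fon fx] Tf] := Td.
apply: eq_cvs (cvs_ipr x (fx (T x))) => n; rewrite ip_sumr; apply: eq_bigr => j _.
by rewrite ipZr (diag_ip _ _ TM Td) -mulrA cm2 -ipC [ip x _ * _]mulrC.
Qed.

Lemma range_approx z (e : R) : C_numerical_range C T z -> 0 < e ->
  exists2 s, conv_hull (pairings c t) s & cm (z - s) < e.
Proof.
move=> /(range_diag_left _ pq Cp Tq Cd)[u ub uz] e0.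
have [uon _] := ub; have [fb Tf] := Td; have [fon _] := fb.
(* Four errors of size [d] occur: the truncations at [N] and at [J], and two inside [S], namely the
   far away entries and the tail of the completed pairing. *)
pose d := e / 5; have d0 : 0 < d by rewrite divr_gt0.
have [N NP] := range_tail_lim d0.
pose q1 := \sum_(k < N) c k * qf T (u k).
pose D i j := cm (ip (f j) (u i)) ^+ 2.
have [J JP] : exists J, cm (q1 - \sum_(i < N) \sum_(j < J) (D i j)%:C * (c i * t j)) <= d.
  have : cvc (fun n => \sum_(i < N) c i *: (\sum_(j < n) t j * (D i j)%:C : R[i]^o)) q1.
    by apply: cvs_sum => i; apply: cvsZ; exact: qf_diag.
  move=> /(_ d d0)[J JP]; exists J; rewrite cm_sub ltW //; apply: le_lt_trans (JP J (leqnn J)).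
  rewrite nm_cm le_eqVlt; apply/orP; left; apply/eqP; congr (cm (_ - _)).
  apply: eq_bigr => i _; rewrite [RHS]mulr_sumr; apply: eq_bigr => j _ /=; ring.
pose s1 := \sum_(k < N) cm (c k); have s10 : 0 <= s1 by apply: sumr_ge0 => k _; exact: cm_ge0.
(* Terms with an entry of [t] below [eta] contribute at most [s1 * eta], hence at most [d],
   altogether. *)
pose eta := d / (1 + s1); have eta0 : 0 < eta by rewrite divr_gt0 // ltr_pwDl.
have s1eta : s1 * eta <= d.
  by rewrite mulrCA ler_piMr ?(ltW d0) // ler_pdivrMr ?ltr_pwDl // mul1r lerDr.
have [J1 J1P] := diag_cvs0 (compact_seqcpt Tq.1) Td eta0.
pose J2 := maxn J J1; pose I := ('I_N + 'I_J)%type.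
pose F (a b : I) := match a, b with inl i, inr j => c i * t j | _, _ => 0 end.
pose r i := \sum_(j < J) D i j; pose cc j := \sum_(i < N) D i j.
(* Doubly stochastic dilation of [D]: the off-diagonal blocks are [D] and its transpose, and the
   diagonal blocks hold what the rows and columns lack. [F] is nonzero only on the block of [D]. *)
pose M (a b : I) : R := match a, b with
  | inl i, inl i' => (i == i')%:R * (1 - r i)
  | inl i, inr j => D i j
  | inr j, inl i => D i j
  | inr j, inr j' => (j == j')%:R * (1 - cc j)
  end.
pose S : set R[i]^o := [set x | exists2 s, conv_hull (pairings c t) s & cm (x - s) <= 2 * d].
have hc : convex_set (conv_hull (pairings c t)) by exact: hull_convex.
have cS : convex_set S.
  apply/convexP => x y l l01 [x' hx' xx'] [y' hy' yy'].
  exists (l%:C * x' + (1 - l)%:C * y'); first exact: (iffLR (convexP _) hc).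
  have -> : l%:C * x + (1 - l)%:C * y - (l%:C * x' + (1 - l)%:C * y') =
    l%:C * (x - x') + (1 - l)%:C * (y - y') by ring.
  case/andP: l01 => l0 l1; rewrite (le_trans (cmD _ _)) // !cmM !cm_real !ger0_norm ?subr_ge0 //.
  move: xx' yy'; set a := cm _; set b := cm _ => *; nra.
have SF (s : {perm I}) : S (\sum_a F a (s a)).
  (* A matched row goes to its column. An unmatched row [i] goes to [J2 + i]: beyond [J], so that
     nothing collides, and beyond [J1], where [t] is small. The value for [k >= N] is a dummy. *)
  pose g k := if insub k is Some i then
    if s (inl i) is inr j then val j else (J2 + k)%N else 0%N.
  have gE (i : 'I_N) : g i = if s (inl i) is inr j then val j else (J2 + i)%N.
    by rewrite /g valK.
  have gi k k' : (k < N)%N -> (k' < N)%N -> g k = g k' -> k = k'.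
    move=> kN k'N; rewrite (gE (Ordinal kN)) (gE (Ordinal k'N)) /=.
    case E : (s _) => [a|j]; case E' : (s _) => [a'|j'].
    - exact: addnI.
    - by have := ltn_ord j'; rewrite /J2; lia.
    - by have := ltn_ord j; rewrite /J2; lia.
    - move=> /val_inj jj'; have := E; rewrite jj' -E' => /perm_inj.
      by move=> [].
  have [sg sgb sgE] := extend_bij gi.
  have [z' z'P] := pairing_cvg sgb.
  exists z'; first by move=> A [_]; apply; exists sg.
  have z'N : cm (z' - \sum_(k < N) c k * t (sg k)) <= d.
    have := NP (f \o sg) z' (onb_reindex sgb fb).
    have E n : \sum_(k < n) c k * qf T ((f \o sg) k) = \sum_(k < n) c k * t (sg k).
      by apply: eq_bigr => k _; rewrite /qf (diag_coef _ Td).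
    by rewrite E; apply; apply: eq_cvs z'P => n; rewrite E.
  apply: le_trans (cm_split (\sum_(k < N) c k * t (sg k)) _ _) _.
  rewrite mulr2n mulrDl mul1r; apply: lerD; last by rewrite cm_sub.
  rewrite big_sumType /= [X in _ + X - _]big1 ?addr0 // -sumrB.
  apply: le_trans (cm_sum _ _ _) _; apply: le_trans s1eta.
  rewrite mulr_suml; apply: ler_sum => i _.
  rewrite sgE // gE; case E : (s _) => [a|j]; last first.
    by rewrite subrr cm0 mulr_ge0 ?cm_ge0 ?ltW.
  rewrite sub0r cmN cmM ler_wpM2l ?cm_ge0 // J1P //.
  exact: leq_trans (leq_maxr J J1) (leq_addr _ _).
have sumI (G : I -> R) : \sum_a G a = \sum_i G (inl i) + \sum_j G (inr j).
  exact: big_sumType.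
have Msym a b : M a b = M b a.
  by case: a b => [i|j] [i'|j'] //=; rewrite eq_sym; case: eqP => [->|_]; rewrite ?mul0r.
have M0 a b : 0 <= M a b.
  case: a b => [i|j] [i'|j'] /=; rewrite ?mulr_ge0 ?exprn_ge0 ?cm_ge0 ?subr_ge0 ?ler0n //.
    by rewrite (le_trans (on_bessel fon _ _)) // on_nm // expr1n.
  rewrite /cc; under eq_bigr do rewrite /D ipC cmC.
  by rewrite (le_trans (on_bessel uon _ _)) // on_nm // expr1n.
have delta k (i : 'I_k) (x : 'I_k -> R) : \sum_j (i == j)%:R * x i = x i.
  rewrite (bigD1 i) //= eqxx mul1r big1 ?addr0 // => j ji.
  by rewrite eq_sym (negbTE ji) mul0r.
have Mr a : \sum_b M a b = 1.
  rewrite sumI; case: a => [i|j] /=.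
    by rewrite (delta _ i (fun i => 1 - r i)) subrK.
  by rewrite (delta _ j (fun j => 1 - cc j)) addrC subrK.
have Mc b : \sum_a M a b = 1 by under eq_bigr do rewrite Msym; exact: Mr.
have [x [y hy xy] xE] := birkhoff cS SF ler01 M0 Mr Mc.
exists y => //; have {}xE : \sum_(i < N) \sum_(j < J) (D i j)%:C * (c i * t j) = x.
  rewrite mul1r in xE; rewrite -xE big_sumType /= [X in _ = _ + X]big1 ?addr0.
    apply: eq_bigr => i _; rewrite big_sumType /= [X in _ = X + _]big1 ?add0r // => i' _.
    by rewrite mulr0.
  by move=> j _; rewrite big1 // => a _; rewrite mulr0.
rewrite xE in JP; apply: le_lt_trans (cm_split q1 _ _) _.
apply: le_lt_trans (lerD (NP _ _ ub uz) (cm_split x _ _)) _.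
by move: JP xy; rewrite /d; lra.
Qed.

End Pairings.
End Spectrum.

(** * Convexity and the two inclusions for normal operators *)

Section NormalCase.
Context {R : realType} {H : hilbertType R}.
Variable Hsep : exists2 D : set H, countable D & dense D.
Variable Hinf : ~ finite_dim [set: H].
Local Notation K := R[i].
Implicit Types (A C T : {linear H -> H}) (p q : \bar R).

Lemma normal_op_diag A : compact_op A -> normal_op A -> exists e t, diag A e t.
Proof.
move=> Ac An; have [e eb] := onb_exists Hsep Hinf; have [M AM] := compact_bnd Ac.
have AB := riesz_adjoint eb AM.
exact: (@normal_diag _ _ A (mklin (isadj_linear AB)) M AM AB An (compact_seqcpt Ac) Hsep Hinf).
Qed.

Lemma normal_op_modified A : compact_op A -> normal_op A ->
  exists t e, modified_eigenvalue_seq A t /\ diag A e t.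
Proof.
move=> Ac An; have [f [s Ad]] := normal_op_diag Ac An; have [M AM] := compact_bnd Ac.
have [t tP] := modified_exists AM Ad (diag_cvs0 (compact_seqcpt Ac) Ad).
by have [e ed] := modified_diag AM Ad tP; exists t, e.
Qed.

Lemma range_convex_right p q C T : conj_exp p q -> schatten p C -> schatten q T ->
  normal_op T -> collinear_eigenvalues T -> convex_set (closure (C_numerical_range C T)).
Proof.
move=> pq Cp Tq Tn Tcol; have [p1 q1 _] := pq; have [Tc _] := Tq.
have [f [t Td]] := normal_op_diag Tc Tn.
have [d [r tE]] := diag_collinear (compact_seqcpt Tc) Td Tcol.
have := range_convex Hsep Hinf (conj_exp_sym pq) Cp (diag_tail q1 Tq Td) tE.
suff -> : C_numerical_range C T = [set z | exists2 u, onb u &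
    @cvs R (R[i]^o) (fun n => \sum_(k < n) t k * qf C (u k)) z] by [].
by apply/seteqP; split=> z /(range_diag_right z pq Cp Tq Td).
Qed.

Lemma range_convex_left p q C T : conj_exp p q -> schatten p C -> schatten q T ->
  normal_op C -> collinear_eigenvalues C -> convex_set (closure (C_numerical_range C T)).
Proof.
move=> pq Cp Tq Cn Ccol; have [p1 q1 _] := pq; have [Cc _] := Cp.
have [h [c Cd]] := normal_op_diag Cc Cn.
have [d [r cE]] := diag_collinear (compact_seqcpt Cc) Cd Ccol.
have := range_convex Hsep Hinf pq Tq (diag_tail p1 Cp Cd) cE.
suff -> : C_numerical_range C T = [set z | exists2 u, onb u &
    @cvs R (R[i]^o) (fun n => \sum_(k < n) c k * qf T (u k)) z] by [].
by apply/seteqP; split=> z /(range_diag_left z pq Cp Tq Cd).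
Qed.

Lemma spectrum_sub_range p q C T : conj_exp p q -> schatten p C -> schatten q T ->
  normal_op C -> normal_op T -> C_spectrum C T `<=` C_numerical_range C T.
Proof.
move=> pq Cp Tq Cn Tn z [c [t [s [cP tP sb sz]]]]; have [Cc _] := Cp; have [Tc _] := Tq.
have [h0 [c0 Cd0]] := normal_op_diag Cc Cn; have [MC CM] := compact_bnd Cc.
have [f0 [t0 Td0]] := normal_op_diag Tc Tn; have [MT TM] := compact_bnd Tc.
have [h Cd] := modified_diag CM Cd0 cP; have [f Td] := modified_diag TM Td0 tP.
apply: (pairings_range pq Cp Tq Cd Td); exists s => //.
by apply/cvsP; move: sz; rewrite seriesE.
Qed.

Lemma range_bounded p q C T : conj_exp p q -> schatten p C -> schatten q T ->
  normal_op C -> exists M, forall z, C_numerical_range C T z -> cm z <= M.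
Proof.
move=> pq Cp Tq Cn; have [Cc _] := Cp; have [h [c Cd]] := normal_op_diag Cc Cn.
have [M [M0 TM]] := schatten_bnd Tq; have [N NP] := range_tail_lim pq Cp Tq Cd ltr01.
exists (1 + \sum_(k < N) cm (c k) * M) => z /(range_diag_left z pq Cp Tq Cd)[u ub uz].
have [uon _] := ub; rewrite -[z]subr0.
apply: le_trans (cm_split (\sum_(k < N) c k * qf T (u k)) _ _) _; rewrite subr0.
apply: lerD; first exact: NP.
apply: le_trans (cm_sum _ _ _) _; apply: ler_sum => k _; rewrite cmM ler_wpM2l ?cm_ge0 //.
apply: le_trans (cauchy_schwarz _ _) _; rewrite on_nm // mul1r.
by rewrite (le_trans (TM _)) // on_nm // mulr1.
Qed.

(** The spectrum lies in the bounded range, and its closure inherits the bound that [hull_closed]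
    asks for. *)
Lemma hull_spectrum_closed p q C T : conj_exp p q -> schatten p C -> schatten q T ->
  normal_op C -> normal_op T -> closed (conv_hull (closure (C_spectrum C T)) : set R[i]^o).
Proof.
move=> pq Cp Tq Cn Tn; have [M MP] := range_bounded pq Cp Tq Cn.
apply: (hull_closed (M := M)); first exact: closed_closure.
move=> x /closureP xP; apply/ler_addgt0Pl => e /xP[y /(spectrum_sub_range pq Cp Tq Cn Tn)/MP yM xy].
have := cm_split y x 0; rewrite !subr0 => /le_trans; apply.
by rewrite lerD // ltW.
Qed.

Lemma range_sub_hull p q C T : conj_exp p q -> schatten p C -> schatten q T ->
  normal_op C -> normal_op T ->
  C_numerical_range C T `<=` conv_hull (closure (C_spectrum C T)).
Proof.
move=> pq Cp Tq Cn Tn z zW; have [Cc _] := Cp; have [Tc _] := Tq.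
have [c [h [cP Cd]]] := normal_op_modified Cc Cn.
have [t [f [tP Td]]] := normal_op_modified Tc Tn.
apply: (hull_spectrum_closed pq Cp Tq Cn Tn); apply/closureP => e e0.
have [s sP zs] := range_approx pq Cp Tq Cd Td zW e0.
exists s => //; apply: sP; split; first exact: hull_convex.
move=> x [sg sgb sx] A [_]; apply; apply: subset_closure; exists c, t, sg; split=> //.
by rewrite seriesE; apply/cvsP.
Qed.

End NormalCase.

Theorem theorem3p10 (R : realType) (H : hilbertType R)
  (Hsep : exists2 D : set H, countable D & dense D)
  (Hinf : ~ finite_dim [set: H])
  (p q : \bar R) (p1 : (1 <= p)%E) (q1 : (1 <= q)%E)
  (pq : (p^-1 + q^-1 = 1)%E)
  (C T : {linear H -> H}) (Cp : schatten p C) (Tq : schatten q T) :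
  [/\ (normal_op C /\ collinear_eigenvalues C \/
       normal_op T /\ collinear_eigenvalues T ->
       convex_set (closure (C_numerical_range C T))),
      (normal_op C -> normal_op T ->
       C_spectrum C T `<=` C_numerical_range C T /\
       C_numerical_range C T `<=` conv_hull (closure (C_spectrum C T))) &
      (normal_op C -> normal_op T ->
       collinear_eigenvalues C \/ collinear_eigenvalues T ->
       closure (C_numerical_range C T) =
         conv_hull (closure (C_spectrum C T)))].
Proof.
have cpq : conj_exp p q by split.
have cvx : normal_op C /\ collinear_eigenvalues C \/
    normal_op T /\ collinear_eigenvalues T -> convex_set (closure (C_numerical_range C T)).
  case=> -[An Acol]; first exact: (range_convex_left Hsep Hinf cpq Cp Tq An Acol).
  exact: (range_convex_right Hsep Hinf cpq Cp Tq An Acol).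
split=> // [Cn Tn|Cn Tn col].
  split; first exact: (spectrum_sub_range Hsep Hinf cpq Cp Tq Cn Tn).
  exact: (range_sub_hull Hsep Hinf cpq Cp Tq Cn Tn).
apply/seteqP; split.
  have cl := hull_spectrum_closed Hsep Hinf cpq Cp Tq Cn Tn.
  apply: subset_trans cl; apply: closureS.
  exact: (range_sub_hull Hsep Hinf cpq Cp Tq Cn Tn).
(* The closed range is one of the convex sets whose intersection is the hull. *)
move=> z; apply; split; first by apply: cvx; case: col => ?; [left|right].
by apply: closureS; exact: (spectrum_sub_range Hsep Hinf cpq Cp Tq Cn Tn).
Qed.
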